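(* Let $v=(v(x),\,x\in\mathbb{R}^k)$ be a centered continuous $\mathbb{R}^d$-valued Gaussian random field with i.i.d. components. Suppose that, with given exponents $\gamma_1,\dots,\gamma_k>0$ (and $\alpha_j=(\gamma_j+1)^{-1}$), Assumption A and Assumption B (both defined in the context) hold for all sufficiently small closed boxes $I\subset\mathbb{R}^k$, i.e. there is $\eta>0$ such that they hold for every closed box $I$ of diameter less than $\eta$. Let $Q=\sum_{j=1}^k(\gamma_j+1)=\sum_{j=1}^k\alpha_j^{-1}$ and assume that $Q=d$. Then for every closed box $J\subset\mathbb{R}^k$ and all $z\in\mathbb{R}^Q$, $$P\{\exists x\in J:\ v(x)=z\}=0.$$
   Context: Notation: $\mathbb{R}_+=[0,\infty[$, $|\cdot|$ is the Euclidean norm, $\|X\|_{L^2}=(E|X|^2)^{1/2}$. An $\mathbb{R}^d$-valued white noise based on a measure $\nu$ on $\mathcal{B}(\mathbb{R}_+)$ is a set function $A\mapsto W(A)$ such that each $W(A)$ is a centered normal random vector in $\mathbb{R}^d$ with covariance matrix $\nu(A)\cdot I_d$, and for disjoint $A,B$: $W(A\cup B)=W(A)+W(B)$ and $W(A),W(B)$ are independent. A closed box is a set $I=\prod_{j=1}^k[c_j,d_j]$ with $c_j<d_j$; $I^{(\varepsilon)}$ is the $\varepsilon$-enlargement of $I$ in Euclidean norm. Given $\gamma_j>0$, set $\alpha_j=(\gamma_j+1)^{-1}\in\,]0,1[$, $\Delta(x,y)=\sum_{j=1}^k|x_j-y_j|^{\alpha_j}$, and $d(x,y)=\|v(x)-v(y)\|_{L^2}$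 (canonical metric). Assumption A for the closed box $I$: there is a Gaussian random field $(v(A,x),\,A\in\mathcal{B}(\mathbb{R}_+),\,x\in\mathbb{R}^k)$ and $\varepsilon_0>0$ such that: (a) for all $x\in I^{(\varepsilon_0)}$, $A\mapsto v(A,x)$ is an $\mathbb{R}^d$-valued white noise (based on a measure that may depend on $x$), $v(\mathbb{R}_+,x)=v(x)$, and when $A$ and $B$ are disjoint, $v(A,\cdot)$ and $v(B,\cdot)$ are independent; (b) there are constants $c_0,a_0\in\mathbb{R}_+$ such that for all $a_0\le a\le b\le+\infty$ and $x,y\in I^{(\varepsilon_0)}$, $$\|v([a,b[,x)-v(x)-v([a,b[,y)+v(y)\|_{L^2}\le c_0\Big[\sum_{j=1}^k a^{\gamma_j}|x_j-y_j|+b^{-1}\Big]$$ (with $b^{-1}=0$ if $b=+\infty$) and $$\|v([0,a_0],x)-v([0,a_0],y)\|_{L^2}\le c_0\sum_{j=1}^k|x_j-y_j|.$$ Assumption B for the closed box $I$ (with $\varepsilon_0$ as in Assumption A): (a) there are constants $c>0$, $\tilde c>0$ such that for all $x,y\in I^{(\varepsilon_0)}$, $d(x,y)\ge c\,\Delta(x,y)$ and $\|v(x)\|_{L^2}\ge\tilde c$; (b) there is $\rho>0$ with the following property: for each $x\in I$ there are $x'\in I^{(\varepsilon_0)}$, $\delta_j\in\,]\alpha_j,1]$ ($j=1,\dots,k$) and $C>0$ such that for all $y,\bar y\in I^{(\varepsilon_0)}$ with $\Delta(x,y)\le2\rho$ and $\Delta(x,\bar y)\le2\rho$, and all $i\in\{1,\dots,d\}$,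 $$\big|E[(v_i(y)-v_i(\bar y))\,v_i(x')]\big|\le C\sum_{j=1}^k|y_j-\bar y_j|^{\delta_j}.$$ *)

(* Defs.v *)
From HB Require Import structures.
From mathcomp Require Import all_boot all_order all_algebra.
From mathcomp Require Import all_classical all_reals all_analysis.
Set Implicit Arguments.
Unset Strict Implicit.
Unset Printing Implicit Defensive.
Import Order.TTheory GRing.Theory Num.Theory.
Import numFieldNormedType.Exports.
Local Open Scope classical_set_scope.
Local Open Scope ring_scope.

(* Vectors of R^n are row vectors 'rV[R]_n.  The norm `|x| that MathComp-Analysis
   puts on 'rV[R]_n is the sup norm; the Euclidean norm is [enorm]. *)

Section Euclid.
Context {R : realType} {n : nat}.
Implicit Types (x y lo hi : 'rV[R]_n).

Definition enorm x : R := Num.sqrt (\sum_(j < n) x 0 j ^+ 2).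

Definition closed_box lo hi : set 'rV[R]_n :=
  [set x | forall j, lo 0 j <= x 0 j <= hi 0 j].

Definition box_ends lo hi := forall j, lo 0 j < hi 0 j.

Definition diameter (A : set 'rV[R]_n) : R :=
  sup [set r | exists x y, [/\ A x, A y & r = enorm (x - y)]].

Definition enlargement (A : set 'rV[R]_n) (eps : R) : set 'rV[R]_n :=
  [set x | exists2 y, A y & enorm (x - y) < eps].

End Euclid.

Section Gaussian.
Context {R : realType} {disp : measure_display} {Omega : measurableType disp}.
Variable P : probability Omega R.

(* N(m, s^2).  At s = 0 the library's [normal_prob] is not the point mass. *)
Definition gaussian_law (m s : R) : set R -> \bar R :=
  if s == 0 then \d_m else normal_prob m s.

Definition gaussian_rv (X : Omega -> R) :=
  measurable_fun setT X /\
  exists m s : R, forall B : set R, measurable B ->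
    P (X @^-1` B) = gaussian_law m s B.

(* Joint normality of the field (X t, t in D): all finite linear combinations
   of the components of finitely many X t are normal, possibly degenerate. *)
Definition gaussian_field (n : nat) (T : Type) (D : set T)
    (X : T -> Omega -> 'rV[R]_n) :=
  forall (m : nat) (t : 'I_m -> T) (a : 'I_m -> 'rV[R]_n),
    (forall l, D (t l)) ->
    gaussian_rv (fun w => \sum_(l < m) \sum_(i < n) a l 0 i * X (t l) w 0 i).

Definition gaussian_vector (n : nat) (X : Omega -> 'rV[R]_n) :=
  gaussian_field [set: unit] (fun=> X).

Definition centered_field (n : nat) (T : Type) (X : T -> Omega -> 'rV[R]_n) :=
  forall t i, ('E_P[fun w => X t w 0%R i] = 0)%E.

(* The sigma-algebra on S generated by the real functions X t. *)
Definition sigma_of (S T : Type) (X : T -> S -> R) : set (set S) :=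
  <<s \bigcup_t preimage_set_system setT (X t) (@measurable _ R) >>.

Definition independent_processes (T U : Type)
    (X : T -> Omega -> R) (Y : U -> Omega -> R) :=
  forall E F, sigma_of X E -> sigma_of Y F -> P (E `&` F) = (P E * P F)%E.

Definition mutually_independent (I : finType) (T : Type)
    (X : I -> T -> Omega -> R) :=
  forall (K : {set I}) (E : I -> set Omega),
    (forall i, sigma_of (X i) (E i)) ->
    P (\bigcap_(i in [set` K]) E i) = (\prod_(i in K) P (E i))%E.

(* Equality of the laws of X and Y on R^T with its product sigma-algebra. *)
Definition same_law (T : Type) (X Y : T -> Omega -> R) :=
  forall E : set (T -> R), sigma_of (fun t (f : T -> R) => f t) E ->
    P [set w | E (X ^~ w)] = P [set w | E (Y ^~ w)].

Definition iid_components (n : nat) (T : Type) (X : T -> Omega -> 'rV[R]_n) :=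
  let comp := fun (i : 'I_n) (t : T) w => X t w 0 i in
  mutually_independent comp /\ forall i j, same_law (comp i) (comp j).

Definition L2norm (n : nat) (X : Omega -> 'rV[R]_n) : \bar R :=
  Lnorm P 2%:E (fun w => (enorm (X w))%:E).

(* B(R_+), as Borel subsets of R contained in [0, +oo[. *)
Definition borelRp (A : set R) := measurable A /\ A `<=` `[0, +oo[.

(* Only the values of W and nu on B(R_+) matter. *)
Definition white_noise (n : nat) (nu : {measure set R -> \bar R})
    (W : set R -> Omega -> 'rV[R]_n) :=
  (forall A, borelRp A ->
    [/\ gaussian_vector (W A),
        forall i, ('E_P[fun w => W A w 0%R i] = 0)%E
      & forall i j, covariance P (fun w => W A w 0 i) (fun w => W A w 0 j) =
          if i == j then nu A else 0%E]) /\
  (forall A B, borelRp A -> borelRp B -> A `&` B = set0 ->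
    {ae P, forall w, W (A `|` B) w = W A w + W B w} /\
    independent_processes (fun (i : 'I_n) w => W A w 0 i)
                          (fun (i : 'I_n) w => W B w 0 i)).

End Gaussian.

Section Assumptions.
Context {R : realType} {disp : measure_display} {Omega : measurableType disp}.
Variable P : probability Omega R.
Context {k d : nat}.
Variables (gamma : 'I_k -> R) (v : 'rV[R]_k -> Omega -> 'rV[R]_d).
Variables (box : set 'rV[R]_k) (eps0 : R).

Definition alpha (j : 'I_k) : R := (gamma j + 1)^-1.

Definition Delta (x y : 'rV[R]_k) : R :=
  \sum_(j < k) `|x 0 j - y 0 j| `^ alpha j.

Definition canonical_metric (x y : 'rV[R]_k) : \bar R :=
  L2norm P (fun w => v x w - v y w).

(* In (b), b ranges over the extended reals; in \bar R, +oo^-1 = 0 and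
   0^-1 = +oo, so that the bound is uninformative in the corner case b = 0. *)
Definition assumptionA :=
  exists V : set R -> 'rV[R]_k -> Omega -> 'rV[R]_d,
  [/\ gaussian_field P [set Ax : set R * 'rV[R]_k | borelRp Ax.1]
        (fun Ax => V Ax.1 Ax.2),
      forall x, enlargement box eps0 x ->
        (exists nu : {measure set R -> \bar R},
           white_noise P nu (fun A => V A x)) /\
        {ae P, forall w, V `[0%R, +oo[%classic x w = v x w},
      forall A B, borelRp A -> borelRp B -> A `&` B = set0 ->
        independent_processes P
          (fun (xi : 'rV[R]_k * 'I_d) w => V A xi.1 w 0 xi.2)
          (fun (xi : 'rV[R]_k * 'I_d) w => V B xi.1 w 0 xi.2)
    & exists c0 a0 : R, [/\ 0 <= c0, 0 <= a0,
        forall (a : R) (b : \bar R) (x y : 'rV[R]_k),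
          a0 <= a -> (a%:E <= b)%E ->
          enlargement box eps0 x -> enlargement box eps0 y ->
          let ab := [set t : R | a <= t /\ (t%:E < b)%E] in
          (L2norm P (fun w => (V ab x w - v x w - V ab y w + v y w)%R) <=
            c0%:E * ((\sum_(j < k) a `^ gamma j * `|x 0 j - y 0 j|)%R%:E
                     + b^-1))%E
      & forall x y : 'rV[R]_k, enlargement box eps0 x -> enlargement box eps0 y ->
          (L2norm P (fun w => (V `[0%R, a0]%classic x w - V `[0%R, a0]%classic y w)%R) <=
            (c0 * \sum_(j < k) `|x 0 j - y 0 j|)%R%:E)%E]].

Definition assumptionB :=
  (exists c ctilde : R, [/\ 0 < c, 0 < ctilde &
     forall x y : 'rV[R]_k, enlargement box eps0 x -> enlargement box eps0 y ->
       ((c * Delta x y)%:E <= canonical_metric x y)%E /\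
       (ctilde%:E <= L2norm P (v x))%E]) /\
  (exists2 rho : R, 0 < rho &
     forall x, box x ->
     exists x' : 'rV[R]_k, enlargement box eps0 x' /\
     exists (delta : 'I_k -> R) (C : R),
     [/\ forall j, alpha j < delta j <= 1, 0 < C &
       forall y ybar : 'rV[R]_k,
         enlargement box eps0 y -> enlargement box eps0 ybar ->
         Delta x y <= 2 * rho -> Delta x ybar <= 2 * rho ->
         forall i : 'I_d,
         (`| 'E_P[fun w => ((v y w 0 i - v ybar w 0 i) * v x' w 0 i)%R] | <=
           (C * \sum_(j < k) `|y 0 j - ybar 0 j| `^ delta j)%R%:E)%E]).

End Assumptions.

(* Main.v *)
From HB Require Import structures.
Require Import Defs.
From mathcomp Require Import all_boot all_order all_algebra.
From mathcomp Require Import all_classical all_reals all_analysis measurable_realfun.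
From mathcomp Require Import ring lra zify.
Set Implicit Arguments.
Unset Strict Implicit.
Unset Printing Implicit Defensive.
Import Order.TTheory GRing.Theory Num.Theory.
Import numFieldNormedType.Exports.
Local Open Scope classical_set_scope.
Local Open Scope ring_scope.

(** Around a point [x0], a dyadic tree of boxes is built whose cells at depth [n]
    have side of order [theta ^ (n (gamma_j + 1))] in direction [j], with
    [theta ^ d = 1/2]: since [Q = d], halving one coordinate at a time keeps all
    the sides in balance, and the increments of [v] over such a cell are of order
    [theta ^ n].  A node of the tree is a word [s : seq bool]; appending [false] to
    [s] does not move the corner of its cell.  Let [G = V([0,a[, x0)] have variance
    [sg > 0].  Subtracting from [v] its projection on [G] leaves a field
    independent of [G], so [v] has the law of
    [v(x)(w) + alpha(x) (G(w') - G(w))] with [w, w'] independent, where [alpha] is a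
    Lipschitz matrix close to the identity.  For fixed [w], the probability in [w']
    of hitting [z] in a cell is at most [K osc ^ d], where [osc] is the oscillation
    of [v(w)] over the cell, because [G(w')] has a bounded density; if
    [osc <= eta theta ^ n] this is [K eta ^ d] times the relative volume [2 ^ -n] of
    the cell.

    It therefore suffices to cover most of the tree by cells with
    [osc <= eta theta ^ n], for every [eta > 0].  On a single cell this event has a
    probability bounded below, by pigeonhole on the chaining bound and
    symmetrization.  By Assumption A, near depth [n] the field is approximated by
    [V([theta ^ -(n-q), theta ^ -(n+q)[, .)], and these are independent for remote
    values of [n]; hence, by a second moment argument, the probability that no
    ancestor of a deep cell is flat is as small as desired.  The remaining cells are
    controlled by a high moment of their oscillation.  Thus [z] is hit with
    probability O(eta ^ d).

    The laws of Gaussian families are handled through the expectations of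
    [cos (theta + l)], [l] a linear form in the family: these determine the
    expectation of every functional in the smallest class that contains them and
    is closed under linear combinations and bounded pointwise limits. *)

(** * Laws determined by linear forms *)

(** When Q = d, counting cells alone is inconclusive: each of the [2 ^ N] cells of depth [N] is hit
    with probability of order [2 ^ -N], so the expected number of hits stays bounded without tending
    to 0. The gain has to come from cells that are flatter than typical, which cost a factor
    [eta ^ d] less; since they may be picked at any depth, almost every branch meets one. The rare
    other branches are charged as if the oscillation were [theta ^ N / eta], at relative price
    [eta ^ -d], which is why their probability is taken as small as [eta ^ (2 d)]. Flatness depends
    on [w] only, while the hitting probability is computed over the copy [w']: Fubini decouples the
    two, although both concern the same field. The Gaussian characteristic function enters only
    through its multiplicativity in the variance, which is read off two independent components of
    [v] at one point; there are two because Q > 1 forces d >= 2. *)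

Lemma bernoulli_ineq (R : realDomainType) (x : R) n :
  -1 <= x -> 1 + n%:R * x <= (1 + x) ^+ n.
Proof.
move=> x1; elim: n => [|n ih]; first by rewrite mul0r addr0.
have h : 0 <= 1 + x by lra.
rewrite exprS; apply: (le_trans _ (ler_wpM2l h ih)).
rewrite mulrDl mul1r mulrDr mulr1 -natr1 mulrDl mul1r.
have : 0 <= x * (n%:R * x) by rewrite mulrCA mulr_ge0// -expr2 sqr_ge0.
by lra.
Qed.

(** Write [q = r ^ 2]: Bernoulli applied to [1 / r] bounds [n * r ^ n], and the remaining factor
    [r ^ n] tends to 0. *)
Lemma natmul_expr_cvg0 (R : realType) (q : R) : 0 <= q < 1 ->
  (fun n => n%:R * q ^+ n) @ \oo --> (0 : R).
Proof.
move=> /andP[q0 q1].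
have [->|qn0] := eqVneq q 0.
  apply: cvg_near_cst; near=> n; rewrite expr0n.
  by rewrite (_ : (n == 0)%N = false) ?mulr0//; apply/negbTE;
    rewrite -lt0n; near: n; exact: nbhs_infty_gt.
pose r := Num.sqrt q.
have r0 : 0 < r by rewrite sqrtr_gt0 lt0r qn0.
have r1 : r < 1 by rewrite -sqrtr1 ltr_sqrt.
have d0 : 0 < r^-1 - 1 by rewrite subr_gt0 invf_gt1.
apply: (@squeeze_cvgr _ _ _ _ (fun=> 0) (fun n => (r^-1 - 1)^-1 * r ^+ n)).
- near=> n; rewrite mulr_ge0 ?exprn_ge0//=.
  rewrite -(sqr_sqrtr q0) -/r -exprM mulnC muln2 -addnn exprD mulrA.
  apply: ler_wpM2r; first by rewrite exprn_ge0// ltW.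
  rewrite -[leRHS]mul1r ler_pdivlMr//.
  have := @bernoulli_ineq _ (r^-1 - 1) n.
  have -> : 1 + (r^-1 - 1) = r^-1 by ring.
  move=> /(_ ltac:(lra)).
  rewrite exprVn -(ler_pM2r (exprn_gt0 n r0)) mulVf ?gt_eqF ?exprn_gt0//.
  have := exprn_gt0 n r0.
  by nra.
- exact: cvg_cst.
- rewrite -[X in _ --> X](mulr0 (r^-1 - 1)^-1); apply: cvgM; first exact: cvg_cst.
  by apply: cvg_expr; rewrite ger0_norm ?ltW.
Unshelve. all: by end_near.
Qed.

(* step_poly n s tends to 1 if s >= 1/2 and to 0 otherwise; the factor n settles
   the boundary case s = 1/2. *)
Definition step_poly (R : realType) n (s : R) := 1 - (1 - s ^+ n) ^+ (n * 2 ^ n).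

Lemma step_poly_01 (R : realType) n (s : R) : 0 <= s <= 1 -> 0 <= step_poly n s <= 1.
Proof.
move=> /andP[s0 s1]; have s1n : 0 <= 1 - s ^+ n <= 1.
  by rewrite subr_ge0 exprn_ile1//= gerBl exprn_ge0.
case/andP: s1n => h0 h1.
by rewrite /step_poly subr_ge0 exprn_ile1//= gerBl exprn_ge0.
Qed.

(** For [s >= 1/2] the subtracted power is at most [exp (- n)]; for [s < 1/2] Bernoulli bounds the
    whole by [n * (2 * s) ^ n]. *)
Lemma step_poly_cvg (R : realType) (s : R) : 0 <= s <= 1 ->
  (fun n => step_poly n s) @ \oo --> ((2^-1 <= s)%R%:R : R).
Proof.
move=> /andP[s0 s1]; have s01 n := @step_poly_01 _ n s.
have [h|h] := leP.
- apply: (@squeeze_cvgr _ _ _ _ (fun n => 1 - expR (-1) ^+ n) (fun=> 1)); last exact: cvg_cst.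
    near=> n; have /andP[_ ->] := s01 n ltac:(by rewrite s0 s1).
    rewrite andbT lerD2l lerNl opprK mulnC exprM lerXn2r ?nnegrE ?exprn_ge0 ?expR_ge0//.
      by rewrite subr_ge0 exprn_ile1.
    have -> : expR (-1) = expR (- (2 ^ n)%:R^-1) ^+ (2 ^ n) :> R.
      by rewrite -expRM_natl mulrN divff// pnatr_eq0 expn_eq0.
    rewrite lerXn2r ?nnegrE ?expR_ge0// ?subr_ge0 ?exprn_ile1//.
    apply: le_trans (expR_ge1Dx _); rewrite lerD2l lerN2 natrX -exprVn lerXn2r//.
    by rewrite nnegrE invr_ge0.
  rewrite -[X in _ --> X]subr0; apply: cvgB; first exact: cvg_cst.
  by apply: cvg_expr; rewrite ger0_norm ?expR_ge0// expR_lt1 ltrN10.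
- apply: (@squeeze_cvgr _ _ _ _ (fun=> 0) (fun n => n%:R * (s *+ 2) ^+ n)).
    near=> n; have /andP[-> _] := s01 n ltac:(by rewrite s0 s1).
    rewrite /= lerBlDl addrC -lerBlDl.
    have := @bernoulli_ineq _ (- s ^+ n) (n * 2 ^ n).
    rewrite lerN2 exprn_ile1// => /(_ isT); apply: le_trans.
    by rewrite -[s *+ 2]mulr_natr exprMn mulrN lerD2l lerN2 natrM natrX mulrAC mulrA.
  exact: cvg_cst.
  by apply: natmul_expr_cvg0; rewrite mulrn_wge0//= -mulr_natr -ltr_pdivlMr// div1r.
Unshelve. all: by end_near.
Qed.

Section TrigClass.
Context {R : realType} {T : Type}.
Implicit Types (s : seq (R * T)) (x : T -> R) (f g : (T -> R) -> R).

Definition lform s x : R := \sum_(p <- s) p.1 * x p.2.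

Lemma lform_cat s1 s2 x : lform (s1 ++ s2) x = lform s1 x + lform s2 x.
Proof. by rewrite /lform big_cat. Qed.

Lemma lformZ c s x : lform [seq (c * p.1, p.2) | p <- s] x = c * lform s x.
Proof.
by rewrite /lform big_map mulr_sumr; apply: eq_bigr => p _; rewrite mulrA.
Qed.

(** The phase [theta] brings in the sines and lets products of generators be linearized. The uniform
    bound [M] in [trig_lim] is there for dominated convergence. *)
Inductive trig_class : ((T -> R) -> R) -> Prop :=
| trig_cos theta s : trig_class (fun x => cos (theta + lform s x))
| trig_lin c f g : trig_class f -> trig_class g ->
    trig_class (fun x => c * f x + g x)
| trig_lim (F : nat -> (T -> R) -> R) f M : (forall n, trig_class (F n)) ->
    (forall n x, `|F n x| <= M) -> (forall x, `|f x| <= M) ->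
    (forall x, F ^~ x @ \oo --> f x) ->
    trig_class f.

Lemma trig_bounded f : trig_class f -> exists M, forall x, `|f x| <= M.
Proof.
elim=> [theta s|c g h _ [M1 h1] _ [M2 h2]|F g M _ _ _ gM _]; last by exists M.
- by exists 1 => x; rewrite ler_norml cos_geN1 cos_le1.
- exists (`|c| * M1 + M2) => x.
  by rewrite (le_trans (ler_normD _ _))// lerD// normrM ler_wpM2l.
Qed.

Lemma trig_cst c : trig_class (fun=> c).
Proof.
have one : trig_class (fun=> 1).
  rewrite (_ : (fun=> 1) = fun x => cos (0 + lform [::] x)); last first.
    by apply/funext => x; rewrite /lform big_nil addr0 cos0.
  exact: trig_cos.
rewrite (_ : (fun=> c) = fun x : T -> R => (c - 1) * (fun=> 1) x + (fun=> 1) x).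
  exact: trig_lin.
by apply/funext => x; rewrite mulr1 subrK.
Qed.

Lemma trig_scale c f : trig_class f -> trig_class (fun x => c * f x).
Proof.
move=> cf; rewrite (_ : (fun x => _) = fun x => c * f x + (fun=> 0) x).
  by apply: trig_lin => //; exact: trig_cst.
by apply/funext => x; rewrite addr0.
Qed.

Lemma trig_add f g : trig_class f -> trig_class g ->
  trig_class (fun x => f x + g x).
Proof.
move=> cf cg; rewrite (_ : (fun x => _) = fun x => 1 * f x + g x).
  exact: trig_lin.
by apply/funext => x; rewrite mul1r.
Qed.

(** Product-to-sum formula on the generators; the other two constructors commute with multiplication
    by a fixed bounded function. *)
Lemma trig_mul_cos theta s f : trig_class f ->
  trig_class (fun x => f x * cos (theta + lform s x)).
Proof.
elim=> [theta' s'|c g h _ ch1 _ ch2|F g M _ cF FM gM Fg].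
- rewrite (_ : (fun x => _) = fun x => 2^-1 *
      cos (theta' - theta + lform (s' ++ [seq (-1 * p.1, p.2) | p <- s]) x) +
    2^-1 * cos (theta' + theta + lform (s' ++ s) x)).
    apply: trig_add; apply: trig_scale; exact: trig_cos.
  apply/funext => x; rewrite !lform_cat lformZ.
  rewrite (_ : theta' - theta + _ = (theta' + lform s' x) - (theta + lform s x)).
    rewrite (_ : theta' + theta + _ = (theta' + lform s' x) + (theta + lform s x)).
      by move: (theta' + _) (theta + _) => A B; rewrite cosB cosD; field.
    by ring.
  by ring.
- rewrite (_ : (fun x => _) = fun x => c * (g x * cos (theta + lform s x)) +
    h x * cos (theta + lform s x)); first exact: trig_lin.
  by apply/funext => x; ring.
- have H a : `|a * 1| = `|a : R| by rewrite mulr1.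
  apply: (@trig_lim (fun n x => F n x * cos (theta + lform s x)) _ M) => //.
  + move=> n x; rewrite normrM -[leRHS]mulr1 ler_pM//.
    by rewrite ler_norml cos_geN1 cos_le1.
  + move=> x; rewrite normrM -[leRHS]mulr1 ler_pM//.
    by rewrite ler_norml cos_geN1 cos_le1.
  + by move=> x; apply: cvgM => //; exact: cvg_cst.
Qed.

Lemma trig_mul f g : trig_class f -> trig_class g ->
  trig_class (fun x => f x * g x).
Proof.
move=> cf; elim=> [theta s|c h1 h2 _ ch1 _ ch2|F h M _ cF FM hM Fh].
- exact: trig_mul_cos.
- rewrite (_ : (fun x => _) = fun x => c * (f x * h1 x) + f x * h2 x).
    exact: trig_lin.
  by apply/funext => x; ring.
- have [N fN] := trig_bounded cf.
  apply: (@trig_lim (fun n x => f x * F n x) _ (N * M)) => //.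
  + by move=> n x; rewrite normrM ler_pM.
  + by move=> x; rewrite normrM ler_pM.
  + by move=> x; apply: cvgM => //; exact: cvg_cst.
Qed.

Lemma trig_exp f n : trig_class f -> trig_class (fun x => f x ^+ n).
Proof.
move=> cf; elim: n => [|n ih].
  by rewrite (_ : (fun x => _) = fun=> 1); [exact: trig_cst|exact/funext].
rewrite (_ : (fun x => _) = fun x => f x * f x ^+ n); first exact: trig_mul.
by apply/funext => x; rewrite exprS.
Qed.

(* The events whose probability is determined by the expectations of the
   cos (theta + lform s). *)
Definition tset (E : set (T -> R)) := trig_class \1_E.

Lemma trig_step f n : trig_class f -> trig_class (fun x => step_poly n (f x)).
Proof.
move=> cf.
have c1 : trig_class (fun x => -1 * f x ^+ n + 1).
  by apply: trig_lin; [exact: trig_exp|exact: trig_cst].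
rewrite (_ : (fun x => _) =
  fun x => -1 * (-1 * f x ^+ n + 1) ^+ (n * 2 ^ n) + 1).
  by apply: trig_lin; [exact: (@trig_exp (fun x => -1 * f x ^+ n + 1))|exact: trig_cst].
by apply/funext => x; rewrite /step_poly !mulN1r [RHS]addrC [- f x ^+ n + 1]addrC.
Qed.

(** Let [l] be the linear form. An affine image of the sine of [(l - b) / (n + 1)] is in the class,
    and [step_poly] turns it into the indicator that this sine is nonnegative. For large [n] the
    angle is below [pi] in absolute value, so the sign of the sine is that of [l - b]. *)
Lemma tset_ge s b : tset [set x | b <= lform s x].
Proof.
pose g n x : R := (1 + sin (n.+1%:R^-1 * (lform s x - b))) / 2.
have g01 n x : 0 <= g n x <= 1.
  have := sin_le1 (n.+1%:R^-1 * (lform s x - b)).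
  have := sin_geN1 (n.+1%:R^-1 * (lform s x - b)).
  by rewrite /g; lra.
have cg n : trig_class (g n).
  rewrite (_ : g n = fun x => 2^-1 * cos (- (pi / 2 + n.+1%:R^-1 * b) +
     lform [seq (n.+1%:R^-1 * p.1, p.2) | p <- s] x) + 2^-1).
    by apply: trig_lin; [exact: trig_cos|exact: trig_cst].
  apply/funext => x; rewrite lformZ /g.
  rewrite (_ : - _ + _ = n.+1%:R^-1 * (lform s x - b) - pi / 2); last by ring.
  by rewrite cosB cos_pihalf sin_pihalf; field.
apply: (@trig_lim (fun n x => (2^-1 <= g n x)%R%:R) _ 1) => [n|n x|x|x].
- apply: (@trig_lim (fun m x => step_poly m (g n x)) _ 1) => [m|m x|x|x].
  + exact: trig_step.
  + by have /andP[? ?] := step_poly_01 m (g01 n x); rewrite ger0_norm.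
  + by case: (2^-1 <= _); rewrite ?normr1 ?normr0.
  + exact: step_poly_cvg.
- by case: (2^-1 <= _); rewrite ?normr1 ?normr0.
- by rewrite indicE; case: (_ \in _); rewrite ?normr1 ?normr0.
- have gE n : (2^-1 <= g n x) = (0 <= sin (n.+1%:R^-1 * (lform s x - b))).
    by rewrite /g; apply/idP/idP; lra.
  have small : \forall n \near \oo, `|n.+1%:R^-1 * (lform s x - b)| < 2.
    near=> n; rewrite normrM ger0_norm ?invr_ge0// mulrC ltr_pdivrMr//.
    rewrite (@lt_le_trans _ _ n.+1%:R)//; last by rewrite ler_peMl//; lra.
    by rewrite (@lt_trans _ _ n%:R) ?ltr_nat//; near: n; exact: nbhs_infty_gtr.
  have pi2 : 2 <= pi :> R by exact: pi_ge2.
  apply: cvg_near_cst; near=> n; rewrite gE indicE; congr (_%:R).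
  have : `|n.+1%:R^-1 * (lform s x - b)| < 2 by near: n.
  rewrite ltr_norml => /andP[l1 l2].
  have [bx|bx] := leP b (lform s x).
  + rewrite mem_set//; apply/esym; rewrite sin_ge0_pi// mulr_ge0 ?subr_ge0//=.
    by rewrite ltW// (lt_le_trans l2).
  + rewrite memNset//=; last by apply/negP; rewrite -ltNge.
    suff h : sin (n.+1%:R^-1 * (lform s x - b)) < 0 by rewrite leNgt h.
    rewrite -oppr_gt0 -sinN sin_gt0_pi// -mulrN opprB.
    rewrite mulr_gt0 ?invr_gt0 ?subr_gt0//=.
    rewrite -ltrN2 -mulrN opprB; apply: le_lt_trans l1.
    by rewrite lerN2.
Unshelve. all: by end_near.
Qed.

Lemma tsetC E : tset E -> tset (~` E).
Proof.
move=> tE; rewrite /tset (_ : \1_(~` E) = fun x => -1 * \1_E x + 1).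
  by apply: trig_lin => //; exact: trig_cst.
apply/funext => x; rewrite !indicE in_setC; case: (x \in E) => /=; ring.
Qed.

Lemma tsetI E F : tset E -> tset F -> tset (E `&` F).
Proof.
by move=> tE tF; rewrite /tset indicI; exact: trig_mul.
Qed.

Lemma tset_bigcapn (E : nat -> set (T -> R)) :
  (forall n, tset (E n)) -> tset (\bigcap_n E n).
Proof.
move=> tE.
have tI n : tset (\bigcap_(i < n) E i).
  elim: n => [|n ih].
    rewrite bigcap_mkord big_ord0 /tset indicT; exact: trig_cst.
  by rewrite bigcap_mkord big_ord_recr/= -bigcap_mkord; exact: tsetI.
apply: (@trig_lim (fun n => \1_(\bigcap_(i < n) E i)) _ 1) => //.
- by move=> n x; rewrite indicE; case: (_ \in _); rewrite ?normr1 ?normr0.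
- by move=> x; rewrite indicE; case: (_ \in _); rewrite ?normr1 ?normr0.
- move=> x; apply: cvg_near_cst.
  have [h|] := pselect ((\bigcap_n E n) x).
    by near=> n; rewrite !indicE !mem_set// => i _; exact: h.
  move=> h; have /existsNP[m /not_implyP[_ hm]] := h.
  near=> n; rewrite !indicE !memNset// => /(_ m) H; apply/hm/H => /=.
  by near: n; exact: nbhs_infty_gt.
Unshelve. all: by end_near.
Qed.

Lemma tset_bigcap (I : countType) (E : I -> set (T -> R)) :
  (forall i, tset (E i)) -> tset (\bigcap_i E i).
Proof.
move=> tE.
rewrite (_ : \bigcap_i _ =
  \bigcap_n (if unpickle n is Some i then E i else setT)).
  apply: tset_bigcapn => n; case: (unpickle n) => // .
  by rewrite /tset indicT; exact: trig_cst.
apply/seteqP; split => x h.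
  by move=> n _; case: (unpickle n) => // i; exact: h.
by move=> i _; have := h (pickle i) Logic.I; rewrite pickleK.
Qed.

Lemma tset_bigcup (I : countType) (E : I -> set (T -> R)) :
  (forall i, tset (E i)) -> tset (\bigcup_i E i).
Proof.
move=> tE; rewrite -[X in tset X]setCK setC_bigcup.
by apply: tsetC; apply: tset_bigcap => i; exact: tsetC.
Qed.

Lemma tset_abs_le s c r : tset [set x | `|lform s x - c| <= r].
Proof.
rewrite (_ : [set x | _] = [set x | c - r <= lform s x] `&`
   [set x | - (c + r) <= lform [seq (-1 * p.1, p.2) | p <- s] x]).
  by apply: tsetI; exact: tset_ge.
apply/seteqP; split => x /=; rewrite lformZ ler_norml => h; [split|]; lra.
Qed.
End TrigClass.

Section Transfer.
Context {R : realType} {T : Type}.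
Local Open Scope ereal_scope.

Lemma trig_measurable d (S : measurableType d) (X : T -> S -> R) f :
  (forall t, measurable_fun setT (X t)) -> trig_class f ->
  measurable_fun setT (fun w => f (X ^~ w)).
Proof.
move=> mX; elim=> [theta s|c g h _ mg _ mh|F g M _ mF _ _ Fg].
- apply: (measurableT_comp (continuous_measurable_fun (@continuous_cos R))).
  apply: measurable_funD => //; rewrite /lform.
  by apply: measurable_sum => p; apply: measurable_funM.
- apply: measurable_funD => //; exact: measurable_funM.
- apply: (measurable_fun_cvg (h := fun n w => F n (X ^~ w))) => // w _.
Qed.

Lemma tset_measurable d (S : measurableType d) (X : T -> S -> R) E :
  (forall t, measurable_fun setT (X t)) -> tset E ->
  measurable [set w | E (X ^~ w)].
Proof.
move=> mX tE.
have := trig_measurable mX tE => /(_ measurableT [set 1%R] (measurable_set1 _)).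
rewrite setTI; congr measurable; apply/seteqP; split => w /=.
- rewrite indicE; case: (boolP (_ \in _)) => [/set_mem//|_ /esym/eqP].
  by rewrite oner_eq0.
- by move=> Ew; rewrite indicE mem_set.
Qed.

(** [tset_measurable] is applied to [S] carrying the sigma-algebra generated by [X] in place of its
    own. *)
Lemma tset_sigma_of d (S : measurableType d) (X : T -> S -> R) E : tset E ->
  sigma_of X [set w | E (X ^~ w)].
Proof.
move=> tE.
pose G := \bigcup_t preimage_set_system setT (X t) (@measurable _ R).
have mX t : measurable_fun [set: g_sigma_algebraType G] (X t).
  move=> _ B mB; apply: sub_sigma_algebra; exists t => //; exists B => //.
exact: (tset_measurable mX tE).
Qed.

Lemma bounded_integrable d (S : measurableType d) (P : probability S R)
    (f : S -> R) M : measurable_fun setT f -> (forall w, `|f w| <= M)%R ->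
  P.-integrable setT (EFin \o f).
Proof.
move=> mf fM; apply: (@le_integrable _ _ _ _ _ _ _ (cst M%:E)) => //.
- exact/measurable_EFinP.
- by move=> w _ /=; rewrite lee_fin (le_trans (fM w))// ler_norm.
- exact: finite_measure_integrable_cst.
Qed.

Context {d1 d2} {S1 : measurableType d1} {S2 : measurableType d2}.
Variables (P1 : probability S1 R) (P2 : probability S2 R).
Variables (X : T -> S1 -> R) (Y : T -> S2 -> R).
Hypothesis mX : forall t, measurable_fun setT (X t).
Hypothesis mY : forall t, measurable_fun setT (Y t).
Hypothesis cosXY : forall theta s,
  \int[P1]_w (cos (theta + lform s (X ^~ w)))%:E =
  \int[P2]_w (cos (theta + lform s (Y ^~ w)))%:E.

Lemma trig_transfer f : trig_class f ->
  \int[P1]_w (f (X ^~ w))%:E = \int[P2]_w (f (Y ^~ w))%:E.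
Proof.
elim=> [//|c g h cg ihg ch ihh|F g M cF ih FM gM Fg].
- have [Mg gb] := trig_bounded cg; have [Mh hb] := trig_bounded ch.
  have E d (S : measurableType d) (P : probability S R) (Z : T -> S -> R) :
      (forall t, measurable_fun setT (Z t)) ->
      \int[P]_w (c * g (Z ^~ w) + h (Z ^~ w))%:E =
      c%:E * \int[P]_w (g (Z ^~ w))%:E + \int[P]_w (h (Z ^~ w))%:E.
    move=> mZ.
    have ig : P.-integrable setT (fun w => (g (Z ^~ w))%:E).
      exact: (bounded_integrable _ (trig_measurable mZ cg)).
    have ih : P.-integrable setT (fun w => (h (Z ^~ w))%:E).
      exact: (bounded_integrable _ (trig_measurable mZ ch)).
    under eq_integral do rewrite EFinD EFinM.
    by rewrite integralD//= ?integralZl//; exact: integrableZl.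
  by rewrite !E// ihg ihh.
- have L d (S : measurableType d) (P : probability S R) (Z : T -> S -> R) :
      (forall t, measurable_fun setT (Z t)) ->
      (fun n => \int[P]_w (F n (Z ^~ w))%:E) @ \oo -->
      \int[P]_w (g (Z ^~ w))%:E.
    move=> mZ.
    have [] // := @dominated_convergence _ _ _ P setT measurableT
      (fun n w => (F n (Z ^~ w))%:E) (fun w => (g (Z ^~ w))%:E) (cst M%:E).
    + by move=> n; apply/measurable_EFinP; exact: trig_measurable.
    + apply/measurable_EFinP; apply: trig_measurable => //.
      exact: (@trig_lim _ _ F g M).
    + by apply: aeW => w _; apply/cvg_EFin => //; [exact: nearW|exact: Fg].
    + exact: finite_measure_integrable_cst.
    + by apply: aeW => w n _; rewrite lee_fin.
  have := L _ _ P1 X mX; under eq_fun do rewrite ih.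
  move=> /cvg_unique; apply => //; exact: L.
Qed.

Lemma tset_transfer E : tset E ->
  P1 [set w | E (X ^~ w)] = P2 [set w | E (Y ^~ w)].
Proof.
move=> tE; have := trig_transfer tE.
have I d (S : measurableType d) (P : probability S R) (Z : T -> S -> R) :
    (forall t, measurable_fun setT (Z t)) ->
    \int[P]_w (\1_E (Z ^~ w))%:E = P [set w | E (Z ^~ w)].
  move=> mZ; rewrite -[X in _ = P X]setIT -integral_indic//; last exact: tset_measurable.
by rewrite !I.
Qed.

End Transfer.

(** * Centered normal variables *)

Section Density.
Local Open Scope ereal_scope.
Context d (T : measurableType d) (R : realType).
Variables (mu nu : {measure set T -> \bar R}) (g : T -> R).
Hypothesis g0 : forall x, (0 <= g x)%R.
Hypothesis mg : measurable_fun setT g.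
Hypothesis nuE : forall A, measurable A -> nu A = \int[mu]_(x in A) (g x)%:E.

Import HBNNSimple.

(** Indicators by [nuE], then simple functions, then monotone convergence. It serves to compute with
    normal laws through their densities. *)
Lemma ge0_integral_density (f : T -> \bar R) : measurable_fun setT f ->
  (forall x, 0 <= f x) -> \int[nu]_x f x = \int[mu]_x (f x * (g x)%:E).
Proof.
move=> mf f0; pose h := nnsfun_approx measurableT mf.
transitivity (limn (fun n => \int[nu]_x (h n x)%:E)).
  rewrite -monotone_convergence//.
  - apply: eq_integral => y _; apply/esym/cvg_lim => //.
    exact: cvg_nnsfun_approx.
  - by move=> n; exact/measurable_EFinP.
  - by move=> n y _; rewrite lee_fin.
  - by move=> y _ m n mn; rewrite lee_fin; exact/lefP/nd_nnsfun_approx.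
transitivity (limn (fun n => \int[mu]_x ((h n x)%:E * (g x)%:E))); last first.
  rewrite -monotone_convergence//.
  - apply: eq_integral => y _; apply/cvg_lim => //.
    apply: cvgeZr => //; exact: cvg_nnsfun_approx.
  - by move=> n; apply: emeasurable_funM; exact/measurable_EFinP.
  - by move=> n y _; rewrite mule_ge0// lee_fin.
  - move=> y _ m n mn; rewrite lee_wpmul2r// lee_fin//.
    exact/lefP/nd_nnsfun_approx.
congr (limn _); apply/funext => n.
under eq_integral do rewrite fimfunE -fsumEFin//.
rewrite ge0_integral_fsum//; last 2 first.
  - by move=> r; exact/measurable_EFinP/measurableT_comp.
  - by move=> r x _; exact: nnfun_muleindic_ge0.
transitivity (\int[mu]_x (\sum_(k \in range (h n))
    (k * \1_((h n) @^-1` [set k]) x * g x)%:E)); last first.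
  apply: eq_integral => x _.
  by rewrite [in RHS]fimfunE -fsumEFin// ge0_mule_fsuml// => k; exact: nnfun_muleindic_ge0.
rewrite ge0_integral_fsum//; last 2 first.
  - move=> r; apply/measurable_EFinP/measurable_funM => //.
    exact: measurable_funM.
  - by move=> r x _; rewrite EFinM mule_ge0// ?lee_fin//; exact: nnfun_muleindic_ge0.
apply: eq_fsbigr => r; rewrite inE => -[x _ <-].
have mA : measurable (h n @^-1` [set h n x]) by [].
under eq_integral do rewrite EFinM.
rewrite ge0_integralZl//; first last.
- by rewrite lee_fin.
- exact/measurable_EFinP.
- rewrite integral_indic// setIT nuE// integral_mkcond -ge0_integralZl//.
  - apply: eq_integral => y _; rewrite -mulrA EFinM; congr (_ * _).
    by rewrite patchE indicE; case: (_ \in _); rewrite ?mul1r ?mul0r.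
  - apply/(measurable_restrictT _ mA); apply: measurable_funTS; exact/measurable_EFinP.
  - by move=> y _; rewrite patchE; case: ifP => //; rewrite lee_fin.
by rewrite lee_fin.
Qed.

End Density.

Section Independence.
Local Open Scope ereal_scope.
Context d (T : measurableType d) (R : realType) (P : probability T R).

(** The factorization over rectangles identifies the law of the pair with the product of the two
    laws, where Fubini applies. *)
Lemma indep_integralM (X Y : T -> R) :
  measurable_fun setT X -> measurable_fun setT Y ->
  (forall A B, measurable A -> measurable B ->
     P (X @^-1` A `&` Y @^-1` B) = P (X @^-1` A) * P (Y @^-1` B)) ->
  P.-integrable setT (EFin \o X) -> P.-integrable setT (EFin \o Y) ->
  \int[P]_w (X w * Y w)%:E = \int[P]_w (X w)%:E * \int[P]_w (Y w)%:E.
Proof.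
move=> mX mY XY iX iY.
pose X' : {mfun T >-> R} := HB.pack X (isMeasurableFun.Build _ _ _ _ _ mX).
pose Y' : {mfun T >-> R} := HB.pack Y (isMeasurableFun.Build _ _ _ _ _ mY).
have mXY : measurable_fun setT (fun w => (X w, Y w)) by exact: measurable_fun_pair.
pose XY' : {mfun T >-> (R * R)%type} :=
  HB.pack (fun w => (X w, Y w)) (isMeasurableFun.Build _ _ _ _ _ mXY).
pose PX : probability _ R := distribution P X'.
pose PY : probability _ R := distribution P Y'.
have prodE A : measurable A -> (PX \x PY) A = distribution P XY' A.
  apply: product_measure_unique => A1 A2 mA1 mA2.
  exact: XY.
pose f (z : R * R) := (z.1 * z.2)%:E.
have mf : measurable_fun setT f by exact/measurable_EFinP/measurable_funM.
have mabs : measurable_fun setT (fun x : R => `|x|%:E) by exact/measurable_EFinP.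
have LX : \int[PX]_x `|x|%:E < +oo.
  by rewrite ge0_integral_distribution//; case/integrableP: iX.
have LY : \int[PY]_x `|x|%:E < +oo.
  by rewrite ge0_integral_distribution//; case/integrableP: iY.
have idX : PX.-integrable setT (fun x => x%:E).
  by apply/integrableP; split => //; exact/measurable_EFinP.
have idY : PY.-integrable setT (fun x => x%:E).
  by apply/integrableP; split => //; exact/measurable_EFinP.
(* The iterated integral of [|x * y|] is the product of the two finite first absolute moments. *)
have iXY : (PX \x PY).-integrable setT f.
  apply/integrable12ltyP => //.
  under eq_integral => x _.
    under eq_integral => y _ do rewrite /f /= normrM EFinM.
    rewrite ge0_integralZl//.
    over.
  rewrite ge0_integralZr//; last exact: integral_ge0.
  by rewrite lte_mul_pinfty// ?ge0_fin_numE// integral_ge0.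
have iPXY : P.-integrable setT (f \o XY').
  apply/integrableP; split; first exact: measurableT_comp.
  have mfa : measurable_fun setT (abse \o f) by exact: measurableT_comp.
  have := @ge0_integral_distribution _ _ _ _ _ P XY' (abse \o f) mfa (fun=> abse_ge0 _).
  move=> /= <-; case/integrableP: iXY => _; congr (_ < _).
  by apply: eq_measure_integral => A mA _; exact: prodE.
transitivity (\int[PX \x PY]_z f z).
  rewrite (eq_measure_integral (distribution P XY')); last by move=> A mA _; exact: prodE.
  by rewrite integral_distribution.
rewrite -integral12_prod_meas1//.
transitivity (\int[PX]_x (x%:E * \int[PY]_y y%:E)).
  apply: eq_integral => x _; rewrite /fubini_F /f /=.
  by under eq_integral do rewrite EFinM; rewrite integralZl.
have fY : \int[PY]_y y%:E \is a fin_num by exact: integrable_fin_num.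
rewrite -(fineK fY) integralZr// fineK//.
by rewrite !integral_distribution//; exact/measurable_EFinP.
Qed.

End Independence.

Section Normal.
Context (R : realType).
Local Notation mu := (@lebesgue_measure R).
Local Notation N01 := (@normal_prob R 0 1).
Local Open Scope ereal_scope.

Lemma ge0_integral_normal_prob m s (f : R -> \bar R) :
  measurable_fun setT f -> (forall x, 0 <= f x) ->
  \int[normal_prob m s]_x f x = \int[mu]_x (f x * (normal_pdf m s x)%:E).
Proof.
move=> mf f0; apply: ge0_integral_density => //.
- exact: normal_pdf_ge0.
- exact: measurable_normal_pdf.
Qed.

Lemma normal_pdf_affine (m s x : R) : s != 0%R ->
  (normal_pdf m s (m + `|s| * x) * `|s| = normal_pdf 0 1 x)%R.
Proof.
move=> s0; rewrite !normal_pdfE ?oner_eq0//= mulrAC; congr (_ * _)%R.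
  rewrite /normal_peak expr1n mul1r -mulrnAr sqrtrM ?sqr_ge0// sqrtr_sqr.
  by rewrite invfM mulrC mulrA divff ?mul1r// normr_eq0.
rewrite /normal_fun; congr expR; rewrite addrC addKr subr0 expr1n.
rewrite exprMn real_normK ?num_real// -mulr_natr.
by field.
Qed.

Lemma integral_affine (G : R -> R) (m s : R) : s != 0%R -> continuous G ->
  (forall x, 0 <= G x)%R ->
  \int[mu]_x (G x)%:E = \int[mu]_x (G (m + `|s| * x) * `|s|)%:E.
Proof.
move=> s0 cG G0; have s0' : (0 < `|s|)%R by rewrite normr_gt0.
pose F (x : R) : R := (m + `|s| * x)%R.
have F' : F^`()%classic = cst `|s|%R.
  apply/funext => x; rewrite /F derive1E deriveD// derive_cst add0r.
  by rewrite (_ : *%R _ = *:%R `|s|)// deriveZ//= derive_id; exact: mulr1.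
rewrite (@increasing_ge0_integration_by_substitutionT _ F G)//.
- by rewrite F'.
- by move=> x y xy; rewrite /F ltrD2l ltr_pM2l.
- by rewrite F' => ?; exact: cvg_cst.
- by rewrite F'; exact: is_cvg_cst.
- by rewrite F'; exact: is_cvg_cst.
- rewrite /F; under eq_fun do rewrite addrC.
  apply: (@cvg_comp _ _ _ (fun x : R => `|s| * x)%R (fun y : R => y + m)%R _ -oo%R).
    by under eq_fun do rewrite mulrC; exact: (gt0_cvgMlNy s0' cvg_id).
  exact: cvg_addrr_Ny.
- rewrite /F; under eq_fun do rewrite addrC.
  apply: (@cvg_comp _ _ _ (fun x : R => `|s| * x)%R (fun y : R => y + m)%R _ +oo%R).
    by under eq_fun do rewrite mulrC; exact: (gt0_cvgMly s0' cvg_id).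
  exact: cvg_addrr.
Qed.

(** Reflection exchanges the two half-lines on either side of 0; the substitution is made on each of
    them separately. *)
Lemma integral_oppR (G : R -> R) : continuous G -> (forall x, 0 <= G x)%R ->
  \int[mu]_x (G x)%:E = \int[mu]_x (G (- x))%:E.
Proof.
move=> cG G0.
have cN : continuous (fun x => G (- x)%R).
  by move=> x; apply: continuous_comp; [exact: oppr_continuous|exact: cG].
have split_half (H : R -> R) : continuous H -> (forall x, 0 <= H x)%R ->
    \int[mu]_x (H x)%:E =
    \int[mu]_(x in `[0%R, +oo[) (H x)%:E + \int[mu]_(x in `]-oo, 0%R]) (H x)%:E.
  move=> cH H0; have mH := continuous_measurable_fun cH.
  rewrite -(setUv `[0%R, +oo[) ge0_integral_setU//= ; last 4 first.
  - exact: measurableC.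
  - by apply/measurable_EFinP; rewrite setUv.
  - by move=> x _; rewrite lee_fin.
  - exact/disj_setPCl.
  congr (_ + _); rewrite setCitvr integral_itv_bndo_bndc//.
  exact/measurable_EFinP/measurable_funTS.
rewrite (split_half _ cG G0) (split_half _ cN (fun x => G0 _)) addeC; congr (_ + _).
- have := @ge0_integration_by_substitutionNy _ G 0%R.
  by rewrite oppr0; apply => //; exact: continuous_subspaceT.
- have := @ge0_integration_by_substitutionNy _ (fun x => G (- x)%R) 0%R.
  rewrite oppr0 => ->//; last exact: continuous_subspaceT.
  by apply: eq_integral => x _ /=; rewrite opprK.
Qed.

Lemma continuous_normal01 : continuous (normal_pdf (0 : R) 1).
Proof. exact: continuous_normal_pdf (oner_neq0 R). Qed.

Lemma integral_N01_opp (f : R -> R) : continuous f -> (forall x, 0 <= f x)%R ->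
  \int[N01]_x (f x)%:E = \int[N01]_x (f (- x))%:E.
Proof.
move=> cf f0.
have cN : continuous (fun x => f (- x)%R).
  by move=> x; apply: continuous_comp; [exact: oppr_continuous|exact: cf].
have mf := continuous_measurable_fun cf.
have mN := continuous_measurable_fun cN.
have /measurable_EFinP mf' := mf; have /measurable_EFinP mN' := mN.
rewrite (ge0_integral_normal_prob _ _ mf') => [|x]; last by rewrite lee_fin.
rewrite (ge0_integral_normal_prob _ _ mN') => [|x]; last by rewrite lee_fin.
under eq_integral do rewrite -EFinM.
rewrite integral_oppR.
- apply: eq_integral => x _; rewrite -EFinM; congr (_ * _)%:E.
  by rewrite !normal_pdfE ?oner_eq0//= /normal_fun !subr0 sqrrN.
- by move=> x; apply: cvgM; [exact: cf|exact: continuous_normal01].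
- by move=> x; rewrite mulr_ge0// normal_pdf_ge0.
Qed.

Definition N01_moment n : \bar R := \int[N01]_x (x ^+ n.*2)%:E.

Lemma expR_ge_expn n (y : R) : (0 <= y)%R -> (y ^+ n / n`!%:R <= expR y)%R.
Proof.
move=> y0; case: n => [|n].
  by rewrite expr0 fact0 divr1 (le_trans _ (expR_ge1Dx y))// lerDl.
by rewrite (le_trans _ (expR_ge1Dxn n y0))// lerDr.
Qed.

(** [x ^ (2 n)] is at most [n! 4 ^ n exp (x ^ 2 / 4)], and [exp (x ^ 2 / 4)] times the standard
    density is a multiple of the density of variance 2. *)
Lemma N01_moment_lty n : N01_moment n < +oo.
Proof.
pose s : R := Num.sqrt 2.
have s2 : (s ^+ 2 = 2)%R by rewrite sqr_sqrtr.
have s0 : s != 0%R by rewrite gt_eqF// sqrtr_gt0.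
pose C : R := (n`!%:R * 4 ^+ n * (normal_peak 1 / normal_peak s))%R.
have C0 : (0 <= C)%R by rewrite mulr_ge0 ?divr_ge0 ?normal_peak_ge0// mulr_ge0 ?exprn_ge0.
have mp : measurable_fun setT (fun x : R => x ^+ n.*2)%R by exact: measurable_funX.
have p0 (x : R) : (0 <= x ^+ n.*2)%R by rewrite -mul2n exprM exprn_ge0// sqr_ge0.
rewrite /N01_moment ge0_integral_normal_prob//; last exact/measurable_EFinP.
apply: (@le_lt_trans _ _ (\int[mu]_x (C%:E * (normal_pdf 0 s x)%:E))).
  apply: ge0_le_integral => //.
  - by move=> x _; rewrite mule_ge0// lee_fin ?normal_pdf_ge0.
  - apply: emeasurable_funM; apply/measurable_EFinP => //.
    exact: measurable_normal_pdf.
  - apply: emeasurable_funM; apply/measurable_EFinP => //.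
    exact: measurable_normal_pdf.
  - move=> x _; rewrite -!EFinM lee_fin.
    rewrite !normal_pdfE ?oner_eq0//= /C.
    pose y : R := (x ^+ 2 / 4)%R.
    have y0 : (0 <= y)%R by rewrite divr_ge0// sqr_ge0.
    have xE : (x ^+ n.*2 = y ^+ n * 4 ^+ n)%R.
      by rewrite -mul2n exprM /y expr_div_n divfK// expf_neq0.
    have -> : (normal_fun 0 1 x = expR (- y) * normal_fun 0 s x)%R.
      by rewrite /y /normal_fun -expRD s2 expr1n subr0; congr expR; field.
    have ps : normal_peak s != 0%R by rewrite gt_eqF// normal_peak_gt0.
    have -> : (n`!%:R * 4 ^+ n * (normal_peak 1 / normal_peak s) *
        (normal_peak s * normal_fun 0 s x) =
       normal_peak 1 * (n`!%:R * 4 ^+ n) * normal_fun 0 s x)%R by field.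
    rewrite mulrCA !mulrA ler_wpM2r ?normal_fun_ge0// -!mulrA ler_wpM2l ?normal_peak_ge0//.
    rewrite expRN ler_pdivrMr ?expR_gt0// xE mulrAC ler_wpM2r ?exprn_ge0//.
    by rewrite -ler_pdivrMl ?ltr0n ?fact_gt0// mulrC expR_ge_expn.
rewrite ge0_integralZl//; last 2 first.
- by apply/measurable_EFinP; exact: measurable_normal_pdf.
- by move=> x _; rewrite lee_fin normal_pdf_ge0.
by rewrite integral_normal_pdf mule1 ltry.
Qed.

(** Kept symbolic: below, the scale parameter of a centered normal variable with second moment [t]
    is written [sqrt (t / N01_var R)]. *)
Definition N01_var : R := fine (N01_moment 1).

Lemma N01_moment_fin n : N01_moment n \is a fin_num.
Proof.
rewrite ge0_fin_numE ?N01_moment_lty// integral_ge0// => x _.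
by rewrite lee_fin -mul2n exprM exprn_ge0// sqr_ge0.
Qed.

(** If it vanished, the standard normal law would be carried by the point 0, which is Lebesgue
    null. *)
Lemma N01_var_gt0 : (0 < N01_var)%R.
Proof.
rewrite lt0r fine_ge0 ?andbT; last first.
  by apply: integral_ge0 => x _; rewrite lee_fin sqr_ge0.
apply/negP => /eqP v0.
have : \int[N01]_x `|(x ^+ 2)%:E| = 0.
  have v0' : N01_moment 1 = 0 by rewrite -(fineK (N01_moment_fin 1)) -/N01_var v0.
  rewrite -v0' /N01_moment.
  by apply: eq_integral => x _; rewrite gee0_abs// lee_fin sqr_ge0.
have mx2 : measurable_fun setT (fun x : R => (x ^+ 2)%:E).
  exact/measurable_EFinP/measurable_funX.
move=> h0; have [N [mN N0 HN]] := (ae_eq_integral_abs N01 measurableT mx2).1 h0.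
have : N01 setT <= N01 (N `|` [set 0%R]).
  apply: le_measure; rewrite ?inE//; first exact: measurableU.
  move=> x _; have [->|x0] := eqVneq x 0%R; [by right|left].
  by apply: HN => /(_ Logic.I) /eqP; rewrite eqe sqrf_eq0 (negbTE x0).
have N00 : N01 [set 0%R] = 0.
  have /null_content_dominatesP := @normal_prob_dominates R 0 1; apply => //.
  exact: lebesgue_measure_set1.
apply/negP; rewrite -ltNge probability_setT (le_lt_trans (measureU2 _ _ _))//.
by rewrite [X in X + _]N0 [X in _ + X]N00 adde0.
Qed.

End Normal.

Section GaussianRV.
Context d (T : measurableType d) (R : realType) (P : probability T R).
Local Notation N01 := (@normal_prob R 0 1).
Local Open Scope ereal_scope.

(** Both cases of [gaussian_law] are images of the standard law under [x |-> m + |s| x], the point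
    mass being [s = 0]; this removes the case distinction from what follows. *)
Lemma integral_gaussian_law (X : T -> R) m s (f : R -> R) :
  measurable_fun setT X ->
  (forall B, measurable B -> P (X @^-1` B) = gaussian_law m s B) ->
  continuous f -> (forall x, 0 <= f x)%R ->
  \int[P]_w (f (X w))%:E = \int[N01]_x (f (m + `|s| * x)%R)%:E.
Proof.
move=> mX XE cf f0; have mf := continuous_measurable_fun cf.
have mf' : measurable_fun setT (EFin \o f) by exact/measurable_EFinP.
have cf' : continuous (fun x => f (m + `|s| * x)%R).
  move=> x; apply: continuous_comp; last exact: cf.
  by apply: cvgD; [exact: cvg_cst|apply: cvgM; [exact: cvg_cst|exact: cvg_id]].
have mg := continuous_measurable_fun cf'.
have mg' : measurable_fun setT (fun x => (f (m + `|s| * x)%R)%:E).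
  exact/measurable_EFinP.
have mX' : measurable_fun setT (X : T -> measurableTypeR R) by exact: mX.
pose X' : {mfun T >-> measurableTypeR R} := HB.pack (X : T -> measurableTypeR R)
  (isMeasurableFun.Build _ _ _ _ _ mX').
have := @ge0_integral_distribution _ _ _ _ _ P X' (EFin \o f) mf'.
move=> /(_ (fun x => f0 x)) /= <-.
have [s0|s0] := eqVneq s 0%R.
  rewrite (eq_measure_integral (\d_(m : measurableTypeR R))); last first.
    by move=> A mA _; rewrite [LHS]XE// /gaussian_law s0 eqxx.
  rewrite integral_dirac// diracT mul1e s0 normr0.
  under eq_integral do rewrite mul0r addr0.
  by rewrite integral_cst// [X in _ * X]probability_setT mule1.
transitivity (\int[normal_prob m s]_y (f y)%:E).
  apply: (eq_measure_integral (normal_prob m s)) => A mA _.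
  by rewrite [LHS]XE// /gaussian_law (negbTE s0).
have fE0 x : 0 <= (EFin \o f) x by rewrite lee_fin.
have gE0 x : 0 <= (f (m + `|s| * x)%R)%:E by rewrite lee_fin.
rewrite (ge0_integral_normal_prob m s mf' fE0).
rewrite (ge0_integral_normal_prob 0 1 mg' gE0) /=.
under eq_integral do rewrite -EFinM.
rewrite (integral_affine m s0).
- apply: eq_integral => x _; rewrite -EFinM; congr (_%:E).
  by rewrite -mulrA normal_pdf_affine.
- by move=> x; apply: cvgM; [exact: cf|exact: continuous_normal_pdf].
- by move=> x; rewrite mulr_ge0// normal_pdf_ge0.
Qed.

Definition centered_gaussian (X : T -> R) :=
  measurable_fun setT X /\ exists s : R, (0 <= s)%R /\
    forall B, measurable B -> P (X @^-1` B) = gaussian_law 0 s B.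

Lemma gaussian_law_norm m (s : R) : gaussian_law m `|s| = gaussian_law m s.
Proof.
rewrite /gaussian_law normr_eq0; have [//|s0] := eqVneq s 0%R.
apply/funext => A; rewrite /normal_prob; apply: eq_integral => x _.
by rewrite !normal_pdfE ?normr_eq0//= /normal_peak /normal_fun real_normK ?num_real.
Qed.

Lemma N01_abs_lty : \int[N01]_x (Num.max x 0)%:E < +oo.
Proof.
have H (x : R) : (Num.max x 0 <= 1 + x ^+ 2)%R.
  have h1 : (0 <= (x - 1) ^+ 2)%R by exact: sqr_ge0.
  have h2 : (0 <= x ^+ 2)%R by exact: sqr_ge0.
  by case: (leP x 0%R) => x0; nra.
have mM : measurable_fun setT (fun x : R => (Num.max x 0)%:E).
  by apply/measurable_EFinP; apply: measurable_maxr.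
have m2 : measurable_fun setT (fun x : R => (x ^+ 2)%:E).
  exact/measurable_EFinP/measurable_funX.
apply: (@le_lt_trans _ _ (\int[N01]_x (1 + (x ^+ 2)%:E))).
  apply: ge0_le_integral => //.
  - by move=> x _; rewrite lee_fin le_max lexx orbT.
  - exact: emeasurable_funD.
  - by move=> x _; rewrite lee_fin; exact: H.
rewrite ge0_integralD//; last by move=> x _; rewrite lee_fin sqr_ge0.
rewrite integral_cst// [X in _ * X]probability_setT mule1 lte_add_pinfty ?ltry//;
  exact: (N01_moment_lty R 1).
Qed.

(** By symmetry the positive and negative parts of [X - m] have equal finite integrals, so the
    expectation is [m], which is therefore 0. *)
Lemma gaussian_rv_centered (X : T -> R) : gaussian_rv P X ->
  'E_P[X] = 0 -> centered_gaussian X.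
Proof.
move=> [mX [m [s XE]]] EX; split=> //; exists `|s|%R; split => //.
suff m0 : m = 0%R by rewrite gaussian_law_norm -m0.
pose p (x : R) : R := Num.max (x - m)%R 0%R; pose q (x : R) : R := Num.max (m - x)%R 0%R.
have cp : continuous p.
  move=> x; apply: (@continuous_max _ _ (fun x => x - m)%R (fun=> 0%R)); last exact: cst_continuous.
  by apply: cvgD; [exact: cvg_id|exact: cvg_cst].
have cq : continuous q.
  move=> x; apply: (@continuous_max _ _ (fun x => m - x)%R (fun=> 0%R)); last exact: cst_continuous.
  by apply: cvgB; [exact: cvg_cst|exact: cvg_id].
have p0 x : (0 <= p x)%R by rewrite le_max lexx orbT.
have q0 x : (0 <= q x)%R by rewrite le_max lexx orbT.
have maxM x : (Num.max (`|s| * x) 0 = `|s| * Num.max x 0)%R.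
  by rewrite maxr_pMr// mulr0.
have cm : continuous (fun x : R => Num.max x 0%R).
  move=> x; apply: (@continuous_max _ _ id (fun=> 0%R)); [exact: cvg_id|exact: cst_continuous].
have Ep : \int[P]_w (p (X w))%:E = `|s|%:E * \int[N01]_x (Num.max x 0)%:E.
  rewrite (integral_gaussian_law mX XE)// -ge0_integralZl//.
  - by apply: eq_integral => x _; rewrite /p addrC addKr maxM.
  - by apply/measurable_EFinP; exact: continuous_measurable_fun.
  - by move=> x _; rewrite lee_fin le_max lexx orbT.
have Eq : \int[P]_w (q (X w))%:E = `|s|%:E * \int[N01]_x (Num.max x 0)%:E.
  rewrite (integral_gaussian_law mX XE)// -ge0_integralZl//.
  - rewrite integral_N01_opp//.
    + apply: eq_integral => x _; rewrite /q mulrN opprB addrCA subrr addr0.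
      by rewrite maxM.
    + move=> x; apply: (@continuous_comp _ _ _ (fun x => m + `|s| * x)%R q); last exact: cq.
      by apply: cvgD; [exact: cvg_cst|apply: cvgM; [exact: cvg_cst|exact: cvg_id]].
  - by apply/measurable_EFinP; exact: continuous_measurable_fun.
  - by move=> x _; rewrite lee_fin le_max lexx orbT.
have fin : `|s|%:E * \int[N01]_x (Num.max x 0)%:E < +oo.
  by rewrite lte_mul_pinfty// N01_abs_lty.
have ip : P.-integrable setT (fun w => (p (X w))%:E).
  apply/integrableP; split.
    by apply/measurable_EFinP; apply: measurableT_comp => //; exact: continuous_measurable_fun.
  by under eq_integral do rewrite gee0_abs ?lee_fin//; rewrite Ep.
have iq : P.-integrable setT (fun w => (q (X w))%:E).
  apply/integrableP; split.
    by apply/measurable_EFinP; apply: measurableT_comp => //; exact: continuous_measurable_fun.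
  by under eq_integral do rewrite gee0_abs ?lee_fin//; rewrite Eq.
have im : P.-integrable setT (fun w : T => m%:E) by exact: finite_measure_integrable_cst.
have : 'E_P[X] = m%:E.
  rewrite unlock; transitivity (\int[P]_w (m%:E + ((p (X w))%:E - (q (X w))%:E))).
    apply: eq_integral => w _; rewrite -EFinB -EFinD; congr (_%:E).
    by rewrite /p /q; case: leP => ?; case: leP => ?; lra.
  rewrite integralD//; last exact: integrableB.
  rewrite integralB// integral_cst// [X in _ * X]probability_setT mule1 Ep Eq subee ?adde0//.
  by rewrite ge0_fin_numE// mule_ge0// integral_ge0// => x _; rewrite lee_fin le_max lexx orbT.
by rewrite EX => -[].
Qed.

Definition mom2 (X : T -> R) : R := fine (\int[P]_w (X w ^+ 2)%:E).

Lemma gaussian_integral_even (X : T -> R) s n : (0 <= s)%R ->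
  measurable_fun setT X ->
  (forall B, measurable B -> P (X @^-1` B) = gaussian_law 0 s B) ->
  \int[P]_w (X w ^+ n.*2)%:E = (s ^+ n.*2)%:E * N01_moment R n.
Proof.
move=> s0 mX XE.
have p0 (x : R) : (0 <= x ^+ n.*2)%R by rewrite -mul2n exprM exprn_ge0// sqr_ge0.
rewrite (@integral_gaussian_law _ _ _ (fun x => x ^+ n.*2)%R mX XE)//; last first.
  by move=> x; exact: exprn_continuous.
rewrite /N01_moment -ge0_integralZl//.
- by apply: eq_integral => x _; rewrite add0r ger0_norm// exprMn EFinM.
- by apply/measurable_EFinP; exact: measurable_funX.
- by move=> x _; rewrite lee_fin.
- by rewrite lee_fin exprn_ge0.
Qed.

Lemma integral_mom2 X : centered_gaussian X ->
  \int[P]_w (X w ^+ 2)%:E = (mom2 X)%:E.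
Proof.
move=> [mX [s [s0 XE]]]; rewrite /mom2 fineK//.
rewrite (@gaussian_integral_even X s 1)// fin_numM// N01_moment_fin//.
Qed.

Lemma mom2_ge0 X : (0 <= mom2 X)%R.
Proof. by rewrite fine_ge0// integral_ge0// => w _; rewrite lee_fin sqr_ge0. Qed.

(** The second moment fixes the scale [s], so a centered normal law depends on [mom2] alone. *)
Lemma centered_gaussian_sd X : centered_gaussian X ->
  measurable_fun setT X /\
  forall B, measurable B ->
    P (X @^-1` B) = gaussian_law 0 (Num.sqrt (mom2 X / N01_var R)) B.
Proof.
move=> gX; have EX := integral_mom2 gX; case: gX => mX [s [s0 XE]].
suff <- : s = Num.sqrt (mom2 X / N01_var R) by split.
move: EX; rewrite (@gaussian_integral_even X s 1)// -(fineK (N01_moment_fin R 1)).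
rewrite -EFinM => -[<-]; rewrite mulfK ?sqrtr_sqr ?ger0_norm//.
by rewrite gt_eqF// N01_var_gt0.
Qed.

Lemma gaussian_moment_le n : exists2 K : R, (0 <= K)%R & forall X,
  centered_gaussian X -> \int[P]_w (X w ^+ n.*2)%:E = (K * mom2 X ^+ n)%:E.
Proof.
exists (fine (N01_moment R n) / N01_var R ^+ n)%R => [|X /centered_gaussian_sd[mX XE]].
  rewrite divr_ge0 ?exprn_ge0 ?(ltW (N01_var_gt0 R))// fine_ge0// integral_ge0// => x _.
  by rewrite lee_fin -mul2n exprM exprn_ge0// sqr_ge0.
rewrite (gaussian_integral_even _ (sqrtr_ge0 _) mX XE).
rewrite -(fineK (N01_moment_fin R n)) -EFinM; congr (_%:E).
rewrite -mul2n exprM sqr_sqrtr ?divr_ge0 ?mom2_ge0 ?(ltW (N01_var_gt0 R))//.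
by rewrite expr_div_n mulrC; ring.
Qed.

(* The characteristic function of N(0, t) at 1. *)
Definition gauss_char (t : R) : R :=
  fine (\int[N01]_x (cos (Num.sqrt (t / N01_var R) * x))%:E).

Lemma integral_cst_prob d' (S : measurableType d') (Q : probability S R) (c : R) :
  \int[Q]_w c%:E = c%:E.
Proof. by rewrite integral_cst// [X in _ * X]probability_setT mule1. Qed.

Lemma gaussian_cos X : centered_gaussian X ->
  \int[P]_w (cos (X w))%:E = (gauss_char (mom2 X))%:E.
Proof.
move=> /centered_gaussian_sd[mX XE].
set s := Num.sqrt _ in XE.
have s0 : (0 <= s)%R by exact: sqrtr_ge0.
have mcos : measurable_fun setT (@cos R).
  exact: continuous_measurable_fun (@continuous_cos R).
have mc : measurable_fun setT (cos \o X) by exact: measurableT_comp.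
have ms : measurable_fun setT (fun x : R => cos (s * x)).
  by apply: measurableT_comp => //; exact: measurable_funM.
have cos1 (x : R) : (`|cos x| <= 1)%R by rewrite ler_norml cos_geN1 cos_le1.
have ic : P.-integrable setT (fun w => (cos (X w))%:E).
  exact: (bounded_integrable _ mc (fun=> cos1 _)).
have is' : N01.-integrable setT (fun x => (cos (s * x))%:E).
  exact: (@bounded_integrable R _ (measurableTypeR R) (@normal_prob R 0 1) 
    (fun x => cos (s * x)) 1%R ms (fun=> cos1 _)).
(* [integral_gaussian_law] asks for a nonnegative function, hence the added 1. *)
have H : \int[P]_w (1 + cos (X w))%:E = \int[N01]_x (1 + cos (s * x)%R)%:E.
  rewrite (@integral_gaussian_law _ _ _ (fun x => 1 + cos x)%R mX XE).
  - by apply: eq_integral => x _; rewrite add0r (ger0_norm s0).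
  - by move=> x; apply: cvgD; [exact: cvg_cst|exact: continuous_cos].
  - by move=> x; have := cos_geN1 x; lra.
move: H; under eq_integral do rewrite EFinD.
under [in RHS]eq_integral do rewrite EFinD.
rewrite integralD ?integralD//; try exact: finite_measure_integrable_cst.
rewrite !integral_cst_prob /gauss_char -/s => /(congr1 (fun x => x - 1%:E)).
rewrite addeAC subee// add0e addeAC subee// add0e => ->.
by rewrite fineK// integrable_fin_num.
Qed.

(** By symmetry of the law, [1 + sin X] and [1 - sin X] have the same expectation. *)
Lemma gaussian_sin X : centered_gaussian X -> \int[P]_w (sin (X w))%:E = 0.
Proof.
move=> [mX [s [s0 XE]]].
have msin : measurable_fun setT (@sin R).
  exact: continuous_measurable_fun (@continuous_sin R).
have mc : measurable_fun setT (sin \o X) by exact: measurableT_comp.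
have sin1 (x : R) : (`|sin x| <= 1)%R by rewrite ler_norml sin_geN1 sin_le1.
have ic : P.-integrable setT (fun w => (sin (X w))%:E).
  exact: (bounded_integrable _ mc (fun=> sin1 _)).
have cD : continuous (fun x : R => 1 + sin x)%R.
  by move=> x; apply: cvgD; [exact: cvg_cst|exact: continuous_sin].
have cB : continuous (fun x : R => 1 - sin x)%R.
  by move=> x; apply: cvgB; [exact: cvg_cst|exact: continuous_sin].
have H : \int[P]_w (1 + sin (X w))%:E = \int[P]_w (1 - sin (X w))%:E.
  have D0 (x : R) : (0 <= 1 + sin x)%R by have := sin_geN1 x; lra.
  have B0 (x : R) : (0 <= 1 - sin x)%R by have := sin_le1 x; lra.
  rewrite (@integral_gaussian_law _ _ _ (fun x => 1 + sin x)%R mX XE)//.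
  rewrite (@integral_gaussian_law _ _ _ (fun x => 1 - sin x)%R mX XE)//.
  rewrite integral_N01_opp.
  - by apply: eq_integral => x _; rewrite !add0r mulrN sinN.
  - move=> x; apply: (@continuous_comp _ _ _ (fun x => 0 + `|s| * x)%R (fun x => 1 + sin x)%R);
      last exact: cD.
    by apply: cvgD; [exact: cvg_cst|apply: cvgM; [exact: cvg_cst|exact: cvg_id]].
  - by move=> x; exact: D0.
move: H; under eq_integral do rewrite EFinD.
under [in RHS]eq_integral do rewrite EFinB.
rewrite integralD ?integralB//; try exact: finite_measure_integrable_cst.
rewrite !integral_cst_prob.
have : \int[P]_w (sin (X w))%:E \is a fin_num by exact: integrable_fin_num.
case: (\int[P]_w _) => // r _; rewrite -EFinD -EFinB => -[] h.
by congr (_%:E); lra.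
Qed.

Lemma gaussian_small_ball X (a r : R) : centered_gaussian X -> (0 < mom2 X)%R ->
  (0 <= r)%R -> P [set w | (`|X w - a| <= r)%R] <=
    (r *+ 2 * normal_peak (Num.sqrt (mom2 X / N01_var R)))%:E.
Proof.
move=> /centered_gaussian_sd[mX XE] v0 r0.
set s := Num.sqrt _ in XE *.
have s0 : s != 0%R by rewrite gt_eqF// sqrtr_gt0 divr_gt0// N01_var_gt0.
rewrite (_ : [set w | _] = X @^-1` `[(a - r)%R, (a + r)%R]%classic); last first.
  by apply/seteqP; split => w /=; rewrite in_itv/= ler_distl.
rewrite XE// /gaussian_law (negbTE s0) /normal_prob.
apply: (@le_trans _ _ (\int[@lebesgue_measure R]_(x in `[(a - r)%R, (a + r)%R]%classic)
  (normal_peak s)%:E)).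
  apply: ge0_le_integral => //.
  - by move=> x _; rewrite lee_fin normal_pdf_ge0.
  - apply/measurable_EFinP; apply: measurable_funTS; exact: measurable_normal_pdf.
  - by move=> x _; rewrite lee_fin normal_pdf_ub.
rewrite integral_cst// [X in _ * X <= _]lebesgue_measure_itv/= lte_fin.
case: ifPn => [_|_]; last by rewrite mule0 lee_fin mulr_ge0 ?normal_peak_ge0// mulrn_wge0.
by rewrite -EFinB -EFinM lee_fin mulrC ler_wpM2r ?normal_peak_ge0//; lra.
Qed.

End GaussianRV.

(** * Gaussian spaces *)

(** A linear form in linear forms is again a linear form. Thus events about a linear transform of a
    family can be read as events about the family. *)
Lemma trig_subst (R : realType) (I J : Type) (h : I -> seq (R * J)) (f : (I -> R) -> R) :
  trig_class f -> trig_class (fun x => f (fun i => lform (h i) x)).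
Proof.
elim=> [theta s|c f1 f2 _ c1 _ c2|F g M _ cF FM gM Fg].
- rewrite (_ : (fun x => _) = fun x => cos (theta +
    lform (flatten [seq [seq (p.1 * q.1, q.2) | q <- h p.2] | p <- s]) x)).
    exact: trig_cos.
  apply/funext => x; congr (cos (_ + _)); elim: s => [|p s ih].
    by rewrite /lform !big_nil.
  by rewrite /= lform_cat -ih lformZ {1}/lform big_cons.
- exact: trig_lin.
- exact: (@trig_lim _ _ (fun n x => F n (fun i => lform (h i) x)) _ M).
Qed.

Lemma tset_subst (R : realType) (I J : Type) (h : I -> seq (R * J)) (E : set (I -> R)) :
  tset E -> tset [set x | E (fun i => lform (h i) x)].
Proof.
move=> /(trig_subst h); congr trig_class; apply/funext => x.
Qed.

Lemma tset_reindex (R : realType) (I J : Type) (h : I -> J) (E : set (I -> R)) :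
  tset E -> tset [set x : J -> R | E (fun i => x (h i))].
Proof.
move=> /(tset_subst (fun i => [:: (1, h i)])); congr (tset _); apply/funext => x /=.
by congr E; apply/funext => i; rewrite /lform big_seq1 mul1r.
Qed.

Section GaussianSpace.
Context d (T : measurableType d) (R : realType) (P : probability T R).
Local Open Scope ereal_scope.

(** Joint normality is encoded by stability: a linear combination of members is again a member,
    hence normal. *)
Definition gaussian_space (L : (T -> R) -> Prop) :=
  [/\ L (fun=> 0%R), forall X, L X -> centered_gaussian P X &
    forall a X Y, L X -> L Y -> L (fun w => a * X w + Y w)%R].

Definition ip (X Y : T -> R) : R := fine (\int[P]_w (X w * Y w)%:E).

Lemma ipC X Y : ip X Y = ip Y X.
Proof. by rewrite /ip; under eq_integral do rewrite mulrC. Qed.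

Lemma mom2E X : mom2 P X = ip X X.
Proof. by []. Qed.

Variable L : (T -> R) -> Prop.
Hypothesis gL : gaussian_space L.

Lemma gs0 : L (fun=> 0%R). Proof. by case: gL. Qed.
Lemma gsG X : L X -> centered_gaussian P X. Proof. by case: gL => _ + _; exact. Qed.
Lemma gs_lin a X Y : L X -> L Y -> L (fun w => a * X w + Y w)%R.
Proof. by case: gL => _ _; exact. Qed.
Lemma gsM X : L X -> measurable_fun setT X. Proof. by move=> /gsG[]. Qed.

Lemma gsZ a X : L X -> L (fun w => a * X w)%R.
Proof.
move=> LX; rewrite (_ : (fun w => _) = fun w => a * X w + (fun=> 0) w)%R.
  exact: gs_lin LX gs0.
by apply/funext => w; rewrite addr0.
Qed.

Lemma gsD X Y : L X -> L Y -> L (fun w => X w + Y w)%R.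
Proof.
move=> LX LY; rewrite (_ : (fun w => _) = fun w => 1 * X w + Y w)%R.
  exact: gs_lin.
by apply/funext => w; rewrite mul1r.
Qed.

Lemma gsB X Y : L X -> L Y -> L (fun w => X w - Y w)%R.
Proof.
move=> LX LY; rewrite (_ : (fun w => _) = fun w => -1 * Y w + X w)%R.
  exact: gs_lin.
by apply/funext => w; rewrite mulN1r addrC.
Qed.

Lemma gs_sum (I : Type) (r : seq I) (X : I -> T -> R) : (forall i, L (X i)) ->
  L (fun w => \sum_(i <- r) X i w)%R.
Proof.
move=> LX; elim: r => [|i r ih].
  by rewrite (_ : (fun w => _) = fun=> 0%R); [exact: gs0|apply/funext => w; rewrite big_nil].
rewrite (_ : (fun w => _) = fun w => X i w + (\sum_(j <- r) X j w))%R.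
  exact: gsD.
by apply/funext => w; rewrite big_cons.
Qed.

Lemma gs_lform (I : Type) (s : seq (R * I)) (X : I -> T -> R) :
  (forall i, L (X i)) -> L (fun w => lform s (X ^~ w)).
Proof. by move=> LX; apply: gs_sum => p; exact: gsZ. Qed.

Lemma gs_sqr_integrable X : L X -> P.-integrable setT (fun w => (X w ^+ 2)%:E).
Proof.
move=> LX; have mX := gsM LX; apply/integrableP; split.
  exact/measurable_EFinP/measurable_funX.
under eq_integral do rewrite gee0_abs ?lee_fin ?sqr_ge0//.
by rewrite integral_mom2 ?ltry//; exact: gsG.
Qed.

Lemma gs_mul_integrable X Y : L X -> L Y ->
  P.-integrable setT (fun w => (X w * Y w)%:E).
Proof.
move=> LX LY; have mX := gsM LX; have mY := gsM LY.
apply: (@le_integrable _ _ _ P setT _ _ (fun w => (X w ^+ 2)%:E + (Y w ^+ 2)%:E)) => //.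
- exact/measurable_EFinP/measurable_funM.
- move=> w _ /=; rewrite lee_fin normrM (ger0_norm (addr_ge0 _ _)) ?sqr_ge0//.
  rewrite -(real_normK (num_real (X w))) -(real_normK (num_real (Y w))).
  have h : (0 <= (`|X w| - `|Y w|) ^+ 2)%R by exact: sqr_ge0.
  have h1 : (0 <= `|X w| ^+ 2)%R by exact: sqr_ge0.
  have h2 : (0 <= `|Y w| ^+ 2)%R by exact: sqr_ge0.
  move: h; rewrite sqrrB => h; lra.
- by apply: integrableD => //; exact: gs_sqr_integrable.
Qed.

Lemma gs_ipE X Y : L X -> L Y -> \int[P]_w (X w * Y w)%:E = (ip X Y)%:E.
Proof.
by move=> LX LY; rewrite fineK// integrable_fin_num//; exact: gs_mul_integrable.
Qed.

Lemma ip_linl a X Y Z : L X -> L Y -> L Z ->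
  ip (fun w => a * X w + Y w)%R Z = (a * ip X Z + ip Y Z)%R.
Proof.
move=> LX LY LZ; apply: EFin_inj; rewrite -gs_ipE//; last exact: gs_lin.
under eq_integral do rewrite mulrDl -mulrA EFinD EFinM.
rewrite integralD//; last 2 first.
- by apply: integrableZl => //; exact: gs_mul_integrable.
- exact: gs_mul_integrable.
by rewrite integralZl ?gs_mul_integrable// !gs_ipE.
Qed.

Lemma ip_addl X Y Z : L X -> L Y -> L Z ->
  ip (fun w => X w + Y w)%R Z = (ip X Z + ip Y Z)%R.
Proof.
move=> LX LY LZ; rewrite -[ip X Z]mul1r -ip_linl//; congr ip.
by apply/funext => w; rewrite mul1r.
Qed.

Lemma ip_subl X Y Z : L X -> L Y -> L Z ->
  ip (fun w => X w - Y w)%R Z = (ip X Z - ip Y Z)%R.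
Proof.
move=> LX LY LZ; rewrite addrC -[(- _)%R]mulN1r -ip_linl//; congr ip.
by apply/funext => w; rewrite mulN1r addrC.
Qed.

Lemma ip_0l Z : ip (fun=> 0%R) Z = 0%R.
Proof. by rewrite /ip; under eq_integral do rewrite mul0r; rewrite integral0. Qed.

Lemma ip_scalel a X Z : L X -> L Z -> ip (fun w => a * X w)%R Z = (a * ip X Z)%R.
Proof.
move=> LX LZ; rewrite -[RHS]addr0 -(ip_0l Z) -ip_linl//; last exact: gs0.
by congr ip; apply/funext => w; rewrite addr0.
Qed.

Lemma ip_suml (I : Type) (r : seq I) (X : I -> T -> R) Z : (forall i, L (X i)) ->
  L Z -> ip (fun w => \sum_(i <- r) X i w)%R Z = (\sum_(i <- r) ip (X i) Z)%R.
Proof.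
move=> LX LZ; elim: r => [|i r ih].
  rewrite big_nil (_ : (fun w => _) = fun=> 0%R) ?ip_0l//.
  by apply/funext => w; rewrite big_nil.
rewrite big_cons -ih -ip_addl//; last exact: gs_sum.
by congr ip; apply/funext => w; rewrite big_cons.
Qed.

Lemma ip_lform0 (I : Type) (s : seq (R * I)) (X : I -> T -> R) Z :
  (forall i, L (X i)) -> L Z -> (forall i, ip (X i) Z = 0)%R ->
  ip (fun w => lform s (X ^~ w)) Z = 0%R.
Proof.
move=> LX LZ X0; rewrite /lform ip_suml//; last by move=> p; exact: gsZ.
by rewrite big1// => p _; rewrite ip_scalel// X0 mulr0.
Qed.

Lemma mom2_add X Y : L X -> L Y ->
  mom2 P (fun w => X w + Y w)%R = (mom2 P X + 2 * ip X Y + mom2 P Y)%R.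
Proof.
move=> LX LY; have LD := gsD LX LY.
rewrite mom2E ip_addl// !(ipC _ (fun w => X w + Y w)%R) !ip_addl// (ipC Y X).
by rewrite !mom2E; ring.
Qed.

Lemma mom2_scale a X : L X -> mom2 P (fun w => a * X w)%R = (a ^+ 2 * mom2 P X)%R.
Proof.
move=> LX; rewrite mom2E ip_scalel ?(ipC X) ?ip_scalel//; try exact: gsZ.
by rewrite mom2E mulrA.
Qed.

(* AM-GM form of the Cauchy-Schwarz inequality, which avoids square roots. *)
Lemma ip_le t X Y : (0 < t)%R -> L X -> L Y ->
  (`|ip X Y| <= (t^-1 * mom2 P X + t * mom2 P Y) / 2)%R.
Proof.
move=> t0 LX LY.
have h a : (0 <= a ^+ 2 * mom2 P X + 2 * a * ip X Y + mom2 P Y)%R.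
  rewrite -mom2_scale// -mulrA -ip_scalel// -mom2_add//; first exact: mom2_ge0.
  exact: gsZ.
have := h t^-1%R; have := h (- t^-1)%R.
rewrite sqrrN => h1 h2.
have e1 : (t * (t^-1 ^+ 2 * mom2 P X + 2 * - t^-1 * ip X Y + mom2 P Y) =
   t^-1 * mom2 P X - 2 * ip X Y + t * mom2 P Y)%R by field; rewrite gt_eqF.
have e2 : (t * (t^-1 ^+ 2 * mom2 P X + 2 * t^-1 * ip X Y + mom2 P Y) =
   t^-1 * mom2 P X + 2 * ip X Y + t * mom2 P Y)%R by field; rewrite gt_eqF.
have := mulr_ge0 (ltW t0) h1; rewrite e1 => h3.
have := mulr_ge0 (ltW t0) h2; rewrite e2 => h4.
by rewrite ler_norml; apply/andP; split; lra.
Qed.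

Lemma gs_cos theta X : L X ->
  \int[P]_w (cos (theta + X w))%:E = (cos theta * gauss_char (mom2 P X))%:E.
Proof.
move=> LX; have gX := gsG LX; have mX := gsM LX.
have mcos : measurable_fun setT (cos \o X).
  by apply: measurableT_comp => //; exact: continuous_measurable_fun (@continuous_cos R).
have msin : measurable_fun setT (sin \o X).
  by apply: measurableT_comp => //; exact: continuous_measurable_fun (@continuous_sin R).
have cos1 (x : R) : (`|cos x| <= 1)%R by rewrite ler_norml cos_geN1 cos_le1.
have sin1 (x : R) : (`|sin x| <= 1)%R by rewrite ler_norml sin_geN1 sin_le1.
have ic : P.-integrable setT (fun w => (cos (X w))%:E).
  exact: (bounded_integrable _ mcos (fun=> cos1 _)).
have is' : P.-integrable setT (fun w => (sin (X w))%:E).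
  exact: (bounded_integrable _ msin (fun=> sin1 _)).
under eq_integral do rewrite cosD EFinB !EFinM.
rewrite integralB//; try exact: integrableZl.
by rewrite !integralZl// gaussian_sin// mule0 sube0 gaussian_cos.
Qed.

Lemma gs_cos_prod theta X Y : L X -> L Y ->
  \int[P \x P]_z (cos (theta + (X z.1 + Y z.2)))%:E =
  (cos theta * (gauss_char (mom2 P X) * gauss_char (mom2 P Y)))%:E.
Proof.
move=> LX LY; have mX := gsM LX; have mY := gsM LY.
have cos1 (x : R) : (`|cos x| <= 1)%R by rewrite ler_norml cos_geN1 cos_le1.
have mf : measurable_fun setT (fun z : T * T => cos (theta + (X z.1 + Y z.2))%R).
  apply: measurableT_comp; first exact: continuous_measurable_fun (@continuous_cos R).
  apply: measurable_funD => //; apply: measurable_funD; exact: measurableT_comp.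
rewrite -integral12_prod_meas1; last first.
  exact: (bounded_integrable _ mf (fun=> cos1 _)).
rewrite mulrA EFinM -(gs_cos theta LX) -integralZr//; last first.
  have mc : measurable_fun setT (fun w => cos (theta + X w)%R).
    apply: measurableT_comp; first exact: continuous_measurable_fun (@continuous_cos R).
    exact: measurable_funD.
  exact: (bounded_integrable _ mc (fun=> cos1 _)).
apply: eq_integral => w _; rewrite /fubini_F /=.
by under eq_integral do rewrite addrA; rewrite gs_cos// EFinM.
Qed.

(** Multiplicativity in the variance is what turns orthogonality into independence; [gauss_charD]
    establishes it. *)
Hypothesis charD : forall a b : R, (0 <= a)%R -> (0 <= b)%R ->
  gauss_char (a + b)%R = (gauss_char a * gauss_char b)%R.

Lemma measurable_prod_case (I J : Type) (X : I -> T -> R) (Y : J -> T -> R) :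
  (forall i, L (X i)) -> (forall j, L (Y j)) ->
  forall k : I + J, measurable_fun setT (fun z : T * T =>
    match k with inl i => X i z.1 | inr j => Y j z.2 end).
Proof.
by move=> LX LY [k|k]; apply: measurableT_comp => //; exact: gsM.
Qed.

(** A linear form in both families is the sum of two orthogonal forms. Its variance is the sum of
    theirs, and [charD] then factors the expectation of the cosine exactly as under the product
    measure. *)
Lemma orthogonal_joint_law (I J : Type) (X : I -> T -> R) (Y : J -> T -> R)
    (E : set (I + J -> R)) :
  (forall i, L (X i)) -> (forall j, L (Y j)) ->
  (forall i j, ip (X i) (Y j) = 0)%R -> tset E ->
  P [set w | E (fun k => match k with inl i => X i w | inr j => Y j w end)] =
  (P \x P) [set z | E (fun k => match k with inl i => X i z.1 | inr j => Y j z.2 end)].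
Proof.
move=> LX LY XY tE.
pose Z1 (k : I + J) w : R := match k with inl i => X i w | inr j => Y j w end.
pose Z2 (k : I + J) (z : T * T) : R := match k with inl i => X i z.1 | inr j => Y j z.2 end.
apply: (@tset_transfer _ _ _ _ _ _ P (P \x P) Z1 Z2) => //.
- by case => k; [exact: gsM (LX k)|exact: gsM (LY k)].
- exact: measurable_prod_case.
move=> theta s.
(* The two parts of a form are padded with zeros to keep the common index type [I + J]. *)
pose A (k : I + J) w : R := match k with inl i => X i w | inr j => 0%R end.
pose B (k : I + J) w : R := match k with inl i => 0%R | inr j => Y j w end.
have LA k : L (A k) by case: k => k; [exact: LX|exact: gs0].
have LB k : L (B k) by case: k => k; [exact: gs0|exact: LY].
have E1 w : lform s (Z1 ^~ w) = (lform s (A ^~ w) + lform s (B ^~ w))%R.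
  rewrite /lform -big_split; apply: eq_bigr => -[a k] _ /=.
  by rewrite -mulrDr; congr (_ * _)%R; case: k => k /=; rewrite ?addr0 ?add0r.
have E2 z : lform s (Z2 ^~ z) = (lform s (A ^~ z.1) + lform s (B ^~ z.2))%R.
  rewrite /lform -big_split; apply: eq_bigr => -[a k] _ /=.
  by rewrite -mulrDr; congr (_ * _)%R; case: k => k /=; rewrite ?addr0 ?add0r.
have LfA := gs_lform s LA; have LfB := gs_lform s LB.
under eq_integral do rewrite E1.
under [in RHS]eq_integral do rewrite E2.
rewrite (gs_cos_prod theta LfA LfB) (gs_cos theta (gsD LfA LfB)).
rewrite -charD ?mom2_ge0// mom2_add// ip_lform0 ?mulr0 ?addr0// => k.
rewrite ipC ip_lform0// => k'; rewrite ipC.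
by case: k k' => [i|j] [i'|j']; rewrite /A /B ?ip_0l// ipC ip_0l.
Qed.

(** A form of variance [t] contributes [t / 2] in each copy, and the copies are independent. *)
Lemma symmetrized_law (I : Type) (X : I -> T -> R) (E : set (I -> R)) :
  (forall i, L (X i)) -> tset E ->
  P [set w | E (X ^~ w)] =
  (P \x P) [set z | E (fun i => (X i z.1 - X i z.2) / Num.sqrt 2)%R].
Proof.
move=> LX tE.
pose Z2 i (z : T * T) : R := ((X i z.1 - X i z.2) / Num.sqrt 2)%R.
have mZ i : measurable_fun setT (Z2 i).
  apply: measurable_funM => //; apply: measurable_funB;
  apply: measurableT_comp => //; exact: gsM.
apply: (@tset_transfer _ _ _ _ _ _ P (P \x P) X Z2) => // [i|theta s].
  exact: gsM.
have LfX := gs_lform s LX.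
pose c : R := (Num.sqrt 2)^-1%R.
have c2 : (c ^+ 2 = 2^-1)%R by rewrite /c exprVn sqr_sqrtr.
have E2 z : lform s (Z2 ^~ z) =
    (c * lform s (X ^~ z.1) + - c * lform s (X ^~ z.2))%R.
  rewrite -!lformZ /lform !big_map -big_split; apply: eq_bigr => p _ /=.
  by rewrite /Z2 -/c; ring.
under [in RHS]eq_integral do rewrite E2.
rewrite (gs_cos_prod theta (gsZ c LfX) (gsZ (- c) LfX)) gs_cos//.
rewrite -charD ?mom2_ge0// !mom2_scale// sqrrN c2.
by congr (_ * gauss_char _)%:E; lra.
Qed.

Lemma orthogonal_indep (I J : Type) (X : I -> T -> R) (Y : J -> T -> R)
    (E : set (I -> R)) (F : set (J -> R)) :
  (forall i, L (X i)) -> (forall j, L (Y j)) ->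
  (forall i j, ip (X i) (Y j) = 0)%R -> tset E -> tset F ->
  P ([set w | E (X ^~ w)] `&` [set w | F (Y ^~ w)]) =
  P [set w | E (X ^~ w)] * P [set w | F (Y ^~ w)].
Proof.
move=> LX LY XY tE tF.
have mE : measurable [set w | E (X ^~ w)].
  by apply: tset_measurable => // i; exact: gsM.
have mF : measurable [set w | F (Y ^~ w)].
  by apply: tset_measurable => // i; exact: gsM.
have := orthogonal_joint_law LX LY XY
  (tsetI (tset_reindex (@inl I J) tE) (tset_reindex (@inr I J) tF)).
move=> ->; rewrite -product_measure1E//; congr ((P \x P) _).
Qed.

Lemma orthogonal_box_le (I : finType) (G : I -> T -> R) (g : I -> R) (s r : R) :
  (forall i, L (G i)) -> (forall i j, i != j -> ip (G i) (G j) = 0)%R ->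
  (forall i, mom2 P (G i) = s) -> (0 < s)%R -> (0 <= r)%R ->
  P [set w | forall i, (`|G i w - g i| <= r)%R] <=
    ((r *+ 2 * normal_peak (Num.sqrt (s / N01_var R))) ^+ #|I|)%:E.
Proof.
move=> LG Gorth Gs s0 r0.
set K : R := (r *+ 2 * _)%R.
have K0 : (0 <= K)%R by rewrite mulr_ge0 ?normal_peak_ge0// mulrn_wge0.
(* Coordinates outside [l] are frozen at 0 and left unconstrained, so that the index type does not
   change along the induction. *)
pose X (l : seq I) (i : I) : T -> R := if i \in l then G i else (fun=> 0%R).
have LX l i : L (X l i) by rewrite /X; case: ifP => // _; exact: gs0.
pose E (l : seq I) : set (I -> R) := \bigcap_i (if i \in l then
  [set f | (`|f i - g i| <= r)%R] else setT).
have tE1 (J : Type) (j : J) a : tset [set f : J -> R | (`|f j - a| <= r)%R].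
  have := tset_abs_le [:: (1%R, j)] a r.
  by congr tset; apply/seteqP; split => f /=; rewrite /lform big_seq1/= mul1r.
have tE l : tset (E l).
  apply: tset_bigcap => i; case: ifP => // _.
  by rewrite /tset indicT; exact: trig_cst.
have EX l w : E l (X l ^~ w) <-> forall i, i \in l -> (`|G i w - g i| <= r)%R.
  split=> [h i il|h i _]; first by have := h i Logic.I; rewrite il /X/= il.
  by case: ifPn => // il /=; rewrite /X il; exact: h.
have main (l : seq I) : uniq l ->
    P [set w | E l (X l ^~ w)] <= (K ^+ size l)%:E.
  elim: l => [_|i l ih /= /andP[il ul]].
    by rewrite expr0 probability_le1//; apply: tset_measurable => // i; exact: gsM.
  have -> : [set w | E (i :: l) (X (i :: l) ^~ w)] =
     [set w | E l (X l ^~ w)] `&` [set w | (`|G i w - g i| <= r)%R].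
    apply/seteqP; split => w /=.
      move=> /EX h; split; last by apply: h; rewrite inE eqxx.
      by apply/EX => j jl; apply: h; rewrite inE jl orbT.
    move=> [/EX h1 h2]; apply/EX => j; rewrite inE => /predU1P[->//|]; exact: h1.
  rewrite (@orthogonal_indep I unit (X l) (fun=> G i) (E l) [set f | (`|f tt - g i| <= r)%R])//.
    rewrite exprS mulrC EFinM; apply: lee_pmul => //; first exact: ih.
    by rewrite (le_trans (gaussian_small_ball _ _ _ _)) ?Gs//; exact: gsG.
  move=> j _; rewrite /X; case: ifPn => [jl|_]; last exact: ip_0l.
  by rewrite Gorth//; apply: contraNneq il => <-.
have := main (enum I) (enum_uniq _); rewrite cardT; apply: le_trans.
apply: le_measure; rewrite ?inE.
- rewrite (_ : [set w | _] = [set w | E (enum I) (X (enum I) ^~ w)]).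
    by apply: tset_measurable => // i; exact: gsM.
  by apply/seteqP; split => w /=; 
    [move=> h; apply/EX => i _|move=> /EX h i; apply: h; rewrite mem_enum].
- by apply: tset_measurable => // i; exact: gsM.
- by move=> w /= h; apply/EX => i _.
Qed.

End GaussianSpace.

(** * Chaining on the binary tree *)

Fixpoint words (n : nat) : seq (seq bool) :=
  if n is m.+1 then map (cons false) (words m) ++ map (cons true) (words m)
  else [:: [::]].

Lemma mem_words n t : (t \in words n) = (size t == n).
Proof.
elim: n t => [|n ih] [|b t] //=.
- by rewrite mem_cat; apply/negbTE/norP; split; apply/negP => /mapP[].
- rewrite mem_cat eqSS -ih; case: b.
  + rewrite (_ : (_ \in map (cons false) _) = false).
      by rewrite mem_map// => ? ? [].
    by apply/negbTE/negP => /mapP[].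
  + rewrite (_ : (_ \in map (cons true) _) = false).
      by rewrite orbF mem_map// => ? ? [].
    by apply/negbTE/negP => /mapP[].
Qed.

Lemma size_words n : size (words n) = (2 ^ n)%N.
Proof. by elim: n => //= n ih; rewrite size_cat !size_map ih expnS mul2n addnn. Qed.

Lemma big_wordsS (V : Type) (idx : V) (op : Monoid.law idx) n (F : seq bool -> V) :
  \big[op/idx]_(t <- words n.+1) F t =
  op (\big[op/idx]_(t <- words n) F (false :: t))
     (\big[op/idx]_(t <- words n) F (true :: t)).
Proof. by rewrite /= big_cat !big_map. Qed.

Section Chaining.
Context (R : realType).

(** Taking roots, an increment at depth [l] is at most [mu ^ l * z ^ (1/p)] with
    [mu = 2 ^ (- 1/p) < 1]. A path pays at most once per level, and the geometric series gives
    [S]. *)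
Lemma chaining_bound p : (0 < p)%N -> exists2 S : R, 0 < S &
  forall (f : seq bool -> R) (z : R), 0 <= z ->
    (forall s, f (rcons s false) = f s) ->
    (forall s, 2 ^+ size s * `|f (rcons s true) - f s| ^+ p <= z) ->
  forall s, `|f s - f [::]| ^+ p <= S * z.
Proof.
move=> p0; pose mu : R := 2 `^ (- p%:R^-1).
have mup : mu ^+ p = 2^-1.
  rewrite -powR_mulrn ?powR_ge0// -powRrM mulNr mulVf ?pnatr_eq0 -?lt0n//.
  by rewrite powR_inv1.
have mu0 : 0 < mu by rewrite powR_gt0.
have mu1 : mu < 1.
  rewrite ltNge; apply/negP => h.
  have : 1 <= mu ^+ p by exact: exprn_ege1.
  by rewrite mup; lra.
have S0 : 0 < (1 - mu)^-1 by rewrite invr_gt0 subr_gt0.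
exists ((1 - mu)^-1 ^+ p); first exact: exprn_gt0.
move=> f z z0 f0 fz s.
pose zeta := z `^ p%:R^-1.
have zeta0 : 0 <= zeta by exact: powR_ge0.
have zp : zeta ^+ p = z.
  by rewrite -powR_mulrn// -powRrM mulVf ?pnatr_eq0 -?lt0n// powRr1.
have inc t : `|f (rcons t true) - f t| <= mu ^+ size t * zeta.
  rewrite -(ler_pXn2r p0) ?nnegrE ?mulr_ge0 ?exprn_ge0 ?(ltW mu0)//.
  rewrite exprMn -exprM mulnC exprM mup zp exprVn mulrC ler_pdivlMr ?exprn_gt0//.
  by rewrite mulrC.
suff : `|f s - f [::]| <= (\sum_(i < size s) mu ^+ i) * zeta.
  move=> h; rewrite -zp -exprMn lerXn2r ?nnegrE ?mulr_ge0 ?(ltW S0)//.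
  apply: (le_trans h); rewrite ler_wpM2r//.
  rewrite -[leRHS]mul1r ler_pdivlMr ?subr_gt0//.
  have := subrX1 mu (size s); rewrite -opprB -[X in _ = X * _ -> _]opprB mulNr => /oppr_inj.
  rewrite mulrC => <-; rewrite gerBl exprn_ge0// ltW//.
elim/last_ind: s => [|s b ih]; first by rewrite subrr normr0 big_ord0 mul0r.
rewrite size_rcons big_ord_recr/= mulrDl.
rewrite (_ : f (rcons s b) - _ = (f s - f [::]) + (f (rcons s b) - f s)); last by ring.
apply: (le_trans (ler_normD _ _)); apply: lerD => //.
case: b; first exact: inc.
by rewrite f0 subrr normr0 mulr_ge0// exprn_ge0// ltW.
Qed.

Lemma sum_quarter_le n : \sum_(0 <= i < n) (4^-1 : R) ^+ i <= 2.
Proof.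
have h m : 0 <= (4^-1 : R) ^+ m by rewrite exprn_ge0// invr_ge0.
suff : \sum_(0 <= i < n) (4^-1 : R) ^+ i <= 2 - 2 * 4^-1 ^+ n.
  by have := h n; lra.
elim: n => [|n ih]; first by rewrite big_geq// expr0; lra.
by rewrite big_nat_recr//= exprS; have := h n; lra.
Qed.

Section Process.
Context d (T : measurableType d) (P : probability T R) (I : finType).
Local Open Scope ereal_scope.

(** [Z] sums over all levels the increments raised to the power [p], level [l] having weight
    [2 ^ l]. The weight and the [2 ^ l] nodes of the level cost [4 ^ l] against the moment bound
    [16 ^ - l]. *)
Lemma chaining p : (0 < p)%N -> exists2 C : R, (0 <= C)%R &
  forall (X : seq bool -> I -> T -> R) (A : R), (0 <= A)%R ->
  (forall s i, measurable_fun setT (X s i)) ->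
  (forall s i w, X (rcons s false) i w = X s i w) ->
  (forall s i, \int[P]_w (`|X (rcons s true) i w - X s i w| ^+ p)%:E <=
     (A * (16^-1) ^+ size s)%:E) ->
  exists Z : T -> \bar R, [/\ measurable_fun setT Z, forall w, 0 <= Z w,
    \int[P]_w Z w <= (C * A)%:E &
    forall w s i, (`|X s i w - X [::] i w| ^+ p)%:E <= Z w].
Proof.
move=> p0; have [S Sgt0 HS] := chaining_bound p0; have S0 := ltW Sgt0.
exists (S * (#|I|%:R * 2))%R => [|X A A0 mX X0 XA]; first by rewrite mulr_ge0// mulr_ge0.
pose u l w : R := (\sum_(t <- words l) \sum_(i : I)
     2 ^+ l * `|X (rcons t true) i w - X t i w| ^+ p)%R.
have v0 l t i w : (0 <= 2 ^+ l * `|X (rcons t true) i w - X t i w| ^+ p)%R.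
  by rewrite mulr_ge0 ?exprn_ge0.
have u0 l w : (0 <= u l w)%R by apply: sumr_ge0 => t _; apply: sumr_ge0.
have mv l t i : measurable_fun setT (fun w => 2 ^+ l * `|X (rcons t true) i w - X t i w| ^+ p)%R.
  apply: measurable_funM => //; apply: measurable_funX.
  by apply: measurableT_comp => //; exact: measurable_funB.
have mu l : measurable_fun setT (u l).
  by apply: measurable_sum => t; apply: measurable_sum => i.
have mZ : measurable_fun setT (fun w => \sum_(l <oo) (u l w)%:E).
  apply: (ge0_emeasurable_sum (P := xpredT)) => [k x _ _|k _]; first by rewrite lee_fin.
  exact/measurable_EFinP.
have Z0 w : 0 <= \sum_(l <oo) (u l w)%:E by apply: nneseries_ge0 => *; rewrite lee_fin.
have Iu l : \int[P]_w (u l w)%:E <= (#|I|%:R * A * (4^-1) ^+ l)%:E.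
  under eq_integral do rewrite /u -sumEFin.
  rewrite ge0_integral_sum//; last 2 first.
  - by move=> t; apply/measurable_EFinP; apply: measurable_sum => i.
  - by move=> t w _; rewrite lee_fin sumr_ge0.
  apply: (@le_trans _ _ (\sum_(t <- words l) (#|I|%:R * (2 ^+ l * (A * 16^-1 ^+ l)))%:E)).
    rewrite big_seq [leRHS]big_seq; apply: lee_sum => t; rewrite mem_words => /eqP st.
    under eq_integral do rewrite -sumEFin.
    rewrite ge0_integral_sum//; last by move=> i; apply/measurable_EFinP.
    rewrite (_ : (_ * _)%:E = \sum_(i : I) (2 ^+ l * (A * 16^-1 ^+ l))%:E); last first.
      by rewrite sumEFin sumr_const mulr_natl.
    apply: lee_sum => i _.
    under eq_integral do rewrite EFinM.
    rewrite ge0_integralZl//; last first.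
      apply/measurable_EFinP; apply: measurable_funX.
      by apply: measurableT_comp => //; exact: measurable_funB.
    by rewrite EFinM lee_wpmul2l ?lee_fin ?exprn_ge0// -st.
  rewrite sumEFin big_const_seq count_predT size_words iter_addr_0.
  rewrite -[(_ *+ (2 ^ l))%R]mulr_natl natrX lee_fin.
  have -> : (4^-1 = 2 * 2 * 16^-1 :> R)%R by field.
  by rewrite !exprMn le_eqVlt; apply/orP; left; apply/eqP; ring.
exists (fun w => S%:E * \sum_(l <oo) (u l w)%:E); split.
- by apply: emeasurable_funM => //; exact: measurable_cst.
- by move=> w; rewrite mule_ge0// lee_fin.
- rewrite ge0_integralZl//.
  rewrite -mulrA EFinM lee_wpmul2l ?lee_fin//.
  rewrite integral_nneseries//; last 2 first.
  - by move=> l; exact/measurable_EFinP.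
  - by move=> l w _; rewrite lee_fin.
  apply: lime_le.
    by apply: is_cvg_nneseries => l _ _; apply: integral_ge0 => w _; rewrite lee_fin.
  apply: nearW => n.
  apply: (@le_trans _ _ (\sum_(0 <= l < n) (#|I|%:R * A * (4^-1) ^+ l)%:E)); first exact: lee_sum.
  rewrite sumEFin lee_fin -mulr_sumr mulrAC ler_wpM2r// ler_wpM2l//.
  exact: sum_quarter_le.
move=> w s i; have := Z0 w; set z := \sum_(_ <oo) _ => z0.
have uz l : (u l w)%:E <= z.
  apply: le_trans (nneseries_lim_ge l.+1 _) => //; last by move=> *; rewrite lee_fin.
  by rewrite big_nat_recr//= leeDr// sume_ge0// => *; rewrite lee_fin.
(* Where the series diverges the bound is [+oo] and there is nothing to prove. *)
clearbody z; move: z z0 uz => [z||]//; last first.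
  by move=> _ _; rewrite gt0_muley ?leey// lte_fin.
rewrite lee_fin => z0 uz; rewrite -EFinM lee_fin.
apply: (HS (fun s => X s i w)) => // t.
apply: (@le_trans _ _ (u (size t) w)); last by have := uz (size t); rewrite lee_fin.
rewrite /u (big_rem t) ?mem_words//= (bigD1 i)//= -addrA lerDl.
by rewrite addr_ge0// sumr_ge0// => *; rewrite ?sumr_ge0.
Qed.

Definition osc (X : seq bool -> I -> T -> R) (s : seq bool) (r : R) : set T :=
  [set w | forall t i, (`|X (s ++ t) i w - X s i w| <= r)%R].

(** [osc] as a set of paths, so that its probability can be carried from one law to another. *)
Definition tosc (s : seq bool) (r : R) : set (seq bool * I -> R) :=
  [set f | forall t i, (`|f (s ++ t, i) - f (s, i)| <= r)%R].

Lemma tset_tosc s r : tset (tosc s r).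
Proof.
rewrite (_ : tosc s r = \bigcap_(k : seq bool * I)
   [set f | (`|lform [:: (1%R, (s ++ k.1, k.2)); ((-1)%R, (s, k.2))] f - 0| <= r)%R]).
  by apply: tset_bigcap => k; exact: tset_abs_le.
have e (f : seq bool * I -> R) k :
    (lform [:: (1, (s ++ k.1, k.2)); (-1, (s, k.2))] f - 0 =
    f (s ++ k.1, k.2) - f (s, k.2))%R.
  by rewrite /lform !big_cons big_nil/= mul1r mulN1r addr0 subr0.
apply/seteqP; split => f h.
- by move=> [t i] _; have := h t i; rewrite -(e f (t, i)).
- by move=> t i; rewrite -(e f (t, i)); exact: (h (t, i) Logic.I).
Qed.

Lemma oscE X s r : osc X s r = [set w | tosc s r (fun k => X k.1 k.2 w)].
Proof. by []. Qed.

Lemma measurable_osc X s r : (forall t i, measurable_fun setT (X t i)) ->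
  measurable (osc X s r).
Proof.
move=> mX; rewrite oscE.
apply: (@tset_measurable _ _ _ _ (fun k => X k.1 k.2)); last exact: tset_tosc.
by move=> k; exact: mX.
Qed.

Variable L : (T -> R) -> Prop.
Hypothesis gL : gaussian_space P L.

(** The moment of order [2 n] of a centered normal variable is a constant times the [n]-th power of
    its variance, so [v ^ n = 16^-1] converts the variance decay [v ^ l] into the rate required by
    [chaining]. *)
Lemma gaussian_chaining n (v : R) : (0 < n)%N -> (0 <= v)%R ->
  (v ^+ n = 16^-1)%R -> exists2 C : R, (0 <= C)%R &
  forall (X : seq bool -> I -> T -> R) (s : seq bool) (B : R), (0 <= B)%R ->
  (forall t i, L (X t i)) ->
  (forall t i w, X (rcons t false) i w = X t i w) ->
  (forall t i, mom2 P (fun w => X (rcons (s ++ t) true) i w - X (s ++ t) i w)%R <=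
     B * v ^+ size t)%R ->
  exists Z : T -> \bar R, [/\ measurable_fun setT Z, forall w, 0 <= Z w,
    \int[P]_w Z w <= (C * B ^+ n)%:E &
    forall w t i, (`|X (s ++ t) i w - X s i w| ^+ n.*2)%:E <= Z w].
Proof.
move=> n0 v0 vn.
have n20 : (0 < n.*2)%N by rewrite double_gt0.
have [C C0 HC] := chaining n20.
have [K K0 HK] := gaussian_moment_le P n.
exists (C * K)%R => [|X s B B0 LX X0 XB]; first exact: mulr_ge0.
have [|t i|t i w|t i|Z [mZ Z0 IZ ZX]] := HC (fun t => X (s ++ t)) (K * B ^+ n)%R.
- by rewrite mulr_ge0// exprn_ge0.
- exact: (gsM gL (LX _ _)).
- by rewrite -rcons_cat X0.
- rewrite -rcons_cat.
  have LD : L (fun w => X (rcons (s ++ t) true) i w - X (s ++ t) i w)%R.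
    exact: (gsB gL (LX _ _) (LX _ _)).
  under eq_integral => w _ do rewrite -mul2n exprM real_normK ?num_real// -exprM mul2n.
  rewrite HK ?lee_fin//; last exact: (gsG gL LD).
  rewrite -mulrA ler_wpM2l// -vn exprAC -exprMn.
  by rewrite lerXn2r ?nnegrE ?mulr_ge0 ?exprn_ge0 ?mom2_ge0.
exists Z; split => //; first by rewrite -mulrA.
by move=> w t i; have := ZX w t i; rewrite cats0.
Qed.

(** Markov's inequality for the variable [Z] of [gaussian_chaining]. *)
Lemma gaussian_osc n (v : R) : (0 < n)%N -> (0 <= v)%R ->
  (v ^+ n = 16^-1)%R -> exists2 C : R, (0 <= C)%R &
  forall (X : seq bool -> I -> T -> R) (s : seq bool) (B r : R),
  (0 <= B)%R -> (0 < r)%R ->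
  (forall t i, L (X t i)) ->
  (forall t i w, X (rcons t false) i w = X t i w) ->
  (forall t i, mom2 P (fun w => X (rcons (s ++ t) true) i w - X (s ++ t) i w)%R <=
     B * v ^+ size t)%R ->
  P (~` osc X s r) <= (C * (B / r ^+ 2) ^+ n)%:E.
Proof.
move=> n0 v0 vn; have [C C0 HC] := gaussian_chaining n0 v0 vn.
exists C => // X s B r B0 r0 LX X0 XB.
have [Z [mZ Z0 IZ ZX]] := HC X s B B0 LX X0 XB.
have rn0 : (0 < r ^+ n.*2)%R by rewrite exprn_gt0.
have mO : measurable (~` osc X s r).
  by apply: measurableC; apply: measurable_osc => t i; exact: (gsM gL (LX _ _)).
rewrite expr_div_n -exprM mul2n mulrA EFinM lee_pdivlMr//.
apply: le_trans IZ.
rewrite -(setIT (~` _)) muleC -integral_cst; last exact: measurableI.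
rewrite setIT.
apply: (@le_trans _ _ (\int[P]_(w in ~` osc X s r) Z w)).
  apply: ge0_le_integral => //.
  - by move=> w _; rewrite lee_fin ltW.
  - exact: measurable_funTS.
  move=> w /existsNP[t /existsNP[i /negP]]; rewrite -ltNge => h.
  apply: le_trans (ZX w t i); rewrite lee_fin lerXn2r ?nnegrE// ltW//.
apply: ge0_subset_integral => //.
Qed.

End Process.
End Chaining.

(** * Flat cells *)

Section SecondMoment.
Context d (T : measurableType d) (R : realType) (P : probability T R).
Local Open Scope ereal_scope.

(** Chebyshev: the sum of the centered indicators has second moment at most [m], the expected number
    of events, and equals [- m] when none of them occurs. *)
Lemma pairwise_indep_none (M : nat) (B : 'I_M -> set T) (p : R) :
  (0 < M)%N -> (0 < p)%R -> (forall i, measurable (B i)) ->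
  (forall i j, i != j -> P (B i `&` B j) = P (B i) * P (B j)) ->
  (forall i, p%:E <= P (B i)) ->
  P (\bigcap_(i in setT) ~` B i) <= ((M%:R * p)^-1)%:E.
Proof.
move=> M0 p0 mB indep pB.
pose q i := fine (P (B i)).
have qE i : P (B i) = (q i)%:E by rewrite fineK// fin_num_measure.
have q0 i : (0 <= q i)%R by rewrite fine_ge0.
have pq i : (p <= q i)%R by rewrite -lee_fin -qE.
pose a i w : R := (\1_(B i) w - q i)%R.
have ma i : measurable_fun setT (a i) by exact: measurable_funB.
pose m : R := (\sum_i q i)%R.
have Mm : (M%:R * p <= m)%R.
  rewrite (_ : M%:R * p = \sum_(i < M) p)%R; first exact: ler_sum.
  by rewrite sumr_const card_ord mulr_natl.
have Mp0 : (0 < M%:R * p)%R by rewrite mulr_gt0// ltr0n.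
have m0 : (0 < m)%R by exact: lt_le_trans Mm.
have ii (A : set T) : measurable A -> P.-integrable setT (fun w => (\1_A w)%:E).
  move=> mA; apply: (@bounded_integrable _ _ _ _ _ 1%R) => // w.
  by rewrite indicE; case: (_ \in _); rewrite ?normr1 ?normr0.
have aa i j : P.-integrable setT (fun w => (a i w * a j w)%:E) /\
    \int[P]_w (a i w * a j w)%:E = if i == j then (q i - q i ^+ 2)%:E else 0.
  have e w : (a i w * a j w)%:E = (\1_(B i `&` B j) w)%:E +
      ((- q j)%:E * (\1_(B i) w)%:E + ((- q i)%:E * (\1_(B j) w)%:E + (q i * q j)%:E)).
    by rewrite -!EFinM -!EFinD indicI /a/=; congr (_%:E); ring.
  have i1 := ii _ (measurableI _ _ (mB i) (mB j)).
  have i4 : P.-integrable setT (fun w : T => (q i * q j)%:E).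
    exact: finite_measure_integrable_cst.
  have i2 : P.-integrable setT (fun w => (- q j)%:E * (\1_(B i) w)%:E).
    by apply: integrableZl => //; exact: ii.
  have i3 : P.-integrable setT (fun w => (- q i)%:E * (\1_(B j) w)%:E).
    by apply: integrableZl => //; exact: ii.
  have i34 := integrableD measurableT i3 i4.
  have i234 := integrableD measurableT i2 i34.
  split.
    by apply: eq_integrable (integrableD measurableT i1 i234) => // w _; rewrite e.
  under eq_integral do rewrite e.
  rewrite integralD// integralD// integralD//.
  rewrite !integralZl//; try exact: ii.
  rewrite !integral_indic// ?setIT ?integral_cst_prob; last exact: measurableI.
  rewrite [X in (- q j)%:E * X](qE i) [X in (- q i)%:E * X](qE j).
  case: eqVneq => [ij|ij].
    rewrite -ij [X in X + _](_ : _ = (q i)%:E); last by rewrite setIid; exact: qE.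
    by rewrite -!EFinM -!EFinD; congr (_%:E); ring.
  by rewrite [X in X + _](indep i j ij) !qE -!EFinM -!EFinD; congr (_%:E); ring.
pose S w : R := (\sum_i a i w)%R.
have mS : measurable_fun setT S by exact: measurable_sum.
have IS : \int[P]_w (S w ^+ 2)%:E <= m%:E.
  have e w : (S w ^+ 2)%:E = \sum_i \sum_j (a i w * a j w)%:E.
    rewrite expr2 {1}/S mulr_suml -sumEFin; apply: eq_bigr => i _.
    by rewrite /S mulr_sumr -sumEFin.
  under eq_integral do rewrite e.
  rewrite integral_sum//; last first.
    move=> i; apply: integrable_sum => // j _; exact: (aa i j).1.
  rewrite /m -sumEFin; apply: lee_sum => i _.
  rewrite integral_sum//; last by move=> j; exact: (aa i j).1.
  rewrite (bigD1 i)//= big1 => [|j ji]; last by rewrite (aa i j).2 eq_sym (negbTE ji).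
  by rewrite adde0 (aa i i).2 eqxx lee_fin gerBl sqr_ge0.
have mN : measurable (\bigcap_(i in setT) ~` B i).
  by apply: fin_bigcap_measurable => // i _; exact: measurableC.
have : (m ^+ 2)%:E * P (\bigcap_(i in setT) ~` B i) <= m%:E.
  apply: le_trans IS; rewrite -[X in _ * P X]setIT -integral_cst ?setIT//.
  apply: (@le_trans _ _ (\int[P]_(w in \bigcap_(i in setT) ~` B i) (S w ^+ 2)%:E)).
    rewrite le_eqVlt; apply/orP; left; apply/eqP; apply: eq_integral => w; rewrite inE => Bw.
    congr (_%:E); rewrite /S /a -sqrrN -sumrN; congr (_ ^+ 2)%R.
    apply: eq_bigr => i _; rewrite indicE memNset ?sub0r ?opprK//; exact: Bw.
  apply: ge0_subset_integral => //; first exact/measurable_EFinP/measurable_funX.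
  by move=> w _; rewrite lee_fin sqr_ge0.
have : P (\bigcap_(i in setT) ~` B i) \is a fin_num by exact: fin_num_measure.
case: (P _) => // r _; rewrite -EFinM !lee_fin => h.
rewrite (@le_trans _ _ m^-1%R)//; last by rewrite lef_pV2// posrE.
rewrite -[leRHS]mulr1 ler_pdivlMl//.
by rewrite -(ler_pM2l m0) mulrA -expr2 mulr1.
Qed.

End SecondMoment.

(** * Probability that a cell is flat *)

Section SmallBall.
Context d (T : measurableType d) (R : realType) (P : probability T R).
Local Open Scope ereal_scope.

Lemma probability_ge (A : set T) (e : R) : measurable A ->
  P (~` A) <= e%:E -> (1 - e)%:E <= P A.
Proof.
move=> mA; rewrite probability_setC//.
have : P A \is a fin_num by exact: fin_num_measure.
by case: (P A) => // r _; rewrite -EFinB !lee_fin; lra.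
Qed.

Lemma probability_setC_le (A : set T) (p : R) : measurable A ->
  p%:E <= P A -> P (~` A) <= (1 - p)%:E.
Proof.
move=> mA; rewrite probability_setC//.
have : P A \is a fin_num by exact: fin_num_measure.
by case: (P A) => // r _; rewrite -EFinB !lee_fin; lra.
Qed.

Lemma measure_bigsetU_le (I : Type) (r : seq I) (A : I -> set T) :
  (forall i, measurable (A i)) ->
  P (\big[setU/set0]_(i <- r) A i) <= \sum_(i <- r) P (A i).
Proof.
move=> mA; elim: r => [|i r ih]; first by rewrite !big_nil measure0.
rewrite !big_cons; apply: le_trans (leeD (lexx _) ih); apply: measureU2 => //.
exact: bigsetU_measurable.
Qed.

Lemma cell_exists (N : nat) (y : R) : (0 < N)%N -> (0 <= y <= N%:R)%R ->
  exists j : 'I_N, (j%:R <= y <= j.+1%:R)%R.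
Proof.
move=> N0 /andP[y0 yN]; have [yN'|] := ltP y N%:R.
  have tN : (Num.truncn y < N)%N.
    by rewrite -(ltr_nat R) (le_lt_trans _ yN')// truncn_le.
  by exists (Ordinal tN) => /=; rewrite truncn_le y0 ltW//; exact: truncnS_gt.
(* The right end [y = N] goes to the last closed cell. *)
move=> Ny; have tN : (N.-1 < N)%N by rewrite prednK.
exists (Ordinal tN) => /=; rewrite prednK// yN andbT (le_trans _ Ny)// ler_nat.
exact: leq_pred.
Qed.

Lemma probability_bigsetI_le (I : Type) (r : seq I) (A : I -> set T) (e : R) :
  (forall i, measurable (A i)) -> (forall i, P (~` A i) <= e%:E) ->
  P (~` \big[setI/setT]_(i <- r) A i) <= ((size r)%:R * e)%:E.
Proof.
move=> mA Ae; elim: r => [|i r ih].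
  by rewrite big_nil setCT measure0 mul0r.
rewrite big_cons setCI /= -natr1 addrC mulrDl mul1r EFinD.
apply: le_trans (leeD (Ae i) ih); apply: measureU2; apply: measurableC => //.
by apply: bigsetI_measurable.
Qed.

Variables (dd : nat) (L : (T -> R) -> Prop) (gL : gaussian_space P L).
Hypothesis charD : forall a b : R, (0 <= a)%R -> (0 <= b)%R ->
  gauss_char (a + b)%R = (gauss_char a * gauss_char b)%R.
Variables (theta : R).
Hypotheses (theta0 : (0 < theta)%R) (dd0 : (0 < dd)%N)
  (thetad : (theta ^+ dd = 2^-1)%R).
Variable X : seq bool -> 'I_dd -> T -> R.
Hypothesis LX : forall s i, L (X s i).
Hypothesis X0 : forall s i w, X (rcons s false) i w = X s i w.
Variable A : R.
Hypothesis A0 : (0 <= A)%R.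
Hypothesis XA : forall s i,
  (mom2 P (fun w => X (rcons s true) i w - X s i w)%R <= A * theta ^+ (2 * size s))%R.

(** Chosen so that [theta ^ n = 16^-1], the rate asked for by the chaining lemmas. *)
Let n := (4 * dd)%N.
Let n_gt0 : (0 < n)%N. Proof. by rewrite muln_gt0. Qed.
Let theta_n : (theta ^+ n = 16^-1)%R.
Proof. by rewrite /n mulnC exprM thetad; field. Qed.
Let theta1 : (theta < 1)%R.
Proof.
rewrite ltNge; apply/negP => h; have : (1 <= theta ^+ dd)%R by exact: exprn_ege1.
by rewrite thetad; lra.
Qed.

Lemma measurable_X s i : measurable_fun setT (X s i). Proof. exact: (gsM gL (LX s i)). Qed.

Lemma cat_nseq_false s k i w : X (s ++ nseq k false) i w = X s i w.
Proof.
elim: k s => [|k ih] s /=; first by rewrite cats0.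
by rewrite -cat_rcons ih X0.
Qed.

Lemma osc_tail : exists2 C : R, (0 <= C)%R & forall s (r : R), (0 < r)%R ->
  P (~` osc X s (r * theta ^+ size s)) <= (C / r ^+ n.*2)%:E.
Proof.
have [C C0 HC] := gaussian_osc 'I_dd gL n_gt0 (ltW theta0) theta_n.
exists (C * A ^+ n)%R => [|s r r0]; first by rewrite mulr_ge0// exprn_ge0.
have t0 k : (0 < theta ^+ k)%R by rewrite exprn_gt0.
have := HC X s (A * theta ^+ (2 * size s))%R (r * theta ^+ size s)%R.
rewrite mulr_ge0 ?mulr_gt0// ?(ltW (t0 _))// => /(_ isT isT LX X0 _)/le_trans; apply.
  move=> t i; apply: (le_trans (XA _ _)); rewrite size_cat -mulrA -exprD ler_wpM2l//.
  apply: ler_wiXn2l; rewrite ?ltW//; lia.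
have -> : (A * theta ^+ (2 * size s) / (r * theta ^+ size s) ^+ 2 = A / r ^+ 2)%R.
  by rewrite mulnC exprM; field; rewrite !gt_eqF.
by rewrite lee_fin expr_div_n -exprM mul2n mulrA.
Qed.

(* By pigeonhole some profile of the increments is shared, up to an error, by
   two independent copies with positive probability; the symmetrized field has
   the same law as X. *)
Lemma small_ball (eta : R) : (0 < eta)%R -> exists2 p : R, (0 < p)%R &
  forall s, p%:E <= P (osc X s (eta * theta ^+ size s)%R).
Proof.
move=> eta0; have [C C0 HC] := osc_tail.
have e3 : (0 < eta / 3)%R by rewrite divr_gt0.
pose e := (eta / 3)%R.
have e0 : (0 < e)%R by [].
(* A depth [m] below [s] at which the tail bound, of order [256 ^ - m], beats the number [2 ^ m] of
   subcells. *)
have [m Hm] : exists m, (2 ^+ m * (C / (e / theta ^+ m) ^+ n.*2) <= 4^-1)%R.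
  pose m := (Num.truncn (4 * (C / e ^+ n.*2))%R).+1; exists m.
  have Km : (4 * (C / e ^+ n.*2) <= 128 ^+ m)%R.
    have : (4 * (C / e ^+ n.*2) < m%:R)%R by exact: truncnS_gt.
    move=> /ltW/le_trans; apply; rewrite -natrX ler_nat ltnW// ltn_expl//.
  have tm : (theta ^+ m != 0)%R by rewrite gt_eqF// exprn_gt0.
  have -> : ((e / theta ^+ m) ^+ n.*2 = e ^+ n.*2 * 256 ^+ m)%R.
    have -> : (256 = (theta ^+ n.*2)^-1 :> R)%R by rewrite -mul2n mulnC exprM theta_n; field.
    by rewrite expr_div_n exprVn -!exprM mulnC.
  have e2n : (0 < e ^+ n.*2)%R by exact: exprn_gt0.
  have -> : (2 ^+ m * (C / (e ^+ n.*2 * 256 ^+ m)) = (C / e ^+ n.*2) / 128 ^+ m)%R.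
    have -> : (256 ^+ m = 2 ^+ m * 128 ^+ m :> R)%R by rewrite -exprMn; congr (_ ^+ m)%R; ring.
    have a0 : (2 ^+ m != 0 :> R)%R by rewrite expf_neq0.
    have b0 : (128 ^+ m != 0 :> R)%R by rewrite expf_neq0.
    move: (2 ^+ m)%R (128 ^+ m)%R (e ^+ n.*2)%R a0 b0 (lt0r_neq0 e2n) => x y z *.
    by field; do ?[apply/andP; split].
  by rewrite ler_pdivrMr ?exprn_gt0//; lra.
(* The oscillation over the whole cell is at most [k * e * rs] with probability at least 3/4, so
   that only finitely many profiles have to be considered. *)
have [k [k0 Hk]] : exists k : nat, (0 < k)%N /\ (C / (k%:R * e) ^+ n.*2 <= 4^-1)%R.
  pose k := (Num.truncn (4 * (C / e ^+ n.*2))%R).+1; exists k; split => //.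
  have kn : (k%:R <= k%:R ^+ n.*2 :> R)%R.
    by rewrite ler_eXnr ?double_gt0// ler1n.
  have K1 : (4 * (C / e ^+ n.*2) < k%:R)%R by exact: truncnS_gt.
  rewrite exprMn invfM mulrCA ler_pdivrMl ?exprn_gt0 ?ltr0n//.
  by lra.
pose J : finType := (m.-tuple bool * 'I_dd)%type.
pose K : finType := {ffun J -> 'I_(2 * k)}.
have kk0 : (0 < 2 * k)%N by rewrite muln_gt0.
have N0 : (0 < #|K|)%N by apply/card_gt0P; exists [ffun=> Ordinal kk0].
(* The event [E] below has probability at least 1/2 and is covered by [#|K|] profile events, so one
   of them has probability at least [1 / (4 #|K|)]; the square comes from the two copies. *)
exists ((4 * #|K|%:R)^-1 ^+ 2)%R; first by rewrite exprn_gt0// invr_gt0 mulr_gt0// ltr0n.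
move=> s; set rs := (theta ^+ size s)%R.
have rs0 : (0 < rs)%R by exact: exprn_gt0.
pose E1 := \big[setI/setT]_(t <- words m) osc X (s ++ t) (e * rs)%R.
pose E2 := osc X s (k%:R * e * rs)%R.
have mosc t r : measurable (osc X t r) by apply: measurable_osc => *; exact: measurable_X.
have mE1 : measurable E1 by apply: bigsetI_measurable => *.
have PE1 : P (~` E1) <= (4^-1)%:E.
  (* [probability_bigsetI_le] wants one bound for all words, so those of another length receive the
     full set. *)
  pose B t := if size t == m then osc X (s ++ t) (e * rs)%R else setT.
  have -> : E1 = \big[setI/setT]_(t <- words m) B t.
    rewrite /E1 big_seq [RHS]big_seq; apply: eq_bigr => t.
    by rewrite mem_words /B => ->.
  have -> : (4^-1 = (size (words m))%:R * (4^-1 / (2 ^+ m)) :> R)%R.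
    by rewrite size_words natrX; field; rewrite expf_neq0.
  apply: probability_bigsetI_le => t; first by rewrite /B; case: ifP.
  rewrite /B; case: ifP => [/eqP st|_]; last by rewrite setCT measure0 lee_fin.
  have := HC (s ++ t) (e / theta ^+ m)%R; rewrite divr_gt0 ?exprn_gt0// => /(_ isT).
  have -> : (e / theta ^+ m * theta ^+ size (s ++ t) = e * rs)%R.
    by rewrite size_cat st exprD /rs; field; rewrite gt_eqF// exprn_gt0.
  move=> /le_trans; apply; rewrite lee_fin.
  by rewrite ler_pdivlMr ?exprn_gt0// mulrC.
have PE2 : P (~` E2) <= (4^-1)%:E.
  have ke0 : (0 < k%:R * e)%R by rewrite mulr_gt0// ltr0n.
  by apply: le_trans (HC s (k%:R * e)%R ke0) _; rewrite lee_fin.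
pose E := E1 `&` E2.
have mE2 : measurable E2 by exact: mosc.
have mE : measurable E by exact: measurableI.
have PE : (2^-1)%:E <= P E.
  have -> : (2^-1 = 1 - (4^-1 + 4^-1) :> R)%R by field.
  apply: probability_ge => //; rewrite setCI EFinD.
  by apply: le_trans (leeD PE1 PE2); apply: measureU2; exact: measurableC.
(* The shift by [k] brings the rescaled increments into [[0, 2 k]] on [E2]. *)
pose Y (j : J) w : R := ((X (s ++ j.1) j.2 w - X s j.2 w) / (e * rs) + k%:R)%R.
have mY j : measurable_fun setT (Y j).
  apply: measurable_funD => //; apply: measurable_funM => //.
  by apply: measurable_funB; exact: measurable_X.
pose Ek (f : K) := E `&` \bigcap_(j : J) (Y j @^-1` `[(f j)%:R, (f j).+1%:R]%classic).
have mEk f : measurable (Ek f).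
  apply: measurableI => //; apply: fin_bigcap_measurable => // j _.
  by rewrite -[_ @^-1` _]setTI; exact: mY.
have ers : (0 < e * rs)%R by rewrite mulr_gt0.
have EU : E `<=` \big[setU/set0]_(f : K) Ek f.
  move=> w Ew; rewrite -bigcup_seq.
  have cj (j : J) : exists f : 'I_(2 * k), (f%:R <= Y j w <= f.+1%:R)%R.
    apply: cell_exists => //; case: Ew => _ /(_ j.1 j.2).
    rewrite ler_norml -mulrA -mulNr => /andP[h1 h2].
    rewrite /Y -lerBlDr sub0r ler_pdivlMr// mulNr -mulNr h1/=.
    by rewrite mulnC muln2 -addnn natrD lerD2r ler_pdivrMr.
  have [f hf] := choice cj; exists (finfun f); first by rewrite /= mem_index_enum.
  by split => // j _; rewrite /= in_itv/= ffunE.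
have [f Pf] : exists f, ((4 * #|K|%:R)^-1)%:E <= P (Ek f).
  apply: contrapT => /forallNP h.
  have : P E < (2^-1)%:E.
    have mU : measurable (\big[setU/set0]_(f : K) Ek f) by exact: bigsetU_measurable.
    apply: (@le_lt_trans _ _ (\sum_(f : K) P (Ek f))).
      apply: (@le_trans _ _ (P (\big[setU/set0]_(f : K) Ek f))).
        by apply: le_measure; rewrite ?inE.
      exact: measure_bigsetU_le.
    apply: (@le_lt_trans _ _ (\sum_(f : K) ((4 * #|K|%:R)^-1)%:E)).
      by apply: lee_sum => f _; apply: ltW; rewrite ltNge; apply/negP; exact: h.
    rewrite sumEFin sumr_const -[X in X%:E < _]mulr_natl lte_fin.
    have K0 : (0 < #|K|%:R :> R)%R by rewrite ltr0n.
    have -> : (#|K|%:R * (4 * #|K|%:R)^-1 = 4^-1 :> R)%R by field; rewrite gt_eqF.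
    by rewrite ltf_pV2 ?posrE// ltr_nat.
  by rewrite ltNge PE.
rewrite oscE (@symmetrized_law _ _ _ P L gL charD _ 
  (fun k => X k.1 k.2) (tosc s (eta * rs)%R)); last 2 first.
- by move=> ?; exact: LX.
- exact: tset_tosc.
apply: (@le_trans _ _ ((P \x P) (Ek f `*` Ek f))).
  have K0 : 0 <= ((4 * #|K|%:R)^-1)%:E :> \bar R by rewrite lee_fin invr_ge0 mulr_ge0.
  by rewrite product_measure1E// expr2 EFinM; exact: lee_pmul.
apply: le_measure; rewrite ?inE.
- exact: measurableX.
- apply: (@tset_measurable _ _ _ _ (fun (k : seq bool * 'I_dd) (z : T * T) =>
    (X k.1 k.2 z.1 - X k.1 k.2 z.2) / Num.sqrt 2)%R); last exact: tset_tosc.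
  move=> k'; apply: measurable_funM => //; apply: measurable_funB;
  by apply: measurableT_comp => //; exact: measurable_X.
move=> [w w'] [/= [[E1w E2w] fw] [[E1w' E2w'] fw']] t i /=.
pose D t' w := (X (s ++ t') i w - X s i w)%R.
have E1P t' v : E1 v -> size t' = m ->
    forall t'', (`|X ((s ++ t') ++ t'') i v - X (s ++ t') i v| <= e * rs)%R.
  rewrite /E1 -bigcap_seq => h st t''; have := h t'; rewrite /= mem_words st eqxx.
  by move=> /(_ isT) /(_ t'' i).
(* a word of length m below which t branches off, up to trailing left turns *)
pose t1 := take m (t ++ nseq m false); pose t2 := drop m (t ++ nseq m false).
have st1 : size t1 = m by rewrite size_takel// size_cat size_nseq leq_addl.
have tE v : X (s ++ t) i v = X ((s ++ t1) ++ t2) i v.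
  by rewrite -catA cat_take_drop catA cat_nseq_false.
have D1 : (`|D t1 w - D t1 w'| <= e * rs)%R.
  have := fw (@Tuple m _ t1 (introT eqP st1), i) Logic.I.
  have := fw' (@Tuple m _ t1 (introT eqP st1), i) Logic.I.
  rewrite /= !in_itv/= /Y /=; set j := f _; rewrite -natr1 => /andP[a1 a2] /andP[b1 b2].
  have : (`|(X (s ++ t1) i w - X s i w) / (e * rs) -
      (X (s ++ t1) i w' - X s i w') / (e * rs)| <= 1)%R.
    by rewrite ler_norml; apply/andP; split; lra.
  by rewrite -mulrBl normrM normfV (gtr0_norm ers) ler_pdivrMr// mul1r.
have h1 := E1P t1 w E1w st1 t2; have h2 := E1P t1 w' E1w' st1 t2.
have c1 : (0 < Num.sqrt 2 :> R)%R by rewrite sqrtr_gt0.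
have c2 : (1 <= Num.sqrt 2 :> R)%R by rewrite -[X in (X <= _)%R]sqrtr1 ler_sqrt// ler1n.
rewrite -mulrBl normrM normfV (gtr0_norm c1) ler_pdivrMr//.
apply: (@le_trans _ _ (eta * rs)%R); last by rewrite ler_peMr// mulr_ge0// ltW.
(* One [e] for each copy inside the subcell, one for the two profiles at depth [m]; the factor
   [1 / sqrt 2] only helps. *)
have -> : (eta * rs = e * rs + e * rs + e * rs)%R by rewrite /e; field.
rewrite !tE.
rewrite (_ : _ - _ = (X ((s ++ t1) ++ t2) i w - X (s ++ t1) i w) -
   (X ((s ++ t1) ++ t2) i w' - X (s ++ t1) i w') + (D t1 w - D t1 w'))%R; last by rewrite /D; ring.
apply: (le_trans (ler_normD _ _)); apply: lerD => //.
by apply: (le_trans (ler_normB _ _)); apply: lerD.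
Qed.

Definition bad (lev : seq nat) (eta : R) (c : seq bool) : set T :=
  [set w | forall l, l \in lev -> ~ osc X (take l c) (eta * theta ^+ l)%R w].

Lemma measurable_bad lev eta c : measurable (bad lev eta c).
Proof.
rewrite (_ : bad lev eta c = \bigcap_(l in [set` lev])
    ~` osc X (take l c) (eta * theta ^+ l)%R) //.
apply: fin_bigcap_measurable; first exact: finite_seq.
by move=> l _; apply: measurableC; apply: measurable_osc => *; exact: measurable_X.
Qed.

(* At depths m and beyond, X varies like V m, and the V m are independent for
   depths that differ by q at least. *)
Hypothesis scales : forall delta : R, (0 < delta)%R ->
  exists q n1 (V : nat -> seq bool -> 'I_dd -> T -> R),
  [/\ forall m, (n1 <= m)%N -> forall s i, L (V m s i),
      forall m s i w, V m (rcons s false) i w = V m s i w,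
      forall m s t i, (n1 <= m)%N -> size s = m ->
        (mom2 P (fun w => (X (rcons (s ++ t) true) i w - V m (rcons (s ++ t) true) i w) -
           (X (s ++ t) i w - V m (s ++ t) i w))%R <=
         delta * theta ^+ (2 * m) * theta ^+ size t)%R
    & forall m m' (E F : set (seq bool * 'I_dd -> R)), (n1 <= m)%N -> (m + q <= m')%N ->
        tset E -> tset F ->
        P ([set w | E (fun k => V m k.1 k.2 w)] `&` [set w | F (fun k => V m' k.1 k.2 w)]) =
        P [set w | E (fun k => V m k.1 k.2 w)] * P [set w | F (fun k => V m' k.1 k.2 w)]].

(** Along a branch, the approximating fields at [M] levels spaced by [q] give pairwise independent
    events of probability at least [p / 2], and [pairwise_indep_none] bounds the chance that all
    fail. The thresholds are [e] for [X], then [2 e] for [V], then [3 e = eta] for [X] again, each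
    passage costing the oscillation [e] of the difference. The levels are the same for all
    branches. *)
Lemma bad_small (eta eps : R) (N0 : nat) : (0 < eta)%R -> (0 < eps)%R ->
  exists lev N, [/\ (N0 <= N)%N, forall l, l \in lev -> (N0 <= l <= N)%N &
    forall c, size c = N -> P (bad lev eta c) <= eps%:E].
Proof.
move=> eta0 eps0; pose e := (eta / 3)%R; have e0 : (0 < e)%R by rewrite divr_gt0.
have [p p0 Hp] := small_ball e0.
have [C C0 HC] := gaussian_osc 'I_dd gL n_gt0 (ltW theta0) theta_n.
pose M := (Num.truncn (4 / (eps * p))%R).+1.
have M0 : (0 < M)%N by [].
have MR : (0 < M%:R :> R)%R by rewrite ltr0n.
have HM : ((M%:R * (p / 2))^-1 <= eps / 2)%R.
  have h : (4 / (eps * p) <= M%:R)%R by apply: ltW; exact: truncnS_gt.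
  rewrite -[leLHS]mul1r ler_pdivrMr ?mulr_gt0 ?divr_gt0//.
  move: h; rewrite ler_pdivrMr ?mulr_gt0// => h; lra.
(* The first bound preserves half of [p]; the second keeps the total error of the [M] levels below
   [eps / 2]. *)
pose tau := Num.min (p / 2)%R (eps / (2 * M%:R))%R.
have tau0 : (0 < tau)%R by rewrite lt_min !divr_gt0// mulr_gt0.
(* The first bound makes [delta / e ^ 2] at most 1, so that its power [n] is no larger than itself;
   the second then brings the tail below [tau]. *)
pose delta := Num.min (e ^+ 2)%R (tau * e ^+ 2 / (C + 1))%R.
have C1 : (0 < C + 1)%R by rewrite ltr_wpDl.
have delta0 : (0 < delta)%R by rewrite lt_min exprn_gt0// !mulr_gt0 ?exprn_gt0 ?invr_gt0.
have [q [n1 [V [LV V0 VX indepV]]]] := scales delta0.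
pose n0 := maxn N0 n1.
pose lv i := (n0 + q * i)%N.
have lv_n1 i : (n1 <= lv i)%N := leq_trans (leq_maxr _ _) (leq_addr _ _).
have lv_N0 i : (N0 <= lv i)%N := leq_trans (leq_maxl _ _) (leq_addr _ _).
exists [seq lv i | i <- iota 0 M], (lv M); split => // [l /mapP[i]|c sc].
  by rewrite mem_iota add0n => /andP[_ iM] ->; rewrite lv_N0 leq_add2l leq_mul2l (ltnW iM) orbT.
have st i : (i < M)%N -> size (take (lv i) c) = lv i.
  move=> iM; rewrite size_takel// sc /lv leq_add2l leq_mul2l (ltnW iM) orbT//.
pose B (i : 'I_M) := osc (V (lv i)) (take (lv i) c) (2 * e * theta ^+ lv i)%R.
pose Er (i : nat) s j w : R := (X s j w - V (lv i) s j w)%R.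
pose F (i : nat) := osc (Er i) (take (lv i) c) (e * theta ^+ lv i)%R.
have LE i s j : L (Er i s j) by apply: (gsB gL) => //; exact: LV.
have mB i : measurable (B i).
  by apply: measurable_osc => t j; exact: (gsM gL (LV _ (lv_n1 i) _ _)).
have mF i : measurable (F i) by apply: measurable_osc => t j; exact: (gsM gL (LE _ _ _)).
have PF i : (i < M)%N -> P (~` F i) <= tau%:E.
  move=> iM; have t0 k : (0 < theta ^+ k)%R by rewrite exprn_gt0.
  have := HC (Er i) (take (lv i) c) (delta * theta ^+ (2 * lv i))%R (e * theta ^+ lv i)%R.
  rewrite !mulr_gt0 ?mulr_ge0 ?(ltW delta0) ?(ltW (t0 _))// => /(_ isT isT (LE i)).
  have h1 t j w : Er i (rcons t false) j w = Er i t j w by rewrite /Er X0 V0.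
  move=> /(_ h1) /(_ (fun t j => VX _ _ t j (lv_n1 i) (st _ iM))) /le_trans; apply.
  rewrite lee_fin.
  have -> : (delta * theta ^+ (2 * lv i) / (e * theta ^+ lv i) ^+ 2 = delta / e ^+ 2)%R.
    by rewrite mulnC exprM; field; rewrite !gt_eqF.
  have e2 : (0 < e ^+ 2)%R by rewrite exprn_gt0.
  have d1 : (delta / e ^+ 2 <= 1)%R by rewrite ler_pdivrMr// mul1r ge_min lexx.
  have d2 : (delta / e ^+ 2 <= tau / (C + 1))%R.
    rewrite ler_pdivrMr// (_ : tau / (C + 1) * e ^+ 2 = tau * e ^+ 2 / (C + 1))%R; last by ring.
    by rewrite ge_min lexx orbT.
  have d3 : (0 <= delta / e ^+ 2)%R by rewrite divr_ge0// ltW.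
  apply: (@le_trans _ _ (C * (tau / (C + 1)))%R).
    rewrite ler_wpM2l// (le_trans _ d2)//.
    by rewrite -[leRHS]expr1 ler_wiXn2l.
  by rewrite mulrCA ger_pMr// ler_pdivrMr// mul1r lerDl.
have PB i : (p / 2)%:E <= P (B i).
  have FB : osc X (take (lv i) c) (e * theta ^+ lv i)%R `&` F i `<=` B i.
    move=> w [h1 h2] t j.
    have := h1 t j; have := h2 t j; rewrite /Er => a1 a2.
    rewrite (_ : V _ _ _ _ - _ = (X (take (lv i) c ++ t) j w - X (take (lv i) c) j w) -
      (X (take (lv i) c ++ t) j w - V (lv i) (take (lv i) c ++ t) j w -
      (X (take (lv i) c) j w - V (lv i) (take (lv i) c) j w)))%R; last by ring.
    apply: (le_trans (ler_normB _ _)).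
    by rewrite (_ : 2 * e * _ = e * theta ^+ lv i + e * theta ^+ lv i)%R ?lerD//; ring.
  have mO : measurable (osc X (take (lv i) c) (e * theta ^+ lv i)%R).
    by apply: measurable_osc => *; exact: measurable_X.
  apply: le_trans (le_measure P _ _ FB); rewrite ?inE//; last exact: measurableI.
  have -> : (p / 2 = 1 - ((1 - p) + p / 2))%R by field.
  apply: probability_ge; first exact: measurableI.
  rewrite setCI EFinD; apply: le_trans (measureU2 _ _ _) _; try exact: measurableC.
  apply: leeD; last by apply: le_trans (PF i (ltn_ord i)) _; rewrite lee_fin ge_min lexx.
  have Op := Hp (take (lv i) c); rewrite st// in Op.
  exact: probability_setC_le.
have BB (i j : 'I_M) : i != j -> P (B i `&` B j) = P (B i) * P (B j).
  wlog ij : i j / (i < j)%N => [H ij|_].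
    have : (i < j)%N || (j < i)%N by rewrite -neq_ltn.
    case/orP => h; first exact: H.
    by rewrite setIC muleC; apply: H => //; rewrite eq_sym.
  rewrite /B !oscE; apply: indepV => //; last 2 first.
  - exact: tset_tosc.
  - exact: tset_tosc.
  by rewrite /lv -addnA leq_add2l addnC -mulnS leq_mul2l ij orbT.
have PN := pairwise_indep_none M0 (divr_gt0 p0 (ltr0n _ 2)) mB BB PB.
have badS : bad [seq lv i | i <- iota 0 M] eta c `<=`
    (\bigcap_(i in setT) ~` B i) `|` \big[setU/set0]_(i < M) ~` F i.
  move=> w h; have [|hF] := pselect (exists i : 'I_M, ~ F i w).
    by move=> [i Fi]; right; rewrite -bigcup_seq; exists i => //=; rewrite mem_index_enum.
  left => i _ Bi; have Fi : F i w by apply: contrapT => ?; apply: hF; exists i.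
  apply: (h (lv i)); first by rewrite map_f// mem_iota add0n ltn_ord.
  move=> t j; have := Bi t j; have := Fi t j; rewrite /Er => a1 a2.
  rewrite (_ : X _ _ _ - _ = (V (lv i) (take (lv i) c ++ t) j w - V (lv i) (take (lv i) c) j w) +
      (X (take (lv i) c ++ t) j w - V (lv i) (take (lv i) c ++ t) j w -
      (X (take (lv i) c) j w - V (lv i) (take (lv i) c) j w)))%R; last by ring.
  apply: (le_trans (ler_normD _ _)).
  by rewrite (_ : eta * _ = 2 * e * theta ^+ lv i + e * theta ^+ lv i)%R ?lerD// /e; field.
have mN : measurable (\bigcap_(i in setT) ~` B i).
  by apply: fin_bigcap_measurable => // i _; exact: measurableC.
have mU : measurable (\big[setU/set0]_(i < M) ~` F i).
  by apply: bigsetU_measurable => i _; exact: measurableC.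
apply: (le_trans (le_measure P (mem_set (measurable_bad _ _ _))
  (mem_set (measurableU _ _ mN mU)) badS)).
apply: le_trans (measureU2 _ _ _) _ => //.
have -> : (eps = eps / 2 + \sum_(i < M) (eps / (2 * M%:R)))%R.
  by rewrite sumr_const card_ord -[(_ *+ M)%R]mulr_natl; field; rewrite gt_eqF.
rewrite EFinD; apply: leeD; first by apply: le_trans PN _; rewrite lee_fin.
have mFC (i : 'I_M) : measurable (~` F i) by exact: measurableC.
apply: (le_trans (measure_bigsetU_le (index_enum 'I_M) mFC)).
rewrite -sumEFin; apply: lee_sum => i _.
by apply: le_trans (PF i (ltn_ord i)) _; rewrite lee_fin ge_min lexx orbT.
Qed.

End SmallBall.

(** * Hitting a point on the tree *)

Section TreeBound.
Variable R : realType.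
Local Open Scope ereal_scope.

(* Descending from the root, stop at the first good node of a level in lev; the
   deepest nodes without good ancestor are paid at the price b + z. *)
Lemma tree_bound (H : seq bool -> \bar R) (N : nat) (lev : seq nat)
    (good : seq bool -> Prop) (a b : R) (z : seq bool -> \bar R) :
  (0 <= a)%R -> (0 <= b)%R -> (forall c, 0 <= z c) ->
  (forall s, H s <= H (rcons s false) + H (rcons s true)) ->
  (forall s, size s \in lev -> good s -> H s <= (a / 2 ^+ size s)%:E) ->
  (forall c, size c = N -> H c <= b%:E + z c) ->
  forall n s, (size s + n)%N = N -> H s <= (a / 2 ^+ size s)%:E +
    \sum_(u <- words n) ((b * `[< forall l, l \in lev -> (size s <= l <= N)%N ->
       ~ good (take l (s ++ u)) >]%:R)%:E + z (s ++ u)).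
Proof.
move=> a0 b0 z0 Hs Hgood Hend.
have t0 s n F : 0 <= \sum_(u <- words n) ((b * (F u : bool)%:R)%:E + z (s ++ u)).
  by apply: sume_ge0 => u _; rewrite adde_ge0// lee_fin mulr_ge0.
have a2 n : (0 <= a / 2 ^+ n)%R by rewrite divr_ge0// exprn_ge0.
elim=> [s sN|n ih s sN].
  rewrite addn0 in sN; rewrite /= big_seq1 cats0.
  case: asboolP => [_|/existsNP[l /not_implyP[ll /not_implyP[lN /contrapT gl]]]].
    by rewrite mulr1; apply: le_trans (Hend _ sN) _; rewrite leeDr ?lee_fin.
  have e : l = size s by apply/eqP; rewrite eqn_leq andbC {2}sN.
  apply: le_trans (Hgood s _ _) _; rewrite -?e//; first by rewrite e take_size in gl.
  by rewrite leeDl// adde_ge0// mulr0.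
have [[ls gs]|nogood] := pselect (size s \in lev /\ good s).
  by apply: le_trans (Hgood s ls gs) _; rewrite leeDl.
apply: le_trans (Hs s) _; rewrite big_wordsS.
(* The allowance of a node is shared exactly between its two children. *)
have half : ((a / 2 ^+ size s)%:E =
    (a / 2 ^+ (size s).+1)%:E + (a / 2 ^+ (size s).+1)%:E :> \bar R).
  by rewrite -EFinD exprS; congr (_%:E); field; rewrite expf_neq0.
rewrite half addeACA; have step (x : bool) : H (rcons s x) <= (a / 2 ^+ (size s).+1)%:E +
  \sum_(u <- words n) ((b * `[< forall l, l \in lev -> (size s <= l <= N)%N ->
       ~ good (take l (s ++ x :: u)) >]%:R)%:E + z (s ++ x :: u)).
  have sN' : (size (rcons s x) + n)%N = N by rewrite size_rcons addSnnS.
  apply: le_trans (ih _ sN') _; rewrite size_rcons leeD2l//.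
  apply: lee_sum => u _; rewrite -cat_rcons leeD2r// lee_fin ler_wpM2l// ler_nat.
  case: asboolP => [h1|//]; case: asboolP => // h2; exfalso; apply: h2 => l ll /andP[].
  rewrite leq_eqVlt => /predU1P[e _ g|sl lN]; last by apply: h1 => //; rewrite sl.
  by apply: nogood; rewrite e; split => //; move: g; rewrite -e cat_rcons take_size_cat.
exact: leeD (step false) (step true).
Qed.

End TreeBound.

(** [B] differs from the identity by at most 1/2 in maximal row sum, hence
    [max |h| <= r + max |h| / 2]. *)
Lemma near_identity_le (R : realType) n (B : 'I_n -> 'I_n -> R) (h : 'I_n -> R) (r : R) :
  0 <= r -> (forall i, \sum_j `|B i j - (i == j)%:R| <= 2^-1) ->
  (forall i, `|\sum_j B i j * h j| <= r) -> forall i, `|h i| <= 2 * r.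
Proof.
move=> r0 B1 Bh; pose m := \big[Num.max/0]_j `|h j|.
have hm j : `|h j| <= m by exact: le_bigmax.
suff m2 : m <= r + m / 2 by move=> i; apply: (le_trans (hm i)); lra.
have m0 : 0 <= m by rewrite /m; apply: bigmax_ge_id.
apply: bigmax_le => [|i _]; first by rewrite addr_ge0// divr_ge0.
have -> : h i = \sum_j B i j * h j - \sum_j (B i j - (i == j)%:R) * h j.
  under [X in _ - X]eq_bigr do rewrite mulrBl.
  rewrite sumrB opprB addrC subrK (bigD1 i)//= eqxx mul1r big1 ?addr0// => j.
  by rewrite eq_sym => /negbTE ->; rewrite mul0r.
apply: (le_trans (ler_normB _ _)); apply: lerD => //.
apply: (le_trans (ler_norm_sum _ _ _)).
apply: (@le_trans _ _ (\sum_j `|B i j - (i == j)%:R| * m)).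
  by apply: ler_sum => j _; rewrite normrM ler_wpM2l.
by rewrite -mulr_suml mulrC ler_wpM2l.
Qed.

Lemma truncnS_inv_le (R : realType) (e : R) : 0 < e ->
  (Num.truncn e^-1).+1%:R^-1 <= e.
Proof.
by move=> e0; rewrite -[leRHS]invrK lef_pV2 ?posrE ?ltr0n ?invr_gt0// ltW//; exact: truncnS_gt.
Qed.

Lemma expr_addn_le (R : realType) n (a b : R) : 0 <= a -> 0 <= b ->
  (a + b) ^+ n <= 2 ^+ n * (a ^+ n + b ^+ n).
Proof.
wlog ab : a b / a <= b => [H a0 b0|a0 b0].
  by case: (leP a b) => [|/ltW] h; [exact: H|rewrite addrC (addrC (a ^+ n)); exact: H].
apply: (@le_trans _ _ ((2 * b) ^+ n)).
  by rewrite lerXn2r ?nnegrE ?addr_ge0 ?mulr_ge0// mulr2n mulrDl mul1r lerD2r.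
by rewrite exprMn ler_wpM2l ?exprn_ge0// lerDr exprn_ge0.
Qed.

Lemma null_of_le (R : realType) (C : R) (y : \bar R) : (0 <= C)%R -> (0 <= y)%E ->
  (forall eta, (0 < eta <= 1)%R -> (y <= (C * eta)%:E)%E) -> y = 0%E.
Proof.
move=> C0 y0 h; apply/eqP; rewrite eq_le y0 andbT; apply/lee_addgt0Pr => e e0.
have C1 : (0 < C + 1)%R by rewrite ltr_wpDl.
pose t := Num.min 1%R (e / (C + 1))%R.
have t0 : (0 < t <= 1)%R by rewrite lt_min ltr01 divr_gt0//= ge_min lexx.
rewrite add0e; apply: (le_trans (h t t0)); rewrite lee_fin.
apply: (@le_trans _ _ ((C + 1) * (e / (C + 1)))%R); last by rewrite mulrC divfK// gt_eqF.
by rewrite ler_pM// ?lerDl//; [lra|rewrite ge_min lexx orbT].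
Qed.

Section Hit.
Context (R : realType) (dd : nat) (z : 'I_dd -> R).

(** For a continuous path on a compact box and a countable dense set of points [q], this amounts to
    attaining [z]. Being made of countably many conditions on coordinates, it is a [tset]. *)
Definition approached (Q : Type) : set (Q * 'I_dd -> R) :=
  [set f | forall m : nat, exists q, forall i, `|f (q, i) - z i| <= m.+1%:R^-1].

Lemma tset_approached (Q : countType) : tset (@approached Q).
Proof.
rewrite (_ : @approached Q = \bigcap_(m : nat) \bigcup_(q : Q) \bigcap_(i : 'I_dd)
    [set f | `|lform [:: (1, (q, i))] f - z i| <= m.+1%:R^-1]).
  apply: tset_bigcap => m; apply: tset_bigcup => t; apply: tset_bigcap => i.
  exact: tset_abs_le.
have e (f : Q * 'I_dd -> R) p : lform [:: (1, p)] f = f p by rewrite /lform big_seq1 mul1r.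
apply/seteqP; split => f h m.
- by move=> _; have [t ht] := h m; exists t => // i _ /=; rewrite e.
- by have [t _ ht] := h m Logic.I; exists t => i; rewrite -(e f); exact: (ht i Logic.I).
Qed.

Definition hit (s : seq bool) : set (seq bool * 'I_dd -> R) :=
  [set f | approached (fun p => f (s ++ p.1, p.2))].

Lemma tset_hit s : tset (hit s).
Proof. exact: (tset_reindex (fun p => (s ++ p.1, p.2)) (tset_approached _)). Qed.

(** Were both children missed, at precisions [m0] and [m1], a point of the parent at precision
    [maxn m0 m1] would contradict one of them. The parent node itself counts as a point of the left
    child, since both have the same value. *)
Lemma hit_split s f : (forall s i, f (rcons s false, i) = f (s, i)) ->
  hit s f -> hit (rcons s false) f \/ hit (rcons s true) f.
Proof.
move=> f0 h; apply: contrapT => /not_orP[/existsNP[m0 h0] /existsNP[m1 h1]].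
have [t ht] := h (maxn m0 m1).
have le0 m : (m <= maxn m0 m1)%N -> (maxn m0 m1).+1%:R^-1 <= m.+1%:R^-1 :> R.
  by move=> mm; rewrite lef_pV2 ?posrE ?ltr0n// ler_nat.
case: t ht => [|[] t] ht.
- apply: h0; exists [::] => i; rewrite /= cats0 f0; apply: le_trans (le0 _ (leq_maxl _ _)).
  by have := ht i; rewrite /= cats0.
- by apply: h1; exists t => i; rewrite /= cat_rcons; exact: le_trans (ht i) (le0 _ (leq_maxr _ _)).
- by apply: h0; exists t => i; rewrite /= cat_rcons; exact: le_trans (ht i) (le0 _ (leq_maxl _ _)).
Qed.

End Hit.

(** * Hitting probability of the resampled field *)

Section Core.
Context d (T : measurableType d) (R : realType) (P : probability T R) (dd : nat).
Local Open Scope ereal_scope.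
Variables (L : (T -> R) -> Prop) (gL : gaussian_space P L).
Hypothesis charD : forall a b : R, (0 <= a)%R -> (0 <= b)%R ->
  gauss_char (a + b)%R = (gauss_char a * gauss_char b)%R.
Variables (X : seq bool -> 'I_dd -> T -> R) (G : 'I_dd -> T -> R) (sg : R).
Hypothesis LX : forall s i, L (X s i).
Hypothesis X0 : forall s i w, X (rcons s false) i w = X s i w.
Hypothesis LG : forall j, L (G j).
Hypothesis sg0 : (0 < sg)%R.
Hypothesis GG : forall i j, ip P (G i) (G j) = (if i == j then sg else 0)%R.

(** Coefficient on [G j] of the orthogonal projection of [X s i] on the span of [G], whose
    components are orthogonal with common variance [sg]. *)
Definition projG s i j : R := (ip P (X s i) (G j) / sg)%R.

(* X with its G-part replaced by that of an independent copy. *)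
Definition resampled (k : seq bool * 'I_dd) (p : T * T) : R :=
  (X k.1 k.2 p.1 + \sum_j projG k.1 k.2 j * (G j p.2 - G j p.1))%R.

Lemma measurable_resampled k : measurable_fun setT (resampled k).
Proof.
apply: measurable_funD; first by apply: measurableT_comp => //; exact: (gsM gL (LX _ _)).
apply: measurable_sum => j; apply: measurable_funM => //.
by apply: measurable_funB; apply: measurableT_comp => //; exact: (gsM gL (LG _)).
Qed.

Lemma resampled_rcons s i p : resampled (rcons s false, i) p = resampled (s, i) p.
Proof.
rewrite /resampled /= X0; congr (_ + _)%R; apply: eq_bigr => j _.
by congr (_ / _ * _)%R; congr ip; apply/funext => w; exact: X0.
Qed.

(** [Y], the part of [X] orthogonal to [G], is independent of [G], so [G] may be taken from the
    second copy without changing the joint law. *)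
Lemma resampled_law (E : set (seq bool * 'I_dd -> R)) : tset E ->
  P [set w | E (fun k => X k.1 k.2 w)] = (P \x P) [set p | E (resampled ^~ p)].
Proof.
move=> tE.
pose Y (k : seq bool * 'I_dd) w : R := (X k.1 k.2 w - \sum_j projG k.1 k.2 j * G j w)%R.
have LS k : L (fun w => \sum_j projG k.1 k.2 j * G j w)%R.
  by apply: (gs_sum gL) => j; exact: (gsZ gL).
have LY k : L (Y k) by exact: (gsB gL (LX _ _) (LS _)).
have YG k j : ip P (Y k) (G j) = 0%R.
  rewrite (ip_subl gL (LX _ _) (LS _) (LG _)) (ip_suml gL) => [|l|//]; last exact: (gsZ gL).
  rewrite (bigD1 j)//= big1 => [|l lj]; last first.
    by rewrite (ip_scalel gL _ (LG _) (LG _)) GG (negbTE lj) mulr0.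
  by rewrite (ip_scalel gL _ (LG _) (LG _)) GG eqxx addr0 /projG divfK ?subrr// gt_eqF.
pose h (k : seq bool * 'I_dd) : seq (R * (seq bool * 'I_dd + 'I_dd)) :=
  (1%R, inl k) :: [seq (projG k.1 k.2 j, inr j) | j <- index_enum 'I_dd].
have hE k (f : (seq bool * 'I_dd + 'I_dd) -> R) :
    lform (h k) f = (f (inl k) + \sum_j projG k.1 k.2 j * f (inr j))%R.
  by rewrite /lform big_cons mul1r big_map.
have := orthogonal_joint_law gL charD LY LG YG (tset_subst h tE).
move=> law; transitivity (P [set w | E (fun k => lform (h k)
    (fun k => match k with inl i => Y i w | inr j => G j w end))]).
  congr (P _); apply/funext => w /=; congr E; apply/funext => k.
  by rewrite hE /Y subrK.
rewrite law; congr ((P \x P) _); apply/funext => p /=; congr E; apply/funext => k.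
rewrite hE /Y /resampled -addrA; congr (_ + _)%R; rewrite addrC -sumrB.
by apply: eq_bigr => j _; rewrite mulrBr.
Qed.

Hypothesis projG_near : forall s i, (\sum_j `|projG s i j - (i == j)%:R| <= 2^-1)%R.
Variable z : 'I_dd -> R.
Variables (theta : R).
Hypotheses (theta0 : (0 < theta)%R) (dd0 : (0 < dd)%N)
  (thetad : (theta ^+ dd = 2^-1)%R).
Variable A : R.
Hypothesis A0 : (0 <= A)%R.
Hypothesis XA : forall s i,
  (mom2 P (fun w => X (rcons s true) i w - X s i w)%R <= A * theta ^+ (2 * size s))%R.
(** On a cell of depth [n] the coefficients move by [o(theta ^ n)], negligible against the
    oscillation allowed to a flat cell. *)
Hypothesis projG_osc : forall e : R, (0 < e)%R -> exists N : nat, forall s t i j,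
  (N <= size s)%N -> (`|projG (s ++ t) i j - projG s i j| <= e * theta ^+ size s)%R.
Hypothesis bad_small : forall (eta eps : R) (N0 : nat), (0 < eta)%R -> (0 < eps)%R ->
  exists lev N, [/\ (N0 <= N)%N, forall l, l \in lev -> (N0 <= l <= N)%N &
    forall c, size c = N -> P (bad theta X lev eta c) <= eps%:E].

Let n := (4 * dd)%N.
Let n_gt0 : (0 < n)%N. Proof. by rewrite muln_gt0. Qed.
Let theta_n : (theta ^+ n = 16^-1)%R.
Proof. by rewrite /n mulnC exprM thetad; field. Qed.
Let theta1 : (theta < 1)%R.
Proof.
rewrite ltNge; apply/negP => h; have : (1 <= theta ^+ dd)%R by exact: exprn_ege1.
by rewrite thetad; lra.
Qed.

Section Radius.
(** Bound on [G] in both copies, under which the variation of [projG] displaces the field by a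
    controlled amount. A countable union removes it in [core_null]. *)
Variable M : R.
Hypothesis M0 : (0 <= M)%R.

Let boxG := [set w | forall j, (`|G j w| <= M)%R].

Definition hitG w s := [set w' | boxG w' /\ hit z s (fun k => resampled k (w, w'))].

Lemma measurable_boxG : measurable boxG.
Proof.
rewrite (_ : boxG = \bigcap_(j in setT) (fun w => `|G j w|)%R @^-1` `]-oo, M]%classic).
  apply: fin_bigcap_measurable => // j _; rewrite -[_ @^-1` _]setTI.
  by apply: measurableT_comp => //; exact: (gsM gL (LG _)).
apply/seteqP; split => w h j; last by have := h j Logic.I; rewrite /= in_itv.
by move=> _; rewrite /= in_itv/=.
Qed.

Lemma measurable_hitG w s : measurable (hitG w s).
Proof.
apply: measurableI; first exact: measurable_boxG.
apply: (@tset_measurable _ _ _ _ (fun k w' => resampled k (w, w'))); last exact: tset_hit.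
by move=> k; apply: (measurableT_comp (measurable_resampled k)); exact: measurable_fun_pair.
Qed.

(** [orthogonal_box_le] is used with radius [4 * rho], that is, intervals of length [8 * rho]. *)
Let pk : R := (8 * normal_peak (Num.sqrt (sg / N01_var R)))%R.

(** With [w] fixed, a hit forces [projG s] applied to [G w'] to lie within [rho] of a vector that
    depends on [w] only. As [projG s] is close to the identity, all such [G w'] lie in one box of
    radius [4 * rho], and [G] has a bounded density. *)
Lemma hitG_le w s (r b : R) : boxG w -> osc X s r w -> (0 <= r)%R -> (0 <= b)%R ->
  (forall t i j, (`|projG (s ++ t) i j - projG s i j| <= b)%R) ->
  P (hitG w s) <= ((pk * (r + dd%:R * b * (2 * M))) ^+ dd)%:E.
Proof.
move=> wM wr r0 b0 alb; set rho := (r + _)%R.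
have rho0 : (0 <= rho)%R by rewrite addr_ge0// !mulr_ge0.
pose c i : R := (z i - X s i w + \sum_j projG s i j * G j w)%R.
have near w' : hitG w s w' -> forall i, (`|\sum_j projG s i j * G j w' - c i| <= rho)%R.
  move=> [w'M hw'] i; apply/ler_addgt0Pr => e e0.
  have [t ht] := hw' (Num.truncn e^-1); have := ht i; rewrite /resampled /=.
  set S := (\sum_j _)%R => hS.
  have hX := wr t i.
  have hal : (`|\sum_j (projG (s ++ t) i j - projG s i j) * (G j w' - G j w)| <=
      dd%:R * b * (2 * M))%R.
    apply: (le_trans (ler_norm_sum _ _ _)).
    rewrite (_ : dd%:R * b * (2 * M) = \sum_(j < dd) b * (2 * M))%R; last first.
      by rewrite sumr_const card_ord -[RHS]mulr_natl -mulrA.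
    apply: ler_sum => j _; rewrite normrM ler_pM//.
    apply: (le_trans (ler_normB _ _)); have := wM j; have := w'M j; lra.
  have -> : (\sum_j projG s i j * G j w' - c i = (X (s ++ t) i w + S - z i)
      - (X (s ++ t) i w - X s i w) -
      \sum_j (projG (s ++ t) i j - projG s i j) * (G j w' - G j w))%R.
    rewrite /c.
    have -> : (S = \sum_j (projG (s ++ t) i j - projG s i j) * (G j w' - G j w) +
        (\sum_j projG s i j * G j w' - \sum_j projG s i j * G j w))%R.
      by rewrite -sumrB -big_split; apply: eq_bigr => j _ /=; ring.
    ring.
  rewrite [leRHS]addrC addrA; apply: (le_trans (ler_normB _ _)); apply: lerD => //.
  apply: (le_trans (ler_normB _ _)); apply: lerD => //.
  exact: le_trans hS (truncnS_inv_le e0).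
(* A nonempty hitting set is compared with one of its own points [w0], which serves as the centre of
   the box without inverting [projG s]. *)
have [->|/set0P[w0 hw0]] := eqVneq (hitG w s) set0.
  by rewrite measure0 lee_fin exprn_ge0// mulr_ge0// mulr_ge0// normal_peak_ge0.
have sub : hitG w s `<=` [set w' | forall j, (`|G j w' - G j w0| <= 4 * rho)%R].
  move=> w' hw'.
  have := @near_identity_le _ _ (projG s) (fun j => G j w' - G j w0)%R (2 * rho)%R.
  rewrite mulr_ge0// => /(_ isT (projG_near s)) h j.
  rewrite (_ : 4 * rho = 2 * (2 * rho))%R; last by ring.
  apply: h => i.
  rewrite (_ : \sum_j _ = (\sum_j projG s i j * G j w' - c i) -
      (\sum_j projG s i j * G j w0 - c i))%R.
    apply: (le_trans (ler_normB _ _)); have := near _ hw' i; have := near _ hw0 i; lra.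
  rewrite opprB addrA subrK -sumrB; apply: eq_bigr => l _; ring.
have mbox : measurable [set w' | forall j, (`|G j w' - G j w0| <= 4 * rho)%R].
  rewrite (_ : mkset _ = \bigcap_(j in setT)
      (fun w' => `|G j w' - G j w0|)%R @^-1` `]-oo, (4 * rho)%R]%classic).
    apply: fin_bigcap_measurable => // j _; rewrite -[_ @^-1` _]setTI.
    apply: measurableT_comp => //; apply: measurable_funB => //; exact: (gsM gL (LG _)).
  apply/seteqP; split => w' h j; last by have := h j Logic.I; rewrite /= in_itv.
  by move=> _; rewrite /= in_itv/=; exact: h.
apply: (le_trans (le_measure P (mem_set (measurable_hitG w s)) (mem_set mbox) sub)).
have G0 i j : i != j -> ip P (G i) (G j) = 0%R by move=> /negbTE ij; rewrite GG ij.
have G1 i : mom2 P (G i) = sg by rewrite mom2E GG eqxx.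
have r4 : (0 <= 4 * rho)%R by rewrite mulr_ge0.
apply: (le_trans (orthogonal_box_le gL charD (G ^~ w0) LG G0 G1 sg0 r4)).
by rewrite lee_fin card_ord /pk -mulr_natl le_eqVlt; apply/orP; left;
  apply/eqP; congr (_ ^+ _)%R; ring.
Qed.

Let Z2 := [set p : T * T | [/\ boxG p.1, boxG p.2 & hit z [::] (resampled ^~ p)]].

Lemma measurable_Z2 : measurable Z2.
Proof.
have mB := measurable_boxG.
have m1 : measurable ((fst : T * T -> T) @^-1` boxG).
  by rewrite -[_ @^-1` _]setTI; exact: measurable_fst.
have m2 : measurable ((snd : T * T -> T) @^-1` boxG).
  by rewrite -[_ @^-1` _]setTI; exact: measurable_snd.
have m3 : measurable [set p | hit z [::] (resampled ^~ p)].
  by apply: tset_measurable; [exact: measurable_resampled|exact: tset_hit].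
rewrite (_ : Z2 = (fst @^-1` boxG) `&`
    ((snd @^-1` boxG) `&` [set p | hit z [::] (resampled ^~ p)])).
  by apply: measurableI => //; exact: measurableI.
by apply/seteqP; split => [p [? ? ?]|p [? []]].
Qed.

Let pk_gt0 : (0 < pk)%R.
Proof.
rewrite mulr_gt0// normal_peak_gt0// gt_eqF// sqrtr_gt0 divr_gt0//.
exact: N01_var_gt0.
Qed.

(** For a cell of unknown oscillation [r]: either [r] is at most the cutoff [La * theta ^ N], or
    [r ^ dd] is at most [r ^ (8 dd)] divided by the power [7 dd] of the cutoff, and [r] is chosen
    with [r ^ (8 dd) = y]. *)
Lemma hitG_chaining w s (La eta b : R) (y : \bar R) : (0 < La)%R -> (0 < eta)%R ->
  (0 <= b)%R -> 0 <= y ->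
  boxG w -> (forall t i, (`|X (s ++ t) i w - X s i w| ^+ n.*2)%:E <= y) ->
  (forall t i j, (`|projG (s ++ t) i j - projG s i j| <= b)%R) ->
  (dd%:R * b * (2 * M) <= eta * theta ^+ size s)%R ->
  P (hitG w s) <= ((2 * pk) ^+ dd * (La ^+ dd + eta ^+ dd) / 2 ^+ size s)%:E +
    ((2 * pk) ^+ dd / (La * theta ^+ size s) ^+ (7 * dd))%:E * y.
Proof.
move=> La0 eta0 b0 y0 wM Xy alb bM; set N := size s.
have tN : (0 < theta ^+ N)%R by exact: exprn_gt0.
have e0 : (0 < (2 * pk) ^+ dd / (La * theta ^+ N) ^+ (7 * dd))%R.
  by rewrite divr_gt0// exprn_gt0// mulr_gt0.
case: y y0 Xy => [y||]// y0 Xy; last first.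
  by rewrite gt0_muley ?lte_fin// addey ?leey.
have {}Xy t i : (`|X (s ++ t) i w - X s i w| ^+ n.*2 <= y)%R by have := Xy t i; rewrite lee_fin.
rewrite lee_fin in y0.
have n20 : (0 < n.*2)%N by rewrite double_gt0.
pose r := (y `^ (n.*2%:R^-1))%R.
have r0 : (0 <= r)%R by exact: powR_ge0.
have rn : (r ^+ n.*2 = y)%R.
  by rewrite -powR_mulrn// -powRrM mulVf ?pnatr_eq0 -?lt0n// powRr1.
have osc_r : osc X s r w.
  by move=> t i; rewrite -(@ler_pXn2r _ n.*2)// ?nnegrE// rn.
have twopow : (theta ^+ N ^+ dd = 2^-1 ^+ N)%R by rewrite exprAC thetad.
have rdd : (r ^+ dd <= (La * theta ^+ N) ^+ dd + y / (La * theta ^+ N) ^+ (7 * dd))%R.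
  have L0 : (0 < La * theta ^+ N)%R by rewrite mulr_gt0.
  have [h|h] := leP r (La * theta ^+ N)%R.
    apply: ler_wpDr; first by rewrite divr_ge0// exprn_ge0// ltW.
    by rewrite lerXn2r ?nnegrE// ltW.
  apply: ler_wpDl; first by rewrite exprn_ge0// ltW.
  rewrite ler_pdivlMr ?exprn_gt0// -rn.
  apply: (@le_trans _ _ (r ^+ dd * r ^+ (7 * dd))%R).
    by rewrite ler_wpM2l ?exprn_ge0// lerXn2r ?nnegrE// ltW.
  by rewrite -exprD -mulSn /n -mul2n mulnA.
apply: (le_trans (hitG_le wM osc_r r0 b0 alb)); rewrite -EFinM -EFinD lee_fin.
have eN0 : (0 <= eta * theta ^+ N)%R by rewrite mulr_ge0// ltW.
apply: (@le_trans _ _ (pk ^+ dd * (2 ^+ dd * (r ^+ dd + (eta * theta ^+ N) ^+ dd)))%R).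
  rewrite exprMn ler_wpM2l ?exprn_ge0 ?(ltW pk_gt0)//.
  apply: (le_trans _ (expr_addn_le _ r0 eN0)).
  rewrite lerXn2r ?lerD2l// ?nnegrE addr_ge0//.
  by rewrite !mulr_ge0.
rewrite mulrA -exprMn (mulrC pk) [leRHS](_ : _ = (2 * pk) ^+ dd *
  ((La ^+ dd + eta ^+ dd) / 2 ^+ N + y / (La * theta ^+ N) ^+ (7 * dd)))%R; last first.
  by rewrite [RHS]mulrDr !mulrA; congr (_ + _)%R; rewrite mulrAC.
have q0 : (0 <= (2 * pk) ^+ dd)%R by rewrite exprn_ge0// mulr_ge0// ltW.
rewrite ler_wpM2l//.
rewrite mulrDl -exprVn -twopow -!exprMn addrAC lerD2r.
exact: rdd.
Qed.

(** Flat cells contribute a term of order [eta ^ dd]. Deepest cells without flat ancestor are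
    charged [eta ^ - dd] with probability [eta ^ (2 dd)], and the tail beyond the cutoff
    [La = eta^-1] adds a term of order [eta ^ (7 dd)]. The powers of [2 ^ N] cancel in each term, so
    the total is of order [eta]. *)
Lemma resampled_hit_null : (P \x P) Z2 = 0.
Proof.
have [C C0 HC] := gaussian_chaining 'I_dd gL n_gt0 (ltW theta0) theta_n.
apply: (@null_of_le _ ((2 * pk) ^+ dd * (3 + C * A ^+ n))%R) => // [|eta /andP[eta0 eta1]].
  apply: mulr_ge0; first by rewrite exprn_ge0// mulr_ge0// ltW.
  by rewrite addr_ge0// mulr_ge0// exprn_ge0.
(* With [|G| <= M] in both copies, a variation [b0 * theta ^ l] of the coefficients moves the field
   by at most [eta * theta ^ l]. *)
pose b0 : R := (eta / (dd%:R * (2 * M) + 1))%R.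
have den : (0 < dd%:R * (2 * M) + 1)%R by rewrite ltr_wpDl// !mulr_ge0.
have b00 : (0 < b0)%R by rewrite divr_gt0.
have b0M : (dd%:R * b0 * (2 * M) <= eta)%R.
  rewrite (_ : _ * b0 * _ = eta * (dd%:R * (2 * M) / (dd%:R * (2 * M) + 1)))%R; last first.
    by rewrite /b0; ring.
  by rewrite ger_pMr// ler_pdivrMr// mul1r lerDl.
have [N0 HN0] := projG_osc b00.
have [||lev [N [N0N levN badP]]] := @bad_small eta (eta ^+ (2 * dd))%R N0 => //.
  by rewrite exprn_gt0.
have tN k : (0 < theta ^+ k)%R by exact: exprn_gt0.
have /choice[Z HZ] c : exists Z : T -> \bar R,
  [/\ measurable_fun setT Z, forall w, 0 <= Z w,
    \int[P]_w Z w <= (C * (A * theta ^+ (2 * size c)) ^+ n)%:E &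
    forall w t i, (`|X (c ++ t) i w - X c i w| ^+ n.*2)%:E <= Z w].
  apply: HC => // [|t i]; first by rewrite mulr_ge0// ltW.
  apply: (le_trans (XA _ _)); rewrite size_cat -mulrA -exprD ler_wpM2l//.
  by apply: ler_wiXn2l; rewrite ?ltW// mulnDr leq_add2l mul2n -addnn leq_addr.
have mZ c := let: And4 h _ _ _ := HZ c in h.
have Z0 c := let: And4 _ h _ _ := HZ c in h.
have IZ c := let: And4 _ _ h _ := HZ c in h.
have XZ c := let: And4 _ _ _ h := HZ c in h.
pose a : R := ((2 * pk) ^+ dd * eta ^+ dd)%R.
pose b : R := ((2 * pk) ^+ dd * (eta^-1 ^+ dd + eta ^+ dd) / 2 ^+ N)%R.
pose e : R := ((2 * pk) ^+ dd / (eta^-1 * theta ^+ N) ^+ (7 * dd))%R.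
have pk0 : (0 <= (2 * pk) ^+ dd)%R by rewrite exprn_ge0// mulr_ge0// ltW.
have a0 : (0 <= a)%R by rewrite mulr_ge0// exprn_ge0// ltW.
have b0' : (0 <= b)%R.
  by rewrite !mulr_ge0// ?invr_ge0 ?exprn_ge0// addr_ge0// exprn_ge0// ?invr_ge0 ltW.
have e0 : (0 <= e)%R.
  by rewrite mulr_ge0// invr_ge0 exprn_ge0// mulr_ge0// ?invr_ge0 ltW.
have bE l (w : T) : boxG w -> (N0 <= l)%N -> forall s, size s = l -> forall r, (0 <= r)%R ->
    osc X s r w -> P (hitG w s) <= ((pk * (r + eta * theta ^+ l)) ^+ dd)%:E.
  move=> wM N0l s sl r r0 wr.
  have bl : (0 <= b0 * theta ^+ l)%R by rewrite mulr_ge0// ltW.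
  have al_b t i j : (`|projG (s ++ t) i j - projG s i j| <= b0 * theta ^+ l)%R.
    by rewrite -sl; apply: HN0; rewrite sl.
  apply: (le_trans (hitG_le wM wr r0 bl al_b)); rewrite lee_fin.
  have h0 := addr_ge0 r0 (mulr_ge0 (mulr_ge0 (ler0n R dd) bl) (mulr_ge0 (ler0n R 2) M0)).
  have h1 : (dd%:R * (b0 * theta ^+ l) * (2 * M) <= eta * theta ^+ l)%R.
    by rewrite [(dd%:R * (b0 * _))%R]mulrA mulrAC (ler_wpM2r (ltW (tN l))).
  have p0 := ltW pk_gt0.
  have h2 : (0 <= r + eta * theta ^+ l)%R by rewrite addr_ge0// mulr_ge0// ltW.
  apply: lerXn2r; rewrite ?nnegrE; [exact: (mulr_ge0 p0 h0)|exact: (mulr_ge0 p0 h2)|].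
  by rewrite (ler_wpM2l p0)// lerD2l.
have bound w : boxG w -> P (hitG w [::]) <= a%:E +
    \sum_(u <- words N) ((b * \1_(bad theta X lev eta u) w)%:E + e%:E * Z u w).
  move=> wM.
  have := @tree_bound R (fun s => P (hitG w s)) N lev
    (fun s => osc X s (eta * theta ^+ size s)%R w) a b (fun c => e%:E * Z c w) a0 b0'.
  have ez c : 0 <= e%:E * Z c w by rewrite mule_ge0.
  move=> /(_ ez) tb.
  have s1 s : P (hitG w s) <= P (hitG w (rcons s false)) + P (hitG w (rcons s true)).
    have mH x := measurable_hitG w (rcons s x).
    apply: (@le_trans _ _ (P (hitG w (rcons s false) `|` hitG w (rcons s true)))).
      apply: (le_measure P (mem_set (measurable_hitG _ _))
        (mem_set (measurableU _ _ (mH _) (mH _)))).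
      move=> w' [w'M hw']; have [|h|h] := hit_split _ hw'; [|by left|by right].
      by move=> t i; exact: resampled_rcons.
    exact: measureU2.
  have s2 s : size s \in lev -> osc X s (eta * theta ^+ size s)%R w ->
      P (hitG w s) <= (a / 2 ^+ size s)%:E.
    move=> sl wr; have /andP[N0s _] := levN _ sl.
    apply: (le_trans (bE _ w wM N0s s erefl _ _ wr)).
      by rewrite mulr_ge0// ltW.
    rewrite lee_fin /a -exprMn -exprVn.
    have -> : (2^-1 ^+ size s = theta ^+ size s ^+ dd)%R by rewrite exprAC thetad.
    by rewrite -exprMn le_eqVlt; apply/orP; left;
  apply/eqP; congr (_ ^+ _)%R; ring.
  have s3 c : size c = N -> P (hitG w c) <= b%:E + e%:E * Z c w.
    move=> sc.
    have bl : (0 <= b0 * theta ^+ N)%R by rewrite mulr_ge0// ltW.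
    have al_b t i j : (`|projG (c ++ t) i j - projG c i j| <= b0 * theta ^+ N)%R.
      by rewrite -sc; apply: HN0; rewrite sc.
    rewrite /b /e -sc; apply: (hitG_chaining _ eta0 bl (Z0 c w) wM (XZ c w) al_b).
      by rewrite invr_gt0.
    by rewrite sc [(dd%:R * (b0 * _))%R]mulrA mulrAC (ler_wpM2r (ltW (tN N))).
  apply: (le_trans (tb s1 s2 s3 N [::] erefl)); rewrite expr0 divr1 leeD2l//.
  rewrite big_seq [leRHS]big_seq; apply: lee_sum => u; rewrite mem_words => /eqP su.
  rewrite leeD2r// lee_fin ler_wpM2l// indicE ler_nat.
  case: asboolP => // h; rewrite mem_set// => l ll /= ol.
  have /andP[_ lN] := levN _ ll.
  by apply: (h l ll lN); rewrite /= size_takel// su.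
pose g w := a%:E + \sum_(u <- words N) ((b * \1_(bad theta X lev eta u) w)%:E + e%:E * Z u w).
have mbad u : measurable (bad theta X lev eta u) by exact: (measurable_bad gL).
have m1 u : measurable_fun setT (fun w => (b * \1_(bad theta X lev eta u) w)%:E).
  by apply/measurable_EFinP; apply: measurable_funM.
have m2 u : measurable_fun setT (fun w => e%:E * Z u w).
  by apply: emeasurable_funM => //; exact: measurable_cst.
have p1 u w : 0 <= (b * \1_(bad theta X lev eta u) w)%:E by rewrite lee_fin mulr_ge0.
have p2 u w : 0 <= e%:E * Z u w by rewrite mule_ge0.
have mu : measurable_fun setT (fun w =>
    \sum_(u <- words N) ((b * \1_(bad theta X lev eta u) w)%:E + e%:E * Z u w)).
  by apply: emeasurable_sum => u; exact: emeasurable_funD.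
(* The product measure integrates over [w] the sections of [Z2], which are [hitG w [::]] when
   [boxG w] holds and empty otherwise. *)
apply: (@le_trans _ _ (\int[P]_w g w)).
  rewrite /product_measure1; apply: ge0_le_integral => //.
  - by apply: measurable_fun_xsection; exact: measurable_Z2.
  - by apply: emeasurable_funD => //; exact: measurable_cst.
  move=> w _ /=.
  have [wM|wM] := pselect (boxG w).
    apply: le_trans (bound w wM); rewrite le_eqVlt; apply/orP; left; apply/eqP.
    congr (P _); apply/seteqP; split => w'; rewrite /xsection/= inE.
      by move=> [].
    by move=> [].
  rewrite (_ : xsection _ _ = set0) ?measure0; last first.
    by apply/seteqP; split => w' //; rewrite /xsection/= inE => -[].
  by rewrite adde_ge0 ?lee_fin// sume_ge0// => u _; rewrite adde_ge0.
rewrite /g ge0_integralD//; last 1 first.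
- by move=> w _; apply: sume_ge0 => u _; rewrite adde_ge0.
rewrite integral_cst_prob ge0_integral_sum//; last 2 first.
- by move=> u; exact: emeasurable_funD.
- by move=> u w _; rewrite adde_ge0.
have Iu u : u \in words N -> \int[P]_w ((b * \1_(bad theta X lev eta u) w)%:E + e%:E * Z u w) <=
    (b * eta ^+ (2 * dd) + e * (C * (A * theta ^+ (2 * N)) ^+ n))%:E.
  rewrite mem_words => /eqP su.
  rewrite ge0_integralD// EFinD; apply: leeD.
    under eq_integral do rewrite EFinM.
    rewrite ge0_integralZl//; last exact/measurable_EFinP.
    rewrite integral_indic// setIT; have bE0 : 0 <= b%:E by rewrite lee_fin.
    exact: (lee_wpmul2l bE0 (badP u su)).
  have eE0 : 0 <= e%:E by rewrite lee_fin.
  by rewrite ge0_integralZl//; have := lee_wpmul2l eE0 (IZ u); rewrite su.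
apply: (@le_trans _ _ (a%:E + \sum_(u <- words N)
   (b * eta ^+ (2 * dd) + e * (C * (A * theta ^+ (2 * N)) ^+ n))%:E)).
  by rewrite leeD2l// big_seq [leRHS]big_seq; apply: lee_sum.
rewrite sumEFin big_const_seq count_predT size_words iter_addr_0 -EFinD lee_fin.
rewrite -[(_ *+ (2 ^ N))%R]mulr_natl natrX.
have tq : (theta ^+ N ^+ dd = (2 ^+ N)^-1)%R by rewrite exprAC thetad exprVn.
have -> : (e = (2 * pk) ^+ dd / ((eta ^+ dd)^-1 * (2 ^+ N)^-1) ^+ 7)%R.
  by rewrite /e [(7 * dd)%N]mulnC exprM [((_ * theta ^+ N) ^+ dd)%R]exprMn tq exprVn.
have -> : ((A * theta ^+ (2 * N)) ^+ n = A ^+ n * (2 ^+ N)^-1 ^+ 8)%R.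
  rewrite exprMn -tq -!exprM; congr (_ * _ ^+ _)%R; rewrite /n; ring.
have -> : (eta ^+ (2 * dd) = eta ^+ dd ^+ 2)%R by rewrite -exprM mulnC.
rewrite /a /b exprVn.
have h0 : (0 < eta ^+ dd)%R by exact: exprn_gt0.
have h1 : (eta ^+ dd <= eta)%R by rewrite ler_iXnr// ltW.
have t2 : (2 ^+ N != 0 :> R)%R by rewrite expf_neq0.
move: (eta ^+ dd)%R h0 h1 => h h0 h1; move: (2 ^+ N)%R t2 => t t2.
rewrite [leLHS](_ : _ = (2 * pk) ^+ dd * (2 * h + h ^+ 3 + C * A ^+ n * h ^+ 7))%R; last first.
  by field; rewrite t2 gt_eqF.
have hh k : (h ^+ k.+1 <= eta)%R.
  by apply: (le_trans _ h1); rewrite ler_iXnr ?(ltW h0)// (le_trans h1).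
rewrite -[leRHS]mulrA ler_wpM2l// [leRHS]mulrDl; apply: lerD; last first.
  by rewrite ler_wpM2l// mulr_ge0// exprn_ge0.
have := hh 2%N; lra.
Qed.

End Radius.

Theorem core_null : P [set w | hit z [::] (fun k => X k.1 k.2 w)] = 0.
Proof.
rewrite (resampled_law (tset_hit z [::])).
pose B m := [set p : T * T | [/\ forall j, (`|G j p.1| <= m%:R)%R,
  forall j, (`|G j p.2| <= m%:R)%R & hit z [::] (resampled ^~ p)]].
have mB m : measurable (B m) by exact: measurable_Z2.
rewrite (_ : mkset _ = \bigcup_m B m).
  apply: measure_negligible; first exact: bigcup_measurable.
  apply: negligible_bigcup => m; apply/negligibleP => //.
  exact: resampled_hit_null.
apply/seteqP; split => [p hp|p [m _ []]//].
pose S := (\sum_j (`|G j p.1| + `|G j p.2|))%R.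
have jS j : (`|G j p.1| + `|G j p.2| <= S)%R.
  by rewrite /S (bigD1 j)//= lerDl sumr_ge0// => *; rewrite addr_ge0.
have SM : (S <= (Num.truncn S).+1%:R)%R by apply: ltW; exact: truncnS_gt.
by exists (Num.truncn S).+1 => //; split => // j; apply: le_trans SM;
  apply: le_trans (jS j); rewrite ?lerDl ?lerDr.
Qed.

End Core.

(** * An anisotropic dyadic tree *)

Lemma expr_small (R : realType) (q e : R) : 0 <= q < 1 -> 0 < e ->
  exists N, forall n, (N <= n)%N -> q ^+ n <= e.
Proof.
move=> /andP[q0 q1] e0.
have : `|q| < 1 by rewrite ger0_norm.
move=> /cvg_expr/cvgrPdist_le/(_ e e0)[N _ h]; exists N => n Nn.
by have := h n Nn; rewrite sub0r normrN ger0_norm// exprn_ge0.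
Qed.

Lemma expr_powR_small (R : realType) (k : nat) (gamma : 'I_k -> R) (q e : R) :
  0 < q < 1 -> (forall j, 0 < gamma j) -> 0 < e ->
  exists N, forall n, (N <= n)%N -> forall j, (q ^+ n) `^ gamma j <= e.
Proof.
move=> /andP[q0 q1] gamma0 e0.
have /choice[N HN] j : exists N, forall n, (N <= n)%N -> (q `^ gamma j) ^+ n <= e.
  apply: expr_small => //; rewrite powR_ge0/= [ltRHS](_ : _ = 1 `^ gamma j); last by rewrite powR1.
  by apply: gt0_ltr_powR; rewrite ?nnegrE ?ltW.
exists (\max_j N j) => n nN j.
rewrite -powR_mulrn ?(ltW q0)// powRAC powR_mulrn ?powR_ge0//.
by apply: HN; apply: leq_trans nN; exact: leq_bigmax.
Qed.

Section Tree.
Context {R : realType} {k : nat}.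
Variables (w : 'I_k -> R) (j0 : 'I_k).
Hypothesis w1 : \sum_j w j = 1.
Hypothesis w0 : forall j, 0 <= w j.

(* Halving the coordinate that lags most behind n * w j keeps the number
   halvings n j of halvings of j within k of n * w j. *)
Definition laggard n (e : 'I_k -> nat) : 'I_k :=
  [arg min_(j < j0) ((e j)%:R - n%:R * w j)]%O.

Fixpoint halvings n : 'I_k -> nat := if n is m.+1 then
  fun j => (halvings m j + (j == laggard m (halvings m)))%N else fun=> 0%N.

Let J n := laggard n (halvings n).

Lemma halvings_sum n : \sum_j (halvings n j)%:R = n%:R :> R.
Proof.
elim: n => [|n ih]; first by rewrite big1.
under eq_bigr do rewrite /= natrD.
rewrite big_split/= ih (bigD1 (J n))//= eqxx big1 ?addr0 ?natr1// => j.
by move=> /negbTE ->.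
Qed.

(** The deviations [halvings n j - n * w j] sum to 0, so the smallest is nonpositive. *)
Lemma halvings_lag n : (halvings n (J n))%:R <= n%:R * w (J n).
Proof.
rewrite -subr_le0 leNgt; apply/negP => h.
have : 0 < \sum_j ((halvings n j)%:R - n%:R * w j).
  apply: (@lt_le_trans _ _ ((halvings n (J n))%:R - n%:R * w (J n))) => //.
  rewrite (bigD1 (J n))//= lerDl; apply: sumr_ge0 => j _; apply: ltW.
  apply: (lt_le_trans h); rewrite /J /laggard.
  by case: arg_minP => // i _ /(_ j isT).
by rewrite sumrB halvings_sum -mulr_sumr w1 mulr1 subrr ltxx.
Qed.

(** Only a coordinate with nonpositive deviation is ever halved. *)
Lemma halvings_le n j : (halvings n j)%:R <= n%:R * w j + 1.
Proof.
elim: n => [|n ih]; first by rewrite mul0r add0r.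
rewrite /= natrD -natr1 mulrDl mul1r.
case: eqVneq => [->|_]; rewrite ?mulr1n ?mulr0n; last by have := w0 j; lra.
by have := halvings_lag n; have := w0 (J n); rewrite /J; lra.
Qed.

(** The deviations sum to 0 and each of the others is at most 1. *)
Lemma halvings_ge n j : n%:R * w j <= (halvings n j)%:R + k%:R.
Proof.
have h0 : \sum_i ((halvings n i)%:R - n%:R * w i) = 0.
  by rewrite sumrB halvings_sum -mulr_sumr w1 mulr1 subrr.
rewrite (bigD1 j)//= in h0.
have : \sum_(i | i != j) ((halvings n i)%:R - n%:R * w i) <= k%:R.
  apply: (@le_trans _ _ (\sum_(i < k) 1)); last by rewrite sumr_const card_ord.
  rewrite [leRHS](bigD1 j)//= ler_wpDl//; apply: ler_sum => i _.
  by have := halvings_le n i; lra.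
by move: h0; lra.
Qed.

Variable r : R.
Hypothesis r0 : 0 < r.

Definition side n j : R := r / 2 ^+ halvings n j.

(** Letters are read from depth [n] on; [true] passes to the upper half in the coordinate halved at
    that depth. *)
Fixpoint offset n (t : seq bool) j : R := if t is b :: t' then
  (if b && (j == J n) then side n j / 2 else 0) + offset n.+1 t' j else 0.

Lemma side_ge0 n j : 0 <= side n j.
Proof. by rewrite divr_ge0 ?exprn_ge0// ltW. Qed.

Lemma sideS n j : side n.+1 j = if j == J n then side n j / 2 else side n j.
Proof.
rewrite /side /= -/(J n); case: eqVneq => _ /=; last by rewrite addn0.
by rewrite addn1 exprS invfM mulrCA mulrC.
Qed.

Lemma offset_bound n t j : 0 <= offset n t j <= side n j.
Proof.
elim: t n => [|b t ih] n /=; first by rewrite lexx side_ge0.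
have := ih n.+1; rewrite sideS; have := side_ge0 n j.
by case: b; case: eqVneq => _ /=; lra.
Qed.

Lemma offset_cat n s t j : offset n (s ++ t) j = offset n s j + offset (n + size s) t j.
Proof.
elim: s n => [|b s ih] n /=; first by rewrite addn0 add0r.
by rewrite ih addrA addnS addSn.
Qed.

(** Binary expansion: each letter selects a half that contains the target. *)
Lemma offset_dense n m (y : 'I_k -> R) : (forall j, 0 <= y j <= side n j) ->
  exists t, size t = m /\ forall j, 0 <= y j - offset n t j <= side (n + m) j.
Proof.
elim: m n y => [|m ih] n y yn.
  by exists [::]; split => // j; rewrite subr0 addn0.
pose b := side n (J n) / 2 <= y (J n).
pose c j := if b && (j == J n) then side n j / 2 else 0.
have [|t [st ht]] := ih n.+1 (fun j => y j - c j).
  move=> j; rewrite /c sideS; have := yn j.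
  case: eqVneq => [->|_]; rewrite ?andbT ?andbF ?subr0//.
  by move=> h; case: ifPn; rewrite /b -?ltNge; lra.
exists (b :: t); split => [|j]; first by rewrite /= st.
by rewrite /= opprD addrA addnS -addSn; exact: ht.
Qed.

End Tree.

Lemma anisotropic_tree (R : realType) (k d : nat) (gamma : 'I_k -> R) (theta : R)
    (x0 : 'rV[R]_k) (r : R) :
  (forall j, 0 < gamma j) -> \sum_j (gamma j + 1) = d%:R -> (0 < d)%N ->
  0 < theta -> theta ^+ d = 2^-1 -> 0 < r ->
  exists (corner : seq bool -> 'rV[R]_k) (C rho : R),
  [/\ forall s, corner (rcons s false) = corner s,
      0 <= C /\ (forall s t j, `|corner (s ++ t) 0 j - corner s 0 j| <=
        C * (theta ^+ size s) `^ (gamma j + 1)),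
      forall s j, `|corner s 0 j - x0 0 j| <= r &
      0 < rho /\ forall x : 'rV[R]_k, (forall j, `|x 0 j - x0 0 j| <= rho) ->
        forall e, 0 < e -> exists t, forall j, `|corner t 0 j - x 0 j| <= e].
Proof.
move=> gamma0 Qd d0 theta0 thetad r0.
have dR : 0 < d%:R :> R by rewrite ltr0n.
have j0 : 'I_k.
  case: k gamma gamma0 Qd {x0} => [|k'] ? ? => [|_]; last exact: ord0.
  by rewrite big_ord0 => /esym/eqP; rewrite pnatr_eq0 -leqn0 leqNgt d0.
(* With these weights [2 ^ - (n * w j) = (theta ^ n) ^ (gamma j + 1)]; they sum to 1 because Q =
   d. *)
pose w j := (gamma j + 1) / d%:R.
have w0 j : 0 <= w j by rewrite divr_ge0// addr_ge0// ltW.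
have w1 : \sum_j w j = 1 by rewrite -mulr_suml Qd divff// gt_eqF.
have theta1 : theta < 1.
  rewrite ltNge; apply/negP => h; have : 1 <= theta ^+ d by exact: exprn_ege1.
  by rewrite thetad; lra.
pose off := offset w j0 r; pose sd := side w j0 r.
have sdC n j : sd n j <= r * 2 ^+ k * (theta ^+ n) `^ (gamma j + 1).
  have -> : (theta ^+ n) `^ (gamma j + 1) = (2^-1) `^ (n%:R * w j).
    have t0 := ltW theta0; rewrite -thetad -(powR_mulrn n t0) -(powR_mulrn d t0) -!powRrM.
    by congr (_ `^ _); rewrite /w; field; rewrite gt_eqF.
  rewrite /sd /side -mulrA ler_pM2l//.
  have h := halvings_ge j0 w1 w0 n j.
  have : 2^-1 `^ ((halvings w j0 n j)%:R + k%:R) <= 2^-1 `^ (n%:R * w j) :> R.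
    by apply: ger_powR => //; rewrite invr_gt0 ltr0n/=; lra.
  rewrite powRD ?powR_mulrn//; last by apply/implyP.
  rewrite !exprVn => /(ler_wpM2l (exprn_ge0 k (ler0n R 2))); apply: le_trans.
  by rewrite mulrCA mulfV ?mulr1// expf_neq0.
(* The root cell is the cube of side [r] centred at [x0], hence the density radius [r / 2]. *)
pose corner s : 'rV[R]_k := \row_j (x0 0 j - r / 2 + off 0%N s j).
have ob n t j := offset_bound w j0 r0 n t j.
have cat s t j : corner (s ++ t) 0 j - corner s 0 j = off (size s) t j.
  by rewrite !mxE /off offset_cat add0n; ring.
exists corner, (r * 2 ^+ k), (r / 2); split.
- move=> s; apply/rowP => j; apply/eqP; rewrite -subr_eq0 -cats1 cat /off /=.
  by rewrite addr0.
- split=> [|s t j]; first by rewrite mulr_ge0 ?exprn_ge0// ltW.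
  rewrite cat; apply: le_trans (sdC _ _); have /andP[h1 h2] := ob (size s) t j.
  by rewrite ger0_norm.
- move=> s j; rewrite mxE; have := ob 0%N s j; rewrite /side /= expr0 divr1 /off.
  by move=> h; rewrite ler_norml; lra.
- split=> [|x xr e e0]; first by rewrite divr_gt0.
  have [n Hn] : exists n, forall j, sd n j <= e.
    have K0 : 0 < r * 2 ^+ k by rewrite mulr_gt0// exprn_gt0.
    have [||n hn] := @expr_small _ theta (e / (r * 2 ^+ k)); rewrite ?divr_gt0 ?ltW//.
    exists n => j; apply: (le_trans (sdC n j)); rewrite mulrC -ler_pdivlMr//.
    apply: le_trans (hn n (leqnn n)); apply: ge1r_powR; last by rewrite lerDr ltW.
    by rewrite exprn_gt0// exprn_ile1// ltW.
  have [|t [st ht]] := @offset_dense _ _ w j0 r 0%N n (fun j => x 0 j - (x0 0 j - r / 2)).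
    move=> j; have := xr j; rewrite /side /= expr0 divr1 ler_norml; lra.
  exists t => j; have := ht j; have := Hn j; rewrite add0n mxE -/(off 0%N t j) -/(sd n j).
  by move=> h1 h2; rewrite ler_norml; lra.
Qed.

(** * Square-integrable fields *)

Section AeSpan.
Context d (T : measurableType d) (R : realType) (P : probability T R).
Local Open Scope ereal_scope.

Lemma ae_probability_eq (A B : set T) : measurable A -> measurable B ->
  {ae P, forall w, A w <-> B w} -> P A = P B.
Proof.
move=> mA mB AB; rewrite -(setIT A) -(setIT B) -!integral_indic//.
apply: ae_eq_integral => //; try exact/measurable_EFinP.
apply: filterS AB => w ABw _ /=; congr (_%:E).
by rewrite !indicE; congr (_%:R); congr nat_of_bool; apply/idP/idP; rewrite !inE => /ABw.
Qed.

Lemma centered_gaussian_ae (X Y : T -> R) : measurable_fun setT Y ->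
  {ae P, forall w, Y w = X w} -> centered_gaussian P X -> centered_gaussian P Y.
Proof.
move=> mY YX [mX [s [s0 Xs]]]; split => //; exists s; split => // B mB.
rewrite -Xs//; apply: ae_probability_eq.
- by rewrite -[_ @^-1` _]setTI; exact: mY.
- by rewrite -[_ @^-1` _]setTI; exact: mX.
- by apply: filterS YX => w /= ->.
Qed.

Lemma mom2_ae (X Y : T -> R) : measurable_fun setT X -> measurable_fun setT Y ->
  {ae P, forall w, Y w = X w} -> mom2 P Y = mom2 P X.
Proof.
move=> mX mY YX; congr fine; apply: ae_eq_integral => //.
- exact/measurable_EFinP/measurable_funX.
- exact/measurable_EFinP/measurable_funX.
- by apply: filterS YX => w -> _.
Qed.

Lemma ip_ae (X Y Z : T -> R) : measurable_fun setT X -> measurable_fun setT Y ->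
  measurable_fun setT Z -> {ae P, forall w, Y w = X w} -> ip P Y Z = ip P X Z.
Proof.
move=> mX mY mZ YX; congr fine; apply: ae_eq_integral => //.
- exact/measurable_EFinP/measurable_funM.
- exact/measurable_EFinP/measurable_funM.
- by apply: filterS YX => w -> _.
Qed.

Lemma centered_gaussian_integrable (X : T -> R) : centered_gaussian P X ->
  P.-integrable setT (EFin \o X).
Proof.
move=> gX; have mX := gX.1.
apply: (@le_integrable _ _ _ P setT _ _ (fun w => 1 + (X w ^+ 2)%:E)) => //.
- exact/measurable_EFinP.
- move=> w _ /=; rewrite lee_fin [leRHS]ger0_norm ?addr_ge0 ?sqr_ge0//.
  rewrite -(real_normK (num_real (X w))).
  have h : (0 <= (`|X w| - 1) ^+ 2)%R by exact: sqr_ge0.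
  have h1 : (0 <= `|X w| ^+ 2)%R by exact: sqr_ge0.
  by nra.
- apply: integrableD => //; first exact: finite_measure_integrable_cst.
  apply/integrableP; split; first exact/measurable_EFinP/measurable_funX.
  under eq_integral do rewrite gee0_abs ?lee_fin ?sqr_ge0//.
  by rewrite integral_mom2 ?ltry.
Qed.

Lemma indep_ip0 (X Y : T -> R) : centered_gaussian P X -> centered_gaussian P Y ->
  'E_P[X] = 0 ->
  (forall A B, measurable A -> measurable B ->
     P (X @^-1` A `&` Y @^-1` B) = P (X @^-1` A) * P (Y @^-1` B)) ->
  ip P X Y = 0%R.
Proof.
move=> gX gY EX XY; have iX := centered_gaussian_integrable gX.
have iY := centered_gaussian_integrable gY.
rewrite /ip (indep_integralM gX.1 gY.1 XY iX iY).
by move: EX; rewrite unlock => ->; rewrite mul0e.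
Qed.

Lemma independent_processesP (I J : Type) (X : I -> T -> R) (Y : J -> T -> R) i j A B :
  independent_processes P X Y -> measurable A -> measurable B ->
  P (X i @^-1` A `&` Y j @^-1` B) = P (X i @^-1` A) * P (Y j @^-1` B).
Proof.
move=> XY mA mB; apply: XY; apply: sub_sigma_algebra.
- by exists i => //; exists A => //; rewrite setTI.
- by exists j => //; exists B => //; rewrite setTI.
Qed.

Variables (I : Type) (W : I -> T -> R).
Hypothesis W_gauss : forall s, gaussian_rv P (fun w => lform s (W ^~ w)).
Hypothesis W_centered : forall i, 'E_P[W i] = 0.

(** The identities of white noise hold only almost everywhere, so the span is taken modulo null
    sets. Measurability is required separately because it does not pass to a function that is merely
    equal almost everywhere. *)
Definition ae_span (X : T -> R) := measurable_fun setT X /\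
  exists s, {ae P, forall w, X w = lform s (W ^~ w)}.

Lemma ae_span1 i X : measurable_fun setT X -> {ae P, forall w, X w = W i w} -> ae_span X.
Proof.
move=> mX Xi; split => //; exists [:: (1%R, i)]; apply: filterS Xi => w ->.
by rewrite /lform big_seq1 mul1r.
Qed.

Lemma centered_gaussian1 i : centered_gaussian P (W i).
Proof.
apply: gaussian_rv_centered => //.
rewrite (_ : W i = fun w => lform [:: (1%R, i)] (W ^~ w)); first exact: W_gauss.
by apply/funext => w; rewrite /lform big_seq1 mul1r.
Qed.

Lemma lform_centered s : 'E_P[fun w => lform s (W ^~ w)] = 0.
Proof.
rewrite unlock.
suff [] : P.-integrable setT (fun w => (lform s (W ^~ w))%:E) /\
    \int[P]_w (lform s (W ^~ w))%:E = 0 by [].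
elim: s => [|[a i] s [iS ES]].
  have e w : (lform [::] (W ^~ w))%:E = 0 by rewrite /lform big_nil.
  split; last by under eq_integral do rewrite e; exact: integral0.
  by apply: eq_integrable (integrable0 _ _) => // w _; rewrite e.
have e w : (lform ((a, i) :: s) (W ^~ w))%:E = a%:E * (W i w)%:E + (lform s (W ^~ w))%:E.
  by rewrite -EFinM -EFinD /lform big_cons.
have ii := centered_gaussian_integrable (centered_gaussian1 i).
have iaW : P.-integrable setT (fun w => a%:E * (W i w)%:E) by exact: integrableZl.
split.
  by apply: eq_integrable (integrableD measurableT iaW iS) => // w _; rewrite e.
under eq_integral do rewrite e.
rewrite integralD// ES adde0 integralZl//.
by have := W_centered i; rewrite unlock => ->; rewrite mule0.
Qed.

Lemma ae_span_gaussian_space : gaussian_space P ae_span.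
Proof.
split.
- split; first exact: measurable_cst.
  by exists [::]; apply: nearW => w; rewrite /lform big_nil.
- move=> X [mX [s Xs]]; apply: centered_gaussian_ae Xs _ => //.
  by apply: gaussian_rv_centered; [exact: W_gauss|exact: lform_centered].
- move=> a X Y [mX [s Xs]] [mY [t Yt]]; split.
    by apply: measurable_funD => //; exact: measurable_funM.
  exists ([seq (a * p.1, p.2)%R | p <- s] ++ t).
  by apply: filterS2 Xs Yt => w -> ->; rewrite lform_cat lformZ.
Qed.

End AeSpan.

Lemma gaussian_field_lform (R : realType) d (T : measurableType d) (P : probability T R)
    n (S : Type) (D : set S) (X : S -> T -> 'rV[R]_n) (I : Type) (h : I -> S) (c : I -> 'I_n) :
  gaussian_field P D X -> (forall i, D (h i)) ->
  forall s, gaussian_rv P (fun w => lform s (fun i => X (h i) w 0 (c i))).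
Proof.
move=> gX Dh s; pose q (l : 'I_(size s)) := tnth (in_tuple s) l.
(* Coefficient vectors supported on one component turn the form into a combination covered by
   [gaussian_field]. *)
pose a l : 'rV[R]_n := (q l).1 *: delta_mx 0 (c (q l).2).
have := gX _ (fun l => h (q l).2) a (fun l => Dh (q l).2).
congr gaussian_rv; apply/funext => w; rewrite /lform [RHS]big_tnth.
apply: eq_bigr => l _; rewrite (bigD1 (c (q l).2))//= big1 => [|i il].
  by rewrite !mxE !eqxx mulr1 addr0.
by rewrite !mxE (negbTE il) andbF mulr0 mul0r.
Qed.

Section GaussChar.
Context d (T : measurableType d) (R : realType) (P : probability T R).
Local Open Scope ereal_scope.

(** Rescaled to variances [a] and [b], the independent [X] and [Y] have a sum of variance [a + b].
    When the cosine of the sum is expanded, the sine term vanishes by symmetry. *)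
Lemma gauss_charD (L : (T -> R) -> Prop) (X Y : T -> R) : gaussian_space P L ->
  L X -> L Y -> 'E_P[X] = 0 -> (0 < mom2 P X)%R -> (0 < mom2 P Y)%R ->
  (forall A B, measurable A -> measurable B ->
     P (X @^-1` A `&` Y @^-1` B) = P (X @^-1` A) * P (Y @^-1` B)) ->
  forall a b : R, (0 <= a)%R -> (0 <= b)%R ->
  gauss_char (a + b)%R = (gauss_char a * gauss_char b)%R.
Proof.
move=> gL LX LY EX X0 Y0 XY a b a0 b0.
pose al := Num.sqrt (a / mom2 P X)%R; pose be := Num.sqrt (b / mom2 P Y)%R.
have LaX : L (fun w => al * X w)%R by exact: (gsZ gL).
have LbY : L (fun w => be * Y w)%R by exact: (gsZ gL).
have ma : mom2 P (fun w => al * X w)%R = a.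
  by rewrite (mom2_scale gL)// sqr_sqrtr ?divr_ge0 ?mom2_ge0// divfK// gt_eqF.
have mb : mom2 P (fun w => be * Y w)%R = b.
  by rewrite (mom2_scale gL)// sqr_sqrtr ?divr_ge0 ?mom2_ge0// divfK// gt_eqF.
have mab : mom2 P (fun w => al * X w + be * Y w)%R = (a + b)%R.
  rewrite (mom2_add gL)// ma mb (ip_scalel gL)// ipC (ip_scalel gL)// ipC.
  rewrite (indep_ip0 (gsG gL LX) (gsG gL LY) EX XY); ring.
have cc : continuous (@cos R) by exact: continuous_cos.
have cs : continuous (@sin R) by exact: continuous_sin.
have cos1 (x : R) : (`|cos x| <= 1)%R by rewrite ler_norml cos_geN1 cos_le1.
have sin1 (x : R) : (`|sin x| <= 1)%R by rewrite ler_norml sin_geN1 sin_le1.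
have prod (f : R -> R) : continuous f -> (forall x, `|f x| <= 1)%R ->
    P.-integrable setT (fun w => (f (al * X w) * f (be * Y w))%:E) /\
    \int[P]_w (f (al * X w) * f (be * Y w))%:E =
    \int[P]_w (f (al * X w))%:E * \int[P]_w (f (be * Y w))%:E.
  move=> cf f1; have mf : measurable_fun setT f by exact: continuous_measurable_fun.
  have mfX (c : R) (Z : T -> R) : L Z -> measurable_fun setT (fun w => f (c * Z w))%R.
    by move=> LZ; apply: measurableT_comp => //; apply: measurable_funM => //; exact: (gsM gL LZ).
  have ii (c : R) (Z : T -> R) : L Z -> P.-integrable setT (EFin \o (fun w => f (c * Z w))%R).
    by move=> LZ; apply: (@bounded_integrable _ _ _ _ _ 1%R) => //; exact: mfX.
  split.
    apply: (@bounded_integrable _ _ _ _ (fun w => f (al * X w) * f (be * Y w))%R 1%R).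
      by apply: measurable_funM; exact: mfX.
    by move=> w; rewrite normrM mulr_ile1.
  apply: indep_integralM; [exact: mfX|exact: mfX| |exact: ii|exact: ii].
  have mpre (c : R) C : measurable C -> measurable ((fun x : R => f (c * x))%R @^-1` C).
    move=> mC; rewrite -[_ @^-1` _]setTI; have : measurable_fun setT (fun x : R => f (c * x))%R.
      by apply: measurableT_comp => //; exact: measurable_funM.
    by apply.
  by move=> C D mC mD; exact: (XY _ _ (mpre al C mC) (mpre be D mD)).
have [ic Ic] := prod _ cc cos1; have [is_ Is] := prod _ cs sin1.
have := gaussian_cos (gsG gL (gsD gL LaX LbY)); rewrite mab.
under eq_integral do rewrite cosD EFinB.
rewrite integralB//= Ic Is (gaussian_cos (gsG gL LaX)) (gaussian_cos (gsG gL LbY)) ma mb.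
by rewrite (gaussian_sin (gsG gL LaX)) mul0e sube0 -EFinM => -[].
Qed.

End GaussChar.

Section L2norm.
Context d (T : measurableType d) (R : realType) (P : probability T R).
Local Open Scope ereal_scope.

Lemma L2norm_sqr n (Y : T -> 'rV[R]_n) :
  (L2norm P Y `^ 2)%E = \int[P]_w (\sum_i Y w 0%R i ^+ 2)%:E.
Proof.
rewrite /L2norm poweR_Lnorm//; apply: eq_integral => w _ /=.
congr (_%:E); rewrite ger0_norm ?sqrtr_ge0// powR_mulrn ?sqrtr_ge0//.
by rewrite sqr_sqrtr// sumr_ge0// => i _; exact: sqr_ge0.
Qed.

Lemma mom2_le_L2norm n (Y : T -> 'rV[R]_n) i (c : R) :
  (forall i, measurable_fun setT (fun w => Y w 0%R i)) ->
  L2norm P Y <= c%:E -> (mom2 P (fun w => Y w 0%R i) <= c ^+ 2)%R.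
Proof.
move=> mY Yc.
have c0 : (0 <= c)%R by rewrite -lee_fin; apply: le_trans Yc; exact: Lnorm_ge0.
have Y2 : \int[P]_w (Y w 0%R i ^+ 2)%:E <= (c ^+ 2)%:E.
  apply: (@le_trans _ _ (L2norm P Y `^ 2)).
    rewrite L2norm_sqr; apply: ge0_le_integral => //.
    - by move=> w _; rewrite lee_fin sqr_ge0.
    - exact/measurable_EFinP/measurable_funX.
    - by apply/measurable_EFinP; apply: measurable_sum => j; exact: measurable_funX.
    - by move=> w _; rewrite lee_fin (bigD1 i)//= lerDl sumr_ge0// => *; exact: sqr_ge0.
  rewrite -(powR_mulrn 2 c0) -poweR_EFin.
  by apply: gt0_ler_poweR => //; rewrite in_itv/= ?lee_fin ?c0 ?Lnorm_ge0 ?leey.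
rewrite -lee_fin /mom2 fineK// ge0_fin_numE; first exact: le_lt_trans Y2 (ltry _).
by apply: integral_ge0 => w _; rewrite lee_fin sqr_ge0.
Qed.

Lemma L2norm_gt0 n (Y : T -> 'rV[R]_n) (c : R) :
  (forall i, centered_gaussian P (fun w => Y w 0%R i)) ->
  (0 < c)%R -> c%:E <= L2norm P Y -> exists i, (0 < mom2 P (fun w => Y w 0%R i))%R.
Proof.
move=> gY c0 Yc; apply: contrapT => /forallNP h.
have Y0 i : mom2 P (fun w => Y w 0%R i) = 0%R.
  apply/eqP; rewrite eq_le mom2_ge0 andbT leNgt; apply/negP; exact: h.
have : L2norm P Y `^ 2 = 0.
  rewrite L2norm_sqr; under eq_integral do rewrite -sumEFin.
  rewrite ge0_integral_sum//.
  - by rewrite big1// => i _; rewrite integral_mom2// Y0.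
  - by move=> i; apply/measurable_EFinP/measurable_funX; exact: (gY i).1.
  - by move=> i w _; rewrite lee_fin sqr_ge0.
move/poweR_eq0_eq0 => /(_ (Lnorm_ge0 _ _ _)) Y00.
by move: Yc; rewrite Y00 lee_fin leNgt c0.
Qed.

End L2norm.

(** * White noise fields *)

Section WhiteNoise.
Context {R : realType} {disp : measure_display} {Omega : measurableType disp}.
Variable P : probability Omega R.
Context {k d : nat}.
Variables (gamma : 'I_k -> R) (v : 'rV[R]_k -> Omega -> 'rV[R]_d).
Variables (U : set 'rV[R]_k) (V : set R -> 'rV[R]_k -> Omega -> 'rV[R]_d).
Variables (c0 a0 : R).
Hypothesis v_meas : forall x i, measurable_fun setT (fun w => v x w 0 i).
Hypothesis V_gauss : gaussian_field P
  [set Ax : set R * 'rV[R]_k | borelRp Ax.1] (fun Ax => V Ax.1 Ax.2).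
Hypothesis V_noise : forall x, U x ->
  (exists nu : {measure set R -> \bar R}, white_noise P nu (V ^~ x)) /\
  {ae P, forall w, V `[0%R, +oo[%classic x w = v x w}.
Hypothesis V_indep : forall A B, borelRp A -> borelRp B -> A `&` B = set0 ->
  independent_processes P
    (fun (xi : 'rV[R]_k * 'I_d) w => V A xi.1 w 0 xi.2)
    (fun (xi : 'rV[R]_k * 'I_d) w => V B xi.1 w 0 xi.2).
Hypothesis V_incr : forall (a : R) (b : \bar R) (x y : 'rV[R]_k),
  a0 <= a -> (a%:E <= b)%E -> U x -> U y ->
  let ab := [set t : R | a <= t /\ (t%:E < b)%E] in
  (L2norm P (fun w => (V ab x w - v x w - V ab y w + v y w)%R) <=
    c0%:E * ((\sum_(j < k) a `^ gamma j * `|x 0 j - y 0 j|)%R%:E + b^-1))%E.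

Local Notation Vc A x i := (fun w => V A x w 0 i).
Local Notation vc x i := (fun w => v x w 0 i).

(** [V A x] is known to be centered only for [A] Borel in the half-line and [x] in [U], hence the
    restricted index. *)
Definition Vindex := ({Ax : set R * 'rV[R]_k | borelRp Ax.1 /\ U Ax.2} * 'I_d)%type.

Definition Vfam (p : Vindex) : Omega -> R := Vc (sval p.1).1 (sval p.1).2 p.2.

Lemma Vfam_gauss s : gaussian_rv P (fun w => lform s (Vfam ^~ w)).
Proof.
exact: (gaussian_field_lform (fun p : Vindex => p.2) V_gauss
  (fun p : Vindex => (svalP p.1).1)).
Qed.

Lemma Vfam_centered p : ('E_P[Vfam p] = 0)%E.
Proof.
case: p => [[[A x] /= [bA Ux]] i]; have [[nu [H _]] _] := V_noise Ux.
by have [_ + _] := H A bA; exact.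
Qed.

Definition Vspan := ae_span P Vfam.

Lemma Vspan_gaussian : gaussian_space P Vspan.
Proof. exact: ae_span_gaussian_space Vfam_gauss Vfam_centered. Qed.
Local Notation gL := Vspan_gaussian.

Lemma V_centered_gaussian A x i : borelRp A -> U x -> centered_gaussian P (Vc A x i).
Proof.
move=> bA Ux; exact: (centered_gaussian1 Vfam_gauss Vfam_centered
  (exist _ (A, x) (conj bA Ux), i)).
Qed.

Lemma Vspan_V A x i : borelRp A -> U x -> Vspan (Vc A x i).
Proof.
move=> bA Ux; apply: (@ae_span1 _ _ _ _ _ _ (exist _ (A, x) (conj bA Ux), i)).
  exact: (V_centered_gaussian i bA Ux).1.
exact: nearW.
Qed.

Lemma borelRp_Rp : borelRp (`[0%R, +oo[%classic : set R).
Proof. by split. Qed.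

Lemma V_Rp x i : U x -> {ae P, forall w, v x w 0 i = V `[0%R, +oo[%classic x w 0 i}.
Proof. by move=> /V_noise[_]; apply: filterS => w ->. Qed.

Lemma Vspan_v x i : U x -> Vspan (vc x i).
Proof.
move=> Ux.
apply: (@ae_span1 _ _ _ _ _ _ (exist _ (`[0%R, +oo[%classic, x) (conj borelRp_Rp Ux), i)) => //.
exact: V_Rp.
Qed.

Lemma V_ortho A B x y i j : borelRp A -> borelRp B -> A `&` B = set0 ->
  U x -> U y -> ip P (Vc A x i) (Vc B y j) = 0.
Proof.
move=> bA bB AB Ux Uy; apply: indep_ip0.
- exact: V_centered_gaussian.
- exact: V_centered_gaussian.
- exact: (Vfam_centered (exist _ (A, x) (conj bA Ux), i)).
- move=> C D mC mD.
  exact: (@independent_processesP _ _ _ _ _ _ _ _ (x, i) (y, j) _ _ (V_indep bA bB AB)).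
Qed.

Lemma V_setU A B x : borelRp A -> borelRp B -> A `&` B = set0 -> U x ->
  {ae P, forall w, V (A `|` B) x w = V A x w + V B x w}.
Proof.
by move=> bA bB AB Ux; have [[nu [_ H]] _] := V_noise Ux; have [] := H A B bA bB AB.
Qed.

(** Additivity for the disjoint pair [set0], [set0]. *)
Lemma V_set0 x : U x -> {ae P, forall w, V set0 x w = 0}.
Proof.
move=> Ux; have b0 : borelRp (set0 : set R) by split.
have := V_setU b0 b0 (setI0 _) Ux; rewrite setU0; apply: filterS => w h.
apply/eqP; rewrite -(subr_eq0 (V set0 x w) 0) subr0 -{1}(addrK (V set0 x w) (V set0 x w)).
by rewrite -h subrr.
Qed.

Lemma borelRp_compl (A : set R) : borelRp A -> borelRp (`[0%R, +oo[%classic `\` A).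
Proof. by move=> [mA _]; split => [|t []//]; exact: measurableD. Qed.

Lemma v_split A x i : borelRp A -> U x ->
  {ae P, forall w, v x w 0 i = V A x w 0 i + V (`[0%R, +oo[%classic `\` A) x w 0 i}.
Proof.
move=> bA Ux; have := V_setU bA (borelRp_compl bA) (setDIK _ _) Ux.
rewrite setDUK; last exact: bA.2.
by apply: filterS2 (V_Rp i Ux) => w -> ->; rewrite mxE.
Qed.

(* The part of v outside A is independent of V A, so removing V A decreases the
   variance of increments. *)
Lemma residual_le A x y i : borelRp A -> U x -> U y ->
  mom2 P (fun w => (v x w 0 i - V A x w 0 i) - (v y w 0 i - V A y w 0 i)) <=
  mom2 P (fun w => v x w 0 i - v y w 0 i).
Proof.
move=> bA Ux Uy; have bB := borelRp_compl bA; set B := _ `\` A in bB.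
have AB : A `&` B = set0 by rewrite setDIK.
have LA z : U z -> Vspan (Vc A z i) by exact: Vspan_V.
have LB z : U z -> Vspan (Vc B z i) by exact: Vspan_V.
have LdA := gsB gL (LA _ Ux) (LA _ Uy); have LdB := gsB gL (LB _ Ux) (LB _ Uy).
have Lv z : U z -> Vspan (vc z i) by exact: Vspan_v.
have o : ip P (fun w => V A x w 0 i - V A y w 0 i) (fun w => V B x w 0 i - V B y w 0 i) = 0.
  rewrite (ip_subl gL (LA _ Ux) (LA _ Uy) LdB) !(ipC _ _ (fun w => V B x w 0 i - _)).
  rewrite (ip_subl gL (LB _ Ux) (LB _ Uy) (LA _ Ux)) (ip_subl gL (LB _ Ux) (LB _ Uy) (LA _ Uy)).
  by rewrite !(V_ortho _ _ bB bA)// ?subrr// setIC.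
rewrite (@mom2_ae _ _ _ P (fun w => V B x w 0 i - V B y w 0 i)); last 3 first.
- exact: (gsM gL LdB).
- exact: (gsM gL (gsB gL (gsB gL (Lv _ Ux) (LA _ Ux)) (gsB gL (Lv _ Uy) (LA _ Uy)))).
- by apply: filterS2 (v_split i bA Ux) (v_split i bA Uy) => w -> ->; rewrite /B; ring.
rewrite [leRHS](@mom2_ae _ _ _ P (fun w =>
  (V A x w 0 i - V A y w 0 i) + (V B x w 0 i - V B y w 0 i))); last 3 first.
- exact: (gsM gL (gsD gL LdA LdB)).
- exact: (gsM gL (gsB gL (Lv _ Ux) (Lv _ Uy))).
- by apply: filterS2 (v_split i bA Ux) (v_split i bA Uy) => w -> ->; rewrite /B; ring.
by rewrite (mom2_add gL LdA LdB) o mulr0 addr0 lerDr mom2_ge0.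
Qed.

Definition ico (a : R) (b : \bar R) : set R := [set t : R | a <= t /\ (t%:E < b)%E].

Lemma borelRp_ico a b : 0 <= a -> borelRp (ico a b).
Proof.
move=> a0'; split => [|t [/= ta _]]; last by rewrite in_itv/= andbT (le_trans a0').
case: b => [b||].
- rewrite (_ : ico _ _ = `[a, b[%classic)//.
  apply/seteqP; split => t; rewrite /ico/= in_itv/= lte_fin; first by move=> [-> ->].
  by move=> /andP.
- rewrite (_ : ico _ _ = `[a, +oo[%classic)//.
  by apply/seteqP; split => t; rewrite /ico/= in_itv/= ltry andbT => // -[].
- by rewrite (_ : ico _ _ = set0)//; apply/seteqP; split => t // [].
Qed.

Lemma ico_incr_le a b x y i (c : R) : a0 <= a -> 0 <= a -> (a%:E <= b)%E ->
  U x -> U y ->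
  (c0%:E * ((\sum_(j < k) a `^ gamma j * `|x 0 j - y 0 j|)%R%:E + b^-1) <= c%:E)%E ->
  mom2 P (fun w => (v x w 0 i - V (ico a b) x w 0 i) - (v y w 0 i - V (ico a b) y w 0 i)) <= c ^+ 2.
Proof.
move=> a0a a_ge0 ab Ux Uy hc.
have := le_trans (V_incr a0a ab Ux Uy) hc.
have bA := borelRp_ico b a_ge0.
have LA z j : U z -> Vspan (Vc (ico a b) z j) by exact: Vspan_V.
have m z j : U z -> measurable_fun setT (Vc (ico a b) z j).
  by move=> Uz; exact: (gsM gL (LA z j Uz)).
move=> /(mom2_le_L2norm i) h.
apply: le_trans (h _); last first.
  move=> j; rewrite (_ : (fun w => _) = fun w => (V (ico a b) x w 0 j - v x w 0 j -
    V (ico a b) y w 0 j) + v y w 0 j); last by apply/funext => w; rewrite !mxE.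
  by apply: measurable_funD => //; apply: measurable_funB; [apply: measurable_funB|]; auto.
rewrite /mom2 le_eqVlt; apply/orP; left; apply/eqP; congr fine.
by apply: eq_integral => w _; congr (_%:E); rewrite !mxE /ico; ring.
Qed.

(** The increment condition with [b = a], where the set is empty and its noise vanishes. *)
Lemma v_incr_le a x y i : a0 <= a -> 0 < a -> U x -> U y ->
  mom2 P (fun w => v x w 0 i - v y w 0 i) <=
  (c0 * (\sum_(j < k) a `^ gamma j * `|x 0 j - y 0 j| + a^-1)) ^+ 2.
Proof.
move=> a0a a_gt0 Ux Uy.
have := @ico_incr_le a a%:E x y i _ a0a (ltW a_gt0) (lexx _) Ux Uy.
move=> /(_ (c0 * (\sum_(j < k) a `^ gamma j * `|x 0 j - y 0 j| + a^-1))) h.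
have e0 : ico a a%:E = set0.
  apply/seteqP; split => t //= -[ta]; rewrite lte_fin => /(le_lt_trans ta).
  by rewrite ltxx.
rewrite e0 in h; apply: le_trans (h _); last first.
  by rewrite inver gt_eqF// -EFinD -EFinM.
have b0 : borelRp (set0 : set R) by split.
rewrite le_eqVlt; apply/orP; left; apply/eqP; apply: mom2_ae.
- exact: (gsM gL (gsB gL (gsB gL (Vspan_v _ Ux) (Vspan_V _ b0 Ux))
    (gsB gL (Vspan_v _ Uy) (Vspan_V _ b0 Uy)))).
- exact: (gsM gL (gsB gL (Vspan_v _ Ux) (Vspan_v _ Uy))).
- by apply: filterS2 (V_set0 Ux) (V_set0 Uy) => w -> ->; rewrite !mxE !subr0.
Qed.

Lemma ip_noise x (nu : {measure set R -> \bar R}) A i j : white_noise P nu (V ^~ x) ->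
  borelRp A -> U x ->
  (ip P (Vc A x i) (Vc A x j))%:E = if i == j then nu A else 0%E.
Proof.
move=> [H _] bA Ux; have [_ E0 C] := H A bA; rewrite -C.
rewrite -(gs_ipE gL (Vspan_V i bA Ux) (Vspan_V j bA Ux)).
rewrite covariance.unlock !E0/= expectation.unlock.
by apply: eq_integral => w _; rewrite !fctE/= !subr0.
Qed.

Lemma v_variance x (nu : {measure set R -> \bar R}) i : white_noise P nu (V ^~ x) ->
  U x -> (mom2 P (vc x i))%:E = nu `[0%R, +oo[%classic.
Proof.
move=> WN Ux; have := ip_noise i i WN borelRp_Rp Ux; rewrite eqxx => <-.
rewrite -mom2E; congr (_%:E); apply: mom2_ae => //; last exact: V_Rp.
exact: (gsM gL (Vspan_V _ borelRp_Rp Ux)).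
Qed.

(** The half-line has measure equal to the positive variance of [v x], so some [[0, n[] has positive
    measure; [a] is then enlarged to reach [a0]. *)
Lemma noise_variance x : U x -> (exists i, 0 < mom2 P (vc x i)) ->
  exists a sg : R, [/\ a0 <= a, 0 <= a, 0 < sg & forall i j,
    ip P (Vc (ico 0 a%:E) x i) (Vc (ico 0 a%:E) x j) = if i == j then sg else 0].
Proof.
move=> Ux [i0 vi0]; have [[nu WN] _] := V_noise Ux.
have bA a : borelRp (ico 0 a%:E) by exact: borelRp_ico.
have nuE A i : borelRp A -> nu A = (mom2 P (Vc A x i))%:E.
  by move=> bB; rewrite mom2E (ip_noise i i WN bB Ux) eqxx.
have nuR : (0 < nu `[0%R, +oo[%classic)%E by rewrite -(v_variance i0 WN Ux) lte_fin.
have [n nun] : exists n : nat, nu (ico 0 n%:R%:E) != 0%E.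
  apply: contrapT => /forallNP h; move: nuR; rewrite lt_neqAle => /andP[/eqP + _]; apply.
  apply/esym; apply: measure_negligible => //.
  rewrite (_ : `[0%R, +oo[%classic = \bigcup_n ico 0 n%:R%:E).
    apply: negligible_bigcup => n; apply/negligibleP; first exact: (bA _).1.
    by apply/eqP; have := h n; case: eqP.
  apply/seteqP; split => t /=; rewrite in_itv/= andbT; last by move=> [n _ []].
  move=> t0.
  by exists (Num.truncn t).+1 => //; split => //; rewrite lte_fin; exact: truncnS_gt.
pose a := Num.max a0 n%:R.
exists a, (mom2 P (Vc (ico 0 a%:E) x i0)).
have na : (nu (ico 0 n%:R%:E) <= nu (ico 0 a%:E))%E.
  apply: le_measure; rewrite ?inE; [exact: (bA _).1|exact: (bA _).1|].
  by move=> t [t0 tn]; split => //; apply: (lt_le_trans tn); rewrite lee_fin le_max lexx orbT.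
split.
- by rewrite le_max lexx.
- by rewrite le_max ler0n orbT.
- rewrite -lte_fin -(nuE _ i0 (bA _)); apply: lt_le_trans na.
  by rewrite lt_neqAle eq_sym nun measure_ge0.
- move=> i j; apply: EFin_inj; rewrite (ip_noise i j WN (bA _) Ux).
  by case: eqP => // _; rewrite (nuE _ i0 (bA _)).
Qed.

Lemma ip_v_V A x i j : borelRp A -> U x ->
  ip P (vc x i) (Vc A x j) = ip P (Vc A x i) (Vc A x j).
Proof.
move=> bA Ux; have bB := borelRp_compl bA; set B := _ `\` A in bB.
have LA z := Vspan_V z bA Ux; have LB z := Vspan_V z bB Ux.
rewrite (@ip_ae _ _ _ P (fun w => V A x w 0 i + V B x w 0 i)); last 4 first.
- exact: (gsM gL (gsD gL (LA _) (LB _))).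
- exact: v_meas.
- exact: (gsM gL (LA _)).
- exact: v_split.
rewrite (ip_addl gL (LA _) (LB _) (LA _)) (V_ortho _ _ bB bA) ?addr0//.
by rewrite setIC setDIK.
Qed.

(** The noise on [[a, +oo[] is independent of the noise on [[0, a[], so subtracting it from [v]
    leaves the covariance unchanged; what remains is Lipschitz by the increment condition with
    [b = +oo]. *)
Lemma ip_G_lip a x0 x y i j (be : R) : a0 <= a -> 0 <= a -> 0 < be ->
  U x0 -> U x -> U y ->
  c0 * \sum_(j < k) a `^ gamma j * `|x 0 j - y 0 j| <= be ->
  `|ip P (vc x i) (Vc (ico 0 a%:E) x0 j) - ip P (vc y i) (Vc (ico 0 a%:E) x0 j)| <=
  be * (1 + mom2 P (Vc (ico 0 a%:E) x0 j)) / 2.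
Proof.
move=> a0a a_ge0 be0 Ux0 Ux Uy hbe.
have bA : borelRp (ico 0 a%:E) by exact: borelRp_ico.
have bB : borelRp (ico a +oo%E) by exact: borelRp_ico.
have BA : ico a +oo%E `&` ico 0 a%:E = set0.
  apply/seteqP; split => t // [[ta _] [_]]; rewrite lte_fin => /(le_lt_trans ta).
  by rewrite ltxx.
have LG := Vspan_V j bA Ux0.
have Lv z := Vspan_v i (x := z); have LB z := Vspan_V i bB (x := z).
have LR z : U z -> Vspan (fun w => v z w 0 i - V (ico a +oo%E) z w 0 i).
  by move=> Uz; exact: (gsB gL (Lv _ Uz) (LB _ Uz)).
have e z : U z -> ip P (fun w => v z w 0 i - V (ico a +oo%E) z w 0 i) (Vc (ico 0 a%:E) x0 j) =
    ip P (vc z i) (Vc (ico 0 a%:E) x0 j).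
  by move=> Uz; rewrite (ip_subl gL (Lv _ Uz) (LB _ Uz) LG) V_ortho// subr0.
rewrite -(e _ Ux) -(e _ Uy) -(ip_subl gL (LR _ Ux) (LR _ Uy) LG).
have LD := gsB gL (LR _ Ux) (LR _ Uy).
apply: (le_trans (ip_le gL be0 LD LG)); rewrite ler_pM2r ?invr_gt0// mulrDr mulr1 lerD2r.
rewrite mulrC ler_pdivrMr// -expr2; apply: ico_incr_le => //; first by rewrite leey.
by rewrite invey adde0 -EFinM lee_fin.
Qed.

Variables (theta C : R) (corner : seq bool -> 'rV[R]_k).
Hypotheses (theta0 : 0 < theta) (theta1 : theta < 1) (c0_ge0 : 0 <= c0)
  (gamma_gt0 : forall j, 0 < gamma j)
  (C0 : 0 <= C) (cornerU : forall s, U (corner s))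
  (corner_false : forall s, corner (rcons s false) = corner s)
  (cornerC : forall s t j, `|corner (s ++ t) 0 j - corner s 0 j| <=
        C * (theta ^+ size s) `^ (gamma j + 1)).

Let K := Num.max a0 1.
Let B := C * (\sum_j K `^ gamma j) + 1.

Let K0 : 0 < K. Proof. by rewrite lt_max ltr01 orbT. Qed.
Let a0K : a0 <= K. Proof. by rewrite le_max lexx. Qed.
Let K1 : 1 <= K. Proof. by rewrite le_max lexx orbT. Qed.
Let B0 : 0 < B.
Proof. by rewrite ltr_wpDl// mulr_ge0// sumr_ge0// => j _; exact: powR_ge0. Qed.
Let tN n : 0 < theta ^+ n. Proof. exact: exprn_gt0. Qed.

(** Scaling relation: frequency [K' / u] and side [u ^ (g + 1)] combine into a quantity linear in
    [u]. *)
Lemma powR_scale (K' u g : R) : 0 < u -> 0 <= K' ->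
  (K' / u) `^ g * u `^ (g + 1) = K' `^ g * u.
Proof.
move=> u0 K'0; rewrite powRM ?invr_ge0 ?(ltW u0)// -mulrA; congr (_ * _).
rewrite -(powR_inv1 (ltW u0)) -powRrM -powRD; last by apply/implyP => _; rewrite gt_eqF.
by rewrite mulN1r addrA addNr add0r powRr1// ltW.
Qed.

(** The frequency [a = K / theta ^ n] balances the two terms of the increment condition on a cell of
    depth [n]: both are of order [theta ^ n]. *)
Lemma tree_incr_le s t i :
  mom2 P (fun w => v (corner (s ++ t)) w 0 i - v (corner s) w 0 i) <=
  (c0 * B) ^+ 2 * theta ^+ (2 * size s).
Proof.
have tS := tN (size s).
have aK : K <= K / theta ^+ size s.
  by rewrite ler_pdivlMr// ger_pMr// exprn_ile1// ltW.
apply: (le_trans (@v_incr_le (K / theta ^+ size s) _ _ _ _ _ (cornerU _) (cornerU _))).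
- exact: le_trans aK.
- exact: lt_le_trans aK.
rewrite mulnC exprM -exprMn lerXn2r ?nnegrE//.
- rewrite mulr_ge0// addr_ge0// ?invr_ge0 ?divr_ge0 ?(ltW K0) ?(ltW tS)//.
  by rewrite sumr_ge0// => j _; rewrite mulr_ge0// powR_ge0.
- by rewrite !mulr_ge0// ltW.
rewrite -mulrA ler_wpM2l// /B mulrDl mul1r mulr_sumr mulr_suml; apply: lerD.
  apply: ler_sum => j _; rewrite -mulrA -(powR_scale _ tS (ltW K0)) mulrCA.
  by rewrite ler_wpM2l// powR_ge0.
by rewrite invf_div ler_pdivrMr// ler_peMr// ltW.
Qed.

Let annulus q m := ico (K / theta ^+ (m - q)) (K / theta ^+ (m + q))%:E.

(** Lowering the lower frequency by the factor [theta ^ q] gains [(theta ^ q) ^ gamma j] in the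
    first term of the increment condition; raising the upper one by the inverse factor gains
    [theta ^ q] in the second. *)
Lemma tree_residual_le q m s t i : (q <= m)%N -> size s = m -> forall ep : R, 0 <= ep ->
  (forall j, (theta ^+ q) `^ gamma j <= ep) -> theta ^+ q <= ep ->
  mom2 P (fun w =>
     (v (corner (rcons (s ++ t) true)) w 0 i -
      V (annulus q m) (corner (rcons (s ++ t) true)) w 0 i) -
     (v (corner (s ++ t)) w 0 i - V (annulus q m) (corner (s ++ t)) w 0 i)) <=
  (c0 * B * ep * theta ^+ m) ^+ 2.
Proof.
move=> qm sm ep ep0 epg ept.
have tm := tN m; have tq := tN q.
have aE : K / theta ^+ (m - q) = K * theta ^+ q / theta ^+ m.
  rewrite -{2}(subnK qm) exprD; field; rewrite !gt_eqF//.
have aK : K <= K / theta ^+ (m - q).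
  by rewrite ler_pdivlMr// ger_pMr// exprn_ile1// ltW.
apply: ico_incr_le => //.
- exact: le_trans aK.
- by rewrite ltW// (lt_le_trans K0).
- rewrite lee_fin ler_pM2l// lef_pV2 ?posrE// ler_wiXn2l ?ltW//.
  exact: leq_trans (leq_subr _ _) (leq_addr _ _).
rewrite inver gt_eqF ?divr_gt0// -EFinD -EFinM lee_fin -!mulrA ler_wpM2l// /B.
rewrite mulrDl mul1r mulr_sumr mulr_suml; apply: lerD; last first.
  rewrite invf_div ler_pdivrMr// exprD mulrC -[leRHS]mulrA [ep * _]mulrC.
  apply: (@le_trans _ _ (theta ^+ m * ep)); first by rewrite mulrC ler_wpM2l// ltW.
  by rewrite ler_wpM2r// ler_peMr// ltW.
apply: ler_sum => j _.
rewrite -cats1; apply: (@le_trans _ _ ((K * theta ^+ q / theta ^+ m) `^ gamma j *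
    (C * (theta ^+ m) `^ (gamma j + 1)))).
  rewrite aE ler_wpM2l ?powR_ge0//; apply: (le_trans (cornerC _ _ _)).
  rewrite ler_wpM2l// ge0_ler_powR ?nnegrE ?(ltW (tN _))//.
    by rewrite addr_ge0// ltW.
  by rewrite ler_wiXn2l ?ltW// size_cat sm leq_addr.
have Kq : 0 <= K * theta ^+ q by rewrite mulr_ge0// ltW.
rewrite mulrCA (powR_scale _ tm Kq) (powRM _ (ltW K0) (ltW tq)).
by rewrite -!mulrA !ler_wpM2l ?powR_ge0// ler_wpM2r// ltW.
Qed.

(** The bound of [tree_residual_le] is small but does not decay below [s]; the one from
    [residual_le] and [tree_incr_le] decays but is not small. Their geometric mean is small and
    still decays, at the rate [theta ^ size t]. *)
Lemma tree_scales (delta : R) : 0 < delta ->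
  exists q n1 (VV : nat -> seq bool -> 'I_d -> Omega -> R),
  [/\ forall m, (n1 <= m)%N -> forall s i, Vspan (VV m s i),
      forall m s i w, VV m (rcons s false) i w = VV m s i w,
      forall m s t i, (n1 <= m)%N -> size s = m ->
        mom2 P (fun w => (v (corner (rcons (s ++ t) true)) w 0 i - VV m (rcons (s ++ t) true) i w) -
           (v (corner (s ++ t)) w 0 i - VV m (s ++ t) i w)) <=
         delta * theta ^+ (2 * m) * theta ^+ size t
    & forall m m' (E F : set (seq bool * 'I_d -> R)), (n1 <= m)%N -> (m + q <= m')%N ->
        tset E -> tset F ->
        P ([set w | E (fun k => VV m k.1 k.2 w)] `&` [set w | F (fun k => VV m' k.1 k.2 w)]) =
        (P [set w | E (fun k => VV m k.1 k.2 w)] * P [set w | F (fun k => VV m' k.1 k.2 w)])%E].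
Proof.
move=> delta0; pose D := (c0 * B) ^+ 2.
have D0 : 0 <= D by exact: sqr_ge0.
pose ep := delta / (1 + D).
have D1 : 0 < 1 + D by rewrite ltr_pwDl.
have ep0 : 0 < ep by rewrite divr_gt0.
have [q [qg qt]] : exists q, (forall j, (theta ^+ q) `^ gamma j <= ep) /\ theta ^+ q <= ep.
  have [N1 H1] := @expr_small _ theta ep ltac:(by rewrite ltW) ep0.
  have th01 : 0 < theta < 1 by rewrite theta0.
  have [N2 H2] := expr_powR_small th01 gamma_gt0 ep0.
  exists (maxn N1 N2); split => [|]; first by apply: H2; exact: leq_maxr.
  by apply: H1; exact: leq_maxl.
pose A := annulus q.
have bA m : borelRp (A m) by apply: borelRp_ico; rewrite divr_ge0// ltW.
(* Levels at distance [2 q] have disjoint annuli, and [m >= q] makes the subtraction [m - q]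
   exact. *)
exists (q + q)%N, q, (fun m s i w => V (A m) (corner s) w 0 i); split.
- by move=> m _ s i; exact: Vspan_V.
- by move=> m s i w; rewrite corner_false.
- move=> m s t i qm sm.
  have h1 := @tree_residual_le q m s t i qm sm ep (ltW ep0) qg qt.
  have incr := tree_incr_le (s ++ t) [:: true] i; rewrite cats1 in incr.
  have h2 := le_trans (residual_le i (bA m) (cornerU (rcons (s ++ t) true))
    (cornerU (s ++ t))) incr.
  move: h1 h2 => /=; set x := mom2 _ _ => h1 h2.
  have x0 : 0 <= x by exact: mom2_ge0.
  have xx : x * x <= (delta * theta ^+ (2 * m) * theta ^+ size t) ^+ 2.
    apply: (@le_trans _ _ ((c0 * B * ep * theta ^+ m) ^+ 2 *
        ((c0 * B) ^+ 2 * theta ^+ (2 * size (s ++ t))))).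
      exact: ler_pM.
    rewrite size_cat sm mulnDr exprD (_ : _ * _ = (D * ep) ^+ 2 *
       (theta ^+ (2 * m) * theta ^+ size t) ^+ 2).
      rewrite -[in leRHS]mulrA [leRHS]exprMn ler_wpM2r ?sqr_ge0//.
      have De : D * ep <= delta.
        by rewrite /ep mulrCA ger_pMr// ler_pdivrMr// mul1r lerDr.
      have De0 : 0 <= D * ep := mulr_ge0 D0 (ltW ep0).
      by rewrite lerXn2r ?nnegrE// ltW.
    by rewrite /D [(2 * m)%N]mulnC [(2 * size t)%N]mulnC !exprM; ring.
  by rewrite -(@ler_pXn2r _ 2)// ?nnegrE// ?expr2// !mulr_ge0// ltW.
- move=> m m' E F qm mm' tE tF.
  have AA : A m `&` A m' = set0.
    apply/seteqP; split => u //= [[_ um] [um' _]].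
    move: um; rewrite lte_fin => /(le_lt_trans um'); rewrite ltNge => /negP; apply.
    rewrite ler_pM2l// lef_pV2 ?posrE// ler_wiXn2l ?ltW//.
    by have := leq_sub2r q mm'; rewrite addnA addnK.
  pose E' (H : set (seq bool * 'I_d -> R)) :=
    [set f : 'rV[R]_k * 'I_d -> R | H (fun k => f (corner k.1, k.2))].
  have tE' H : tset H -> tset (E' H) by exact: tset_reindex.
  apply: (V_indep (bA m) (bA m') AA).
  - exact: (@tset_sigma_of _ _ _ _ 
      (fun (xi : 'rV[R]_k * 'I_d) w => V (A m) xi.1 w 0 xi.2) _ (tE' _ tE)).
  - exact: (@tset_sigma_of _ _ _ _ 
      (fun (xi : 'rV[R]_k * 'I_d) w => V (A m') xi.1 w 0 xi.2) _ (tE' _ tF)).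
Qed.

End WhiteNoise.

(** * The local statement *)

Lemma enorm_lt (R : realType) n (x : 'rV[R]_n) (e : R) : 0 < e ->
  (forall j, `|x 0 j| <= e / n.+1%:R) -> enorm x < e.
Proof.
move=> e0 xe; have n0 : 0 < n.+1%:R :> R by rewrite ltr0n.
rewrite /enorm -[ltRHS]ger0_norm ?(ltW e0)// -sqrtr_sqr ltr_sqrt ?exprn_gt0//.
apply: (@le_lt_trans _ _ (\sum_(j < n) (e / n.+1%:R) ^+ 2)).
  apply: ler_sum => j _; rewrite -(real_normK (num_real _)) lerXn2r ?nnegrE//.
  by rewrite divr_ge0// ltW.
rewrite sumr_const card_ord -[ltLHS]mulr_natl expr_div_n.
rewrite mulrCA gtr_pMr ?exprn_gt0// ltr_pdivrMr ?exprn_gt0// mul1r -natrX ltr_nat.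
by apply: (leq_trans (ltnSn n)); rewrite expnS expn1 leq_pmulr.
Qed.

Lemma continuous_coord (R : realType) m n (f : 'rV[R]_m -> 'rV[R]_n)
    (x : 'rV[R]_m) (e : R) :
  continuous f -> 0 < e -> exists2 r : R, 0 < r & forall y : 'rV[R]_m,
    (forall j, `|y 0 j - x 0 j| <= r) -> forall i, `|f y 0 i - f x 0 i| <= e.
Proof.
move=> cf e0; have /nbhs_ballP[r /= r0 hr] := cf x _ (nbhsx_ballx (f x) _ e0).
exists (r / 2) => [|y yx i]; first exact: divr_gt0.
have : ball (f x) e (f y).
  apply: hr; split => // i' j; rewrite ord1 /ball/= distrC; apply: le_lt_trans (yx j) _.
  by rewrite ltr_pdivrMr// ltr_pMr// ltr1n.
by move=> [_ /(_ 0 i)]; rewrite /ball/= distrC => /ltW.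
Qed.

Section Local.
Context {R : realType} {disp : measure_display} {Omega : measurableType disp}.
Variable P : probability Omega R.
Context {k d : nat}.
Variables (v : 'rV[R]_k -> Omega -> 'rV[R]_d) (gamma : 'I_k -> R).
Hypothesis v_gaussian : gaussian_field P [set: 'rV[R]_k] v.
Hypothesis v_centered : centered_field P v.
Hypothesis v_continuous : forall w : Omega, continuous (fun x : 'rV[R]_k => v x w).
Hypothesis v_iid : iid_components P v.
Hypothesis gamma_gt0 : forall j, 0 < gamma j.
Hypothesis Qd : \sum_(j < k) (gamma j + 1) = d%:R.

Let W (p : 'rV[R]_k * 'I_d) w : R := v p.1 w 0 p.2.

Lemma W_gauss s : gaussian_rv P (fun w => lform s (W ^~ w)).
Proof. exact: (gaussian_field_lform snd v_gaussian). Qed.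

Lemma W_centered p : ('E_P[W p] = 0)%E. Proof. exact: v_centered. Qed.

Lemma v_cg x i : centered_gaussian P (fun w => v x w 0 i).
Proof. exact: (centered_gaussian1 W_gauss W_centered (x, i)). Qed.

Lemma v_meas x i : measurable_fun setT (fun w => v x w 0 i).
Proof. exact: (v_cg x i).1. Qed.

Lemma v_indep (x : 'rV[R]_k) (i j : 'I_d) (A B : set R) :
  i != j -> measurable A -> measurable B ->
  P ((fun w => v x w 0 i) @^-1` A `&` (fun w => v x w 0 j) @^-1` B) =
  (P ((fun w => v x w 0%R i) @^-1` A) * P ((fun w => v x w 0%R j) @^-1` B))%E.
Proof.
move=> ij mA mB.
pose E l := if l == i then (fun w => v x w 0 i) @^-1` A else
            if l == j then (fun w => v x w 0 j) @^-1` B else setT.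
have sE l : sigma_of (fun t w => v t w 0 l) (E l).
  rewrite /E; case: eqVneq => [->|li].
    by apply: sub_sigma_algebra; exists x => //; exists A => //; rewrite setTI.
  case: eqVneq => [->|lj].
    by apply: sub_sigma_algebra; exists x => //; exists B => //; rewrite setTI.
  exact: (@measurableT _ (g_sigma_algebraType _)).
have := v_iid.1 [set i; j]%SET E sE.
rewrite big_setU1 ?big_set1 ?inE//= /E eqxx eq_sym (negbTE ij) eqxx => <-.
congr (P _); apply/seteqP; split => w.
  move=> [wA wB] l /=; rewrite !inE => /orP[] /eqP ->; first by rewrite eqxx.
  by rewrite eq_sym (negbTE ij) eqxx.
move=> h; split.
  by have := h i; rewrite /= !inE eqxx => /(_ isT).
by have := h j; rewrite /= !inE eqxx orbT eq_sym (negbTE ij) => /(_ isT).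
Qed.

(** A single term [gamma j + 1] already exceeds 1. This provides the two independent components for
    [gauss_charD]. *)
Lemma d_gt1 : (0 < d)%N -> (1 < d)%N.
Proof.
move=> d0.
have j0 : 'I_k.
  case: k gamma Qd => [|k'] ? => [|_]; last exact: ord0.
  by rewrite big_ord0 => /esym/eqP; rewrite pnatr_eq0 -leqn0 leqNgt d0.
rewrite -(ltr_nat R) -Qd (bigD1 j0)//=.
have := gamma_gt0 j0; set S := \sum_(_ | _) _ => g0.
have S0 : 0 <= S by apply: sumr_ge0 => j _; rewrite addr_ge0// ltW.
by lra.
Qed.

Section LocalNull.
Variables (lo hi x0 : 'rV[R]_k) (eps0 : R) (z : 'rV[R]_d).
Hypothesis x0_in : closed_box lo hi x0.
Hypothesis eps0_gt0 : 0 < eps0.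
Hypothesis HA : assumptionA P gamma v (closed_box lo hi) eps0.
Hypothesis HB : assumptionB P gamma v (closed_box lo hi) eps0.
Let U := enlargement (closed_box lo hi) eps0.

(** Stated as negligibility: the set is contained in the measurable event that the corners of the
    tree approach [z], which is all that its definition gives directly. *)
Lemma local_null : exists2 rho : R, 0 < rho &
  P.-negligible [set w |
    exists2 x : 'rV[R]_k, (forall j, `|x 0 j - x0 0 j| <= rho) & v x w = z].
Proof.
have [V [V_gauss V_noise V_indep [c0 [a0 [c0_ge0 _ V_incr _]]]]] := HA.
have Ux0 : U x0 by exists x0 => //; rewrite subrr /enorm big1 ?sqrtr0// => j _; rewrite mxE expr0n.
have [[c [ct [_ ct0 HBa]]] _] := HB.
have [i0 vi0] := L2norm_gt0 (v_cg x0) ct0 (HBa x0 x0 Ux0 Ux0).2.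
have d0 : (0 < d)%N by case: i0 {vi0} => ?; exact: leq_ltn_trans.
have gL := Vspan_gaussian V_gauss V_noise.
have [a [sg [a0a a_ge0 sg0 GG]]] := 
  noise_variance a0 v_meas V_gauss V_noise Ux0 (ex_intro _ i0 vi0).
have bA : borelRp (ico 0 a%:E) by exact: borelRp_ico.
pose G (j : 'I_d) w : R := V (ico 0 a%:E) x0 w 0 j.
have LG j : Vspan P U V (G j) by exact: (Vspan_V V_gauss V_noise j bA Ux0).
have alx0 i j : ip P (fun w => v x0 w 0 i) (G j) = if i == j then sg else 0.
  by rewrite (ip_v_V v_meas V_gauss V_noise V_indep i j bA Ux0) GG.
have charD : forall a b : R, 0 <= a -> 0 <= b -> gauss_char (a + b) = gauss_char a * gauss_char b.
  have d1 := d_gt1 d0; pose i1 := Ordinal d0; pose i2 := Ordinal d1.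
  (* All components of [v x0] have as variance the measure of the half-line, so none is
     degenerate. *)
  have vV i : mom2 P (fun w => v x0 w 0 i) = mom2 P (fun w => v x0 w 0 i0).
    have [[nu WN] _] := V_noise _ Ux0.
    by apply: EFin_inj; rewrite !(v_variance v_meas V_gauss V_noise _ WN Ux0).
  apply: (@gauss_charD _ _ _ _ _ (fun w => v x0 w 0 i1) (fun w => v x0 w 0 i2)
    (ae_span_gaussian_space W_gauss W_centered)).
  - apply: (@ae_span1 _ _ _ _ _ _ (x0, i1)); [exact: v_meas|exact: nearW].
  - apply: (@ae_span1 _ _ _ _ _ _ (x0, i2)); [exact: v_meas|exact: nearW].
  - exact: v_centered.
  - by rewrite vV.
  - by rewrite vV.
  - by move=> A B; exact: v_indep.
pose theta : R := 2^-1 `^ (d%:R^-1).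
have theta0 : 0 < theta by rewrite powR_gt0// invr_gt0.
have thetad : theta ^+ d = 2^-1.
  by rewrite -powR_mulrn ?(ltW theta0)// -powRrM mulVf ?powRr1// pnatr_eq0 -lt0n.
have theta1 : theta < 1.
  rewrite ltNge; apply/negP => h; have : 1 <= theta ^+ d by exact: exprn_ege1.
  by rewrite thetad; lra.
pose S := c0 * \sum_(j < k) a `^ gamma j.
have S0 : 0 <= S by rewrite mulr_ge0// sumr_ge0// => j _; exact: powR_ge0.
have sg1 : 0 < 1 + sg by rewrite ltr_pwDl// ltW.
have dR : 0 < d%:R :> R by rewrite ltr0n.
(* Chosen so that the [d] terms [be * (1 + sg) / 2 / sg] of a row add up to 1/2. *)
pose be := sg / (d%:R * (1 + sg)).
have be0 : 0 < be by rewrite divr_gt0// mulr_gt0.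
(* The first bound keeps the tree inside [U]; the second keeps [projG] close to the identity, its
   value at [x0]. *)
pose r := Num.min (eps0 / k.+1%:R) (be / (S + 1)).
have S1 : 0 < S + 1 by rewrite ltr_wpDl.
have r0 : 0 < r by rewrite lt_min; apply/andP; split; apply: divr_gt0.
have [corner [C [rho [corner_false [C0 cornerC] cornerr [rho0 dense]]]]] :=
  @anisotropic_tree R k d gamma theta x0 r gamma_gt0 Qd d0 theta0 thetad r0.
have cornerU s : U (corner s).
  exists x0 => //; apply: enorm_lt => // j; rewrite !mxE; apply: (le_trans (cornerr s j)).
  by rewrite ge_min lexx.
pose X s (i : 'I_d) w : R := v (corner s) w 0 i.
have LX s i : Vspan P U V (X s i) by exact: (Vspan_v v_meas V_noise i (cornerU s)).
have X0 s i w : X (rcons s false) i w = X s i w by rewrite /X corner_false.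
have mG j : mom2 P (G j) = sg by rewrite mom2E GG eqxx.
have lip x y i j e : 0 < e -> U x -> U y ->
    c0 * \sum_(j < k) a `^ gamma j * `|x 0 j - y 0 j| <= e ->
    `|ip P (fun w => v x w 0 i) (G j) - ip P (fun w => v y w 0 i) (G j)| <= e * (1 + sg) / 2.
  move=> e0 Ux Uy hx; rewrite -(mG j).
  exact: (ip_G_lip v_meas V_gauss V_noise V_indep V_incr).
have projG_near s i : \sum_j `|projG P X G sg s i j - (i == j)%:R| <= 2^-1.
  apply: (@le_trans _ _ (\sum_(j < d) be * (1 + sg) / 2 / sg)).
    apply: ler_sum => j _.
    have -> : projG P X G sg s i j - (i == j)%:R =
      (ip P (fun w => v (corner s) w 0 i) (G j) - ip P (fun w => v x0 w 0 i) (G j)) / sg.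
      by rewrite alx0 mulrBl /projG; congr (_ - _); case: eqP => _; rewrite ?mul0r// divff// gt_eqF.
    rewrite normrM normfV (gtr0_norm sg0) ler_pM2r ?invr_gt0//.
    apply: lip => //.
    apply: (@le_trans _ _ (S * r)).
      rewrite /S -mulrA ler_wpM2l// mulr_suml; apply: ler_sum => l _.
      by rewrite ler_wpM2l ?powR_ge0.
    have rb : r <= be / (S + 1) by rewrite ge_min lexx orbT.
    apply: (le_trans (ler_wpM2l S0 rb)); rewrite mulrCA ger_pMr// ler_pdivrMr// mul1r.
    by rewrite lerDl.
  rewrite sumr_const card_ord -[leLHS]mulr_natl le_eqVlt; apply/orP; left; apply/eqP.
  by rewrite /be; field; rewrite !gt_eqF.
have projG_osc (e : R) : 0 < e -> exists N : nat, forall s t i j,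
    (N <= size s)%N -> `|projG P X G sg (s ++ t) i j - projG P X G sg s i j| <= e * theta ^+ size s.
  (* The coefficients are Lipschitz, and the sides are [theta ^ (n (gamma_l + 1))] up to a constant:
     the factor [theta ^ (n gamma_l)] supplies the smallness. *)
  move=> e0; pose e' := e * sg / (1 + sg).
  have e'0 : 0 < e' by rewrite divr_gt0// mulr_gt0.
  have SC1 : 0 < S * C + 1 by rewrite ltr_wpDl// mulr_ge0.
  have th01 : 0 < theta < 1 by rewrite theta0.
  have [N HN] := expr_powR_small th01 gamma_gt0 (divr_gt0 e'0 SC1).
  exists N => s t i j Ns; set n := size s.
  have tn : 0 < theta ^+ n by exact: exprn_gt0.
  rewrite /projG -mulrBl normrM normfV (gtr0_norm sg0) ler_pdivrMr//.
  apply: (@le_trans _ _ (e' * theta ^+ n * (1 + sg) / 2)).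
    apply: lip => //; first exact: mulr_gt0.
    apply: (@le_trans _ _ (S * (C * ((e' / (S * C + 1)) * theta ^+ n)))).
      rewrite /S -mulrA ler_wpM2l// mulr_suml; apply: ler_sum => l _.
      rewrite ler_wpM2l ?powR_ge0//; apply: (le_trans (cornerC _ _ _)).
      rewrite ler_wpM2l// powRD; last by apply/implyP => _; rewrite gt_eqF.
      by rewrite powRr1 ?(ltW tn)// ler_wpM2r ?(ltW tn)// HN.
    have hq : S * C / (S * C + 1) <= 1 by rewrite ler_pdivrMr// mul1r lerDl.
    rewrite [leLHS](_ : _ = S * C / (S * C + 1) * (e' * theta ^+ n)).
      by rewrite ger_pMl// mulr_gt0.
    by move: (S) (e') (theta ^+ n) SC1 => *; field; rewrite gt_eqF.
  have -> : e' * theta ^+ n * (1 + sg) / 2 = e * theta ^+ n * sg / 2.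
    by rewrite /e'; field; rewrite gt_eqF.
  have : 0 < e * theta ^+ n * sg by rewrite !mulr_gt0.
  by lra.
have XA s i : mom2 P (fun w => X (rcons s true) i w - X s i w) <=
    (c0 * (C * (\sum_j (Num.max a0 1) `^ gamma j) + 1)) ^+ 2 * theta ^+ (2 * size s).
  rewrite -cats1.
  exact: (tree_incr_le v_meas V_gauss V_noise V_incr).
have scales := tree_scales v_meas V_gauss V_noise V_indep V_incr theta0 theta1 c0_ge0 gamma_gt0 C0
  cornerU corner_false cornerC.
have bads := bad_small gL charD theta0 d0 thetad LX X0 (sqr_ge0 _) XA scales.
have null := core_null gL charD LX X0 LG sg0 GG projG_near (fun i => z 0 i) theta0 d0 thetad
  (sqr_ge0 _) XA projG_osc bads.
exists rho => //.
have nn : P.-negligible [set w | hit (fun i => z 0 i) [::] (fun k => X k.1 k.2 w)].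
  apply/negligibleP => //.
  by apply: tset_measurable; [move=> k'; exact: v_meas|exact: tset_hit].
apply: negligibleS nn.
move=> w [x xr vx] m.
have m0 : 0 < m.+1%:R^-1 :> R by rewrite invr_gt0 ltr0n.
have [e e0 he] := continuous_coord x (@v_continuous w) m0.
have [t ht] := dense x xr e e0.
by exists t => i; rewrite -vx; exact: he.
Qed.

End LocalNull.
End Local.

(** * The global statement *)

Section Box.
Context {R : realType} {k : nat}.
Implicit Types (lo hi x : 'rV[R]_k).

Lemma closed_box_compact lo hi : compact (closed_box lo hi).
Proof.
have := @rV_compact R k (fun j => `[lo 0 j, hi 0 j]%classic) (fun=> @segment_compact _ _ _).
congr compact; apply/seteqP; split => x h j; have := h j; rewrite /= in_itv/=;
  by rewrite (_ : ord0 = 0)//.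
Qed.

(** [Num.min 1] keeps every grid point in the box, so the dense family is indexed by a plain
    countable type. *)
Definition grid lo hi (q : nat * {ffun 'I_k -> nat}) : 'rV[R]_k :=
  \row_j (lo 0 j + Num.min 1 ((q.2 j)%:R / q.1.+1%:R) * (hi 0 j - lo 0 j)).

Lemma grid_in lo hi q : box_ends lo hi -> closed_box lo hi (grid lo hi q).
Proof.
move=> bx j; rewrite mxE; have b0 : 0 < hi 0 j - lo 0 j by rewrite subr_gt0.
have m0 : 0 <= Num.min 1 ((q.2 j)%:R / q.1.+1%:R) :> R by rewrite le_min ler01 divr_ge0.
by rewrite lerDl mulr_ge0 ?(ltW b0)//= -lerBrDl ger_pMl// ge_min lexx.
Qed.

Lemma grid_dense lo hi x (e : R) : box_ends lo hi -> closed_box lo hi x -> 0 < e ->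
  exists q, forall j, `|grid lo hi q 0 j - x 0 j| <= e.
Proof.
move=> bx xb e0; pose S := \sum_j (hi 0 j - lo 0 j).
have b0 j : 0 < hi 0 j - lo 0 j by rewrite subr_gt0.
pose N := Num.truncn (S / e).
have NS : S / e < N.+1%:R by exact: truncnS_gt.
have N0 : 0 < N.+1%:R :> R by rewrite ltr0n.
pose u j := (x 0 j - lo 0 j) / (hi 0 j - lo 0 j).
have u0 j : 0 <= u j by rewrite divr_ge0 ?(ltW (b0 j))// subr_ge0; case/andP: (xb j).
have u1 j : u j <= 1.
  by rewrite ler_pdivrMr// mul1r lerD2r; case/andP: (xb j).
exists (N, [ffun j => Num.truncn (u j * N.+1%:R)]) => j; rewrite mxE ffunE /=.
set f := Num.truncn _.
have f1 : f%:R <= u j * N.+1%:R by rewrite truncn_le mulr_ge0// ltW.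
have f2 : u j * N.+1%:R < f.+1%:R by exact: truncnS_gt.
have g1 : f%:R / N.+1%:R <= u j by rewrite ler_pdivrMr.
have g2 : u j - f%:R / N.+1%:R <= N.+1%:R^-1.
  by rewrite lerBlDr -[X in X + _]mul1r -mulrDl ler_pdivlMr// addrC natr1 ltW.
rewrite min_r; last exact: le_trans (u1 j).
have -> : lo 0 j + f%:R / N.+1%:R * (hi 0 j - lo 0 j) - x 0 j =
    - ((u j - f%:R / N.+1%:R) * (hi 0 j - lo 0 j)).
  by rewrite mulrBl divfK ?gt_eqF//; ring.
rewrite normrN ger0_norm ?mulr_ge0 ?subr_ge0// ?(ltW (bx j))//.
apply: (@le_trans _ _ (N.+1%:R^-1 * S)).
  apply: ler_pM; [by rewrite subr_ge0|exact: ltW|exact: g2|].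
  by rewrite /S (bigD1 j)//= lerDl sumr_ge0// => i _; exact: ltW.
by rewrite mulrC ler_pdivrMr// -ler_pdivrMl// mulrC ltW.
Qed.

Lemma cube_diameter x (e : R) : 0 < e ->
  exists lo hi, [/\ box_ends lo hi, closed_box lo hi x & diameter (closed_box lo hi) < e].
Proof.
move=> e0; pose r := e / 4 / k.+1%:R.
have r0 : 0 < r by rewrite !divr_gt0// ltr0n.
exists (\row_j (x 0 j - r)), (\row_j (x 0 j + r)); split => [j|j|].
- by rewrite !mxE; lra.
- by rewrite !mxE; lra.
apply: (@le_lt_trans _ _ (e / 2 + e / 4)); last by lra.
apply: ge_sup.
  exists (enorm (x - x)), x, x; split => // j; rewrite !mxE; lra.
move=> _ [y [y' [hy hy' ->]]]; apply: ltW; apply: enorm_lt => [|j]; first by lra.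
have := hy j; have := hy' j; rewrite !mxE => h1 h2.
have -> : (e / 2 + e / 4) / k.+1%:R = 3 * r by rewrite /r; field; rewrite addr_eq0 // gt_eqF.
by rewrite ler_norml; lra.
Qed.

End Box.

Theorem theorem2p6 (R : realType) (disp : measure_display)
    (Omega : measurableType disp) (P : probability Omega R) (k d : nat)
    (v : 'rV[R]_k -> Omega -> 'rV[R]_d) (gamma : 'I_k -> R)
    (v_gaussian : gaussian_field P [set: 'rV[R]_k] v)
    (v_centered : centered_field P v)
    (v_continuous : forall w : Omega, continuous (fun x : 'rV[R]_k => v x w))
    (v_iid : iid_components P v)
    (gamma_gt0 : forall j, 0 < gamma j)
    (eta : R) (eta_gt0 : 0 < eta)
    (assumptionsAB : forall lo hi : 'rV[R]_k, box_ends lo hi ->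
      diameter (closed_box lo hi) < eta ->
      exists eps0 : R, [/\ 0 < eps0,
        assumptionA P gamma v (closed_box lo hi) eps0 &
        assumptionB P gamma v (closed_box lo hi) eps0])
    (Q_eq_d : \sum_(j < k) (gamma j + 1) = d%:R) :
  forall lo hi : 'rV[R]_k, box_ends lo hi ->
  forall z : 'rV[R]_d,
    P [set w | exists2 x, closed_box lo hi x & v x w = z] = 0%E.
Proof.
move=> lo hi bx z; set H := [set w | _].
have /choice[rho Hrho] (x0 : 'rV[R]_k) : exists rho : R, 0 < rho /\ P.-negligible [set w |
    exists2 x : 'rV[R]_k, (forall j, `|x 0 j - x0 0 j| <= rho) & v x w = z].
  have [l [h [lh xlh dlh]]] := @cube_diameter R k x0 eta eta_gt0.
  have [eps0 [eps0_gt0 HA HB]] := assumptionsAB l h lh dlh.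
  have [rho r0 Hr] := local_null v_gaussian v_centered v_continuous v_iid gamma_gt0
    Q_eq_d z xlh eps0_gt0 HA HB.
  by exists rho.
apply: measure_negligible.
  (* Measurability: by continuity and compactness, hitting [z] means that the countable grid comes
     arbitrarily close to it. *)
  rewrite (_ : H = [set w | approached (fun i => z 0 i)
      (fun p : (nat * {ffun 'I_k -> nat}) * 'I_d => v (grid lo hi p.1) w 0 p.2)]).
    apply: (@tset_measurable _ _ _ _
      (fun (p : (nat * {ffun 'I_k -> nat}) * 'I_d) w => v (grid lo hi p.1) w 0 p.2)).
      by move=> p; exact: (v_meas v_gaussian v_centered).
    exact: tset_approached.
  apply/seteqP; split => w.
    move=> [x xb vx] m; have m0 : 0 < m.+1%:R^-1 :> R by rewrite invr_gt0 ltr0n.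
    have [e e0 he] := continuous_coord x (@v_continuous w) m0.
    have [q hq] := grid_dense bx xb e0.
    by exists q => i /=; rewrite -vx; exact: he.
  move=> hw; pose f x := `|v x w - z|.
  have cf : continuous f.
    by move=> x; exact: (cvg_norm (cvgB (@v_continuous w x) (cvg_cst z))).
  have box0 : closed_box lo hi !=set0.
    by exists lo => j; rewrite lexx ltW.
  (* The distance to [z] attains its minimum on the compact box, and the grid points force this
     minimum to be 0. *)
  have [c cK cmin] := EVT_min_rV box0 (@closed_box_compact R k lo hi) (continuous_subspaceT cf).
  exists c; first by rewrite inE in cK.
  apply/eqP; rewrite -subr_eq0 -normr_eq0 eq_le normr_ge0 andbT; apply/ler_addgt0Pr => e e0.
  have [q hq] := hw (Num.truncn e^-1).
  apply: (le_trans (cmin (grid lo hi q) _)); first by rewrite inE; exact: grid_in.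
  rewrite add0r /f [leLHS]/Num.norm /= mx_normrE; apply: bigmax_le => [|[i j] _]; first exact: ltW.
  by rewrite !mxE/= ord1; exact: le_trans (hq j) (truncnS_inv_le e0).
(* Finitely many of the neighbourhoods from [local_null] cover the box; balls are those of the sup
   norm, matching the coordinatewise condition there. *)
have cov : closed_box lo hi `<=` cover setT (fun x0 => ball x0 (rho x0)).
  by move=> x _; exists x => //; apply: ballxx; exact: (Hrho x).1.
have := @closed_box_compact R k lo hi; rewrite compact_cover => /(_ _ _ _ _ cov).
move=> [x0 _|D _ HD]; first by apply: ball_open; exact: (Hrho x0).1.
have /finite_seqP[s Ds] := finite_fset D; rewrite Ds in HD.
have negs : P.-negligible (\big[setU/set0]_(x0 <- s) [set w |
    exists2 x : 'rV[R]_k, (forall j, `|x 0 j - x0 0 j| <= rho x0) & v x w = z]).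
  apply: (big_ind (fun A => P.-negligible A)); first exact: negligible_set0.
    by move=> A B; exact: negligibleU.
  by move=> x0 _; exact: (Hrho x0).2.
apply: negligibleS negs => w [x xb vx]; rewrite -bigcup_seq.
have [x0 sx0 [_ hx]] := HD x xb.
exists x0 => //; exists x => // j; have := hx 0 j; rewrite /ball/= distrC; exact: ltW.
Qed.
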